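(* Consider the uniform spanning forest (USF) in $\mathbb{Z}^d$. For a nonempty finite set $W\subset\mathbb{Z}^d$, denote by $U(W)$ the event that all vertices in $W$ are in the same USF component. Then there is a constant $C<\infty$ depending only on $d$ and on the cardinality $|W|$ such that $$\mathbf{P}[U(W)]\le C\,\langle W\rangle^{4-d}.$$
   Context: The uniform spanning forest (USF) in $\mathbb{Z}^d$ (nearest-neighbour graph) is the random subgraph whose law is the weak limit, as $n\to\infty$, of the uniform spanning trees (spanning trees chosen uniformly among all spanning trees) in the boxes $[-n,n]^d$; the limit is known to exist. For $x,y\in\mathbb{Z}^d$ write $\langle xy\rangle:=1+\|x-y\|_1$. For a nonempty finite set $W\subset\mathbb{Z}^d$, the spread of $W$ is $\langle W\rangle:=\min_\tau\prod_{\{x,y\}\in\tau}\langle xy\rangle$, where $\tau$ ranges over all trees on the vertex set $W$ (not necessarily subgraphs of $\mathbb{Z}^d$) and the product is over the undirected edges of $\tau$ (an empty product is $1$). *)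

(* Defs.v *)
From HB Require Import structures.
From mathcomp Require Import all_boot all_order all_algebra finmap.
From mathcomp Require Import all_classical all_reals all_analysis.
Import Order.TTheory GRing.Theory Num.Theory.
Import numFieldNormedType.Exports.

Set Implicit Arguments.
Unset Strict Implicit.
Unset Printing Implicit Defensive.

Section Trees.
Variable V : finType.

(* A graph on V is given by its set of undirected edges, each edge being the
   pair of its endpoints. *)
Definition adj (T : {set {set V}}) : rel V :=
  fun x y => [set x; y]%SET \in T.

Definition is_tree (T : {set {set V}}) : Prop :=
  [/\ forall e, e \in T -> #|e| = 2,
      forall x y, connect (adj T) x y
    & forall c : seq V, (2 < size c)%N -> uniq c -> ~~ cycle (adj T) c].

Definition trees : {set {set {set V}}} := [set T | `[< is_tree T >]]%SET.

Definition spanning_trees (g : rel V) : {set {set {set V}}} :=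
  [set T in trees | [forall x, forall y, adj T x y ==> g x y]]%SET.

End Trees.

Local Open Scope ring_scope.

Definition vertex (d : nat) := 'rV[int]_d.

Definition l1dist (d : nat) (x y : vertex d) : nat :=
  (\sum_(i < d) `|x ord0 i - y ord0 i|)%N.

Definition nn (d : nat) : rel (vertex d) := fun x y => l1dist x y == 1%N.

Definition box (d n : nat) : {fset vertex d} :=
  [fset (\row_i ((k ord0 i)%:Z - n%:Z) : vertex d) |
     k : 'rV['I_n.*2.+1]_d in [set: 'rV['I_n.*2.+1]_d]%SET]%fset.

(* The edge (x, i) joins x and x + e_i, so each undirected nearest-neighbour
   edge occurs exactly once. *)
Definition edge (d : nat) : Type := (vertex d * 'I_d)%type.

Definition edge_head (d : nat) (e : edge d) : vertex d := e.1 + delta_mx ord0 e.2.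

Definition config (d : nat) : Type := prod_topology (fun _ : edge d => bool).

HB.instance Definition _ (d : nat) := Pointed.on (config d).
HB.instance Definition _ (d : nat) := Nbhs.on (config d).
HB.instance Definition _ (d : nat) := Topological.on (config d).

Definition borel_config (d : nat) := g_sigma_algebraType (@open (config d)).

Definition config_adj (d : nat) (w : config d) : rel (vertex d) :=
  fun x y => [exists i : 'I_d,
    (w (x, i) && (y == edge_head (x, i))) || (w (y, i) && (x == edge_head (y, i)))].

Definition same_component (d : nat) (w : config d) (x y : vertex d) : Prop :=
  exists2 p : seq (vertex d), path (config_adj w) x p & last x p = y.

Definition event_U (d : nat) (W : {fset vertex d}) : set (borel_config d) :=
  [set w | forall x y, x \in W -> y \in W -> same_component w x y]%classic.

Definition box_trees (d n : nat) : {set {set {set box d n}}} :=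
  spanning_trees (fun x y : box d n => nn (val x) (val y)).

Definition tree_config (d n : nat) (T : {set {set box d n}}) : config d :=
  fun e => [exists x : box d n, exists y : box d n,
    [&& val x == e.1, val y == edge_head e & adj T x y]].

Definition ust_mean (R : realType) (d n : nat) (f : config d -> R) : R :=
  (\sum_(T in box_trees d n) f (tree_config T)) / #|box_trees d n|%:R.

Definition is_USF (R : realType) (d : nat)
    (P : probability (borel_config d) R) : Prop :=
  forall f : config d -> R, continuous f ->
    (exists M : R, forall w, `|f w| <= M) ->
    ((ust_mean n f)%:E @[n --> \oo] --> 'E_P[f : borel_config d -> R]%E)%classic.

Definition bracket (d : nat) (x y : vertex d) : nat := (1 + l1dist x y)%N.

(* For an edge {x, y} the maximum is attained at its endpoints and is <xy>,
   because <xx> = 1. *)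
Definition edge_bracket (d : nat) (W : {fset vertex d}) (e : {set W}) : nat :=
  (\max_(x in e) \max_(y in e) bracket (val x) (val y))%N.

Definition tree_weight (d : nat) (W : {fset vertex d}) (T : {set {set W}}) : nat :=
  (\prod_(e in T) edge_bracket e)%N.

(* [arg min] only falls back on the default set0 when W carries no tree,
   which by spread_min never happens for W nonempty. *)
Definition spread (d : nat) (W : {fset vertex d}) : nat :=
  tree_weight [arg min_(T < finset.set0 in trees W) tree_weight T]%N.

Lemma star_tree (V : finType) (r : V) :
  is_tree [set [set r; x]%SET | x in [set~ r]%SET]%SET.
Proof.
set T := finset.imset _ _.
have adjE x y : adj T x y -> x = r \/ y = r.
  rewrite /adj => /imsetP[z _ E]; have : r \in [set x; y]%SET by rewrite E set21.
  by rewrite !inE => /orP[] /eqP ->; auto.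
have rx x : x != r -> adj T r x.
  by move=> xr; apply/imsetP; exists x => //; rewrite !inE.
have sym x y : adj T x y = adj T y x by rewrite /adj finset.setUC.
split.
- move=> e /imsetP[x]; rewrite !inE => xr ->; by rewrite cards2 eq_sym xr.
- have c x : connect (adj T) r x.
    by case: (eqVneq x r) => [->//|xr]; apply: connect1; exact: rx.
  move=> x y; apply: connect_trans (c y).
  by rewrite (sym_connect_sym sym).
- move=> [|a [|b [|c s]]] //= _ /and4P[].
  rewrite !inE !negb_or => /and3P[ab ac as_] /andP[bc bs] cs us.
  apply/negP => /and3P[Hab Hbc H].
  have br : b = r.
    case: (adjE _ _ Hab) => // ar; case: (adjE _ _ Hbc) => // cr.
    by move: ac; rewrite ar cr eqxx.
  case: s as_ bs cs us H => [|e s] /=.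
    move=> _ _ _ _ /andP[/adjE[] E _]; first by rewrite E br eqxx in bc.
    by rewrite E br eqxx in ab.
  rewrite !inE !negb_or => _ /andP[be _] _ _ /andP[/adjE[] E _].
    by rewrite E br eqxx in bc.
  by rewrite E br eqxx in be.
Qed.

Lemma spread_min d (W : {fset vertex d}) : W != fset0 ->
  (exists2 T : {set {set W}}, is_tree T & spread W = tree_weight T) /\
  forall T : {set {set W}}, is_tree T -> (spread W <= tree_weight T)%N.
Proof.
move=> /fset0Pn[x xW].
have E : [exists T : {set {set W}}, T \in trees W].
  have St := star_tree (FSetSub xW : W).
  apply/existsP; eexists; rewrite inE; apply/asboolP; exact: St.
move: E => /existsP[T0 T0t].
rewrite /spread /arg_min /extremum.
case: pickP => [T /= /andP[]|].
  rewrite inE => /asboolP Tt /forallP H; split; first by exists T.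
  by move=> T' T't; have := H T'; rewrite inE => /implyP; apply; apply/asboolP.
move=> no; case: (arg_minnP (@tree_weight d W) T0t) => T Tt Tm.
have /negP[] := negbT (no T); apply/andP; split => //; apply/forallP => j; apply/implyP; exact: Tm.
Qed.

(* Main.v *)
Require Import Defs.
From HB Require Import structures.
From mathcomp Require Import all_boot all_order all_algebra finmap.
From mathcomp Require Import all_classical all_reals all_analysis.
From mathcomp Require Import ring lra zify.
Import Order.TTheory GRing.Theory Num.Theory.
Import numFieldNormedType.Exports.

(** For d at most 4 the right-hand side is at least 1 once C is, so assume that
    d is at least 5.  The event U(W) is the increasing union of the events
    local_U m W that W is connected inside the box of radius m.  Such an event
    depends on finitely many edges, so its probability is the limit of its
    frequencies among the spanning trees of the boxes of radius n, and it is
    enough to bound these frequencies for n large, uniformly in m.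

    A spanning tree of a box has no root towards which its paths run off to
    infinity.  Therefore the tree is compared with a random forest in which
    every vertex may also be a root, at a small rate eps.  Such a forest is an
    acyclic function f sending a vertex to its successor, or to None when it is
    a root, and its weight is the product of the weights of its arrows.  The
    one-root forests are the rooted spanning trees.  By Kirchhoff's formula
    (kirchhoff) doubling the weight of an edge multiplies the total weight by
    1 + R, where R is the resistance of the edge; by the Poincare inequality in
    the box (box_poincare) R changes by O(eps n ^ 2) when the killing is
    removed (potential_compare).  Functions of the tree inside a fixed box are
    combinations of the variables 2 ^ #(edges of the tree in S), so with
    eps = theta / n ^ 2 their means move by O(theta) (free_le_killed).

    In the killed forest the weight can be manipulated by exchanging one arrow
    (exchange_arrow).  This shows that, given a set C of vertices closed under
    f, the probability that the path from x first meets C at y is subharmonic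
    in x away from y, hence at most Phi x y times the probability that y lies
    in C, for every function Phi with Phi >= delta_y + P Phi (attach_bound).
    Such a Phi of size |x - y| ^ (2 - d) comes from the function
    (|x| ^ 2 + A) ^ ((2 - d) / 2), which for A large is superharmonic for the
    lattice Laplacian (pot_superharmonic); the lack of neighbours on the faces
    of the box is paid for by a constant that the killing makes small, and that
    constant is of order n ^ (4 - d) / theta, so d >= 5 is used again
    (box_potential, correction_small).

    If the paths from W all meet, consider the last point z where they merge:
    it splits W into two parts whose paths reach z separately (branch_point).
    Attaching the two parts one after the other and summing over z gives, by
    induction on the size of W, a sum of products of Phi over binary trees.  The
    two and three point convolution estimates (convolution_le,
    convolution3_le) turn the sum over z into a factor |a - b| ^ (4 - d) with a
    and b in the two parts, and an edge from a to b glues trees on the two parts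
    into a tree on W (spread_glue).  So the sum is at most a constant times the
    power 4 - d of the spread (joined_bound). *)

Set Implicit Arguments.
Unset Strict Implicit.
Unset Printing Implicit Defensive.

Local Open Scope ring_scope.


(** * Acyclic successor functions *)

Lemma sum_option (R : nmodType) (T : finType) (F : option T -> R) :
  \sum_o F o = F None + \sum_t F (Some t).
Proof.
rewrite (bigD1 None) //=; congr (_ + _).
rewrite (reindex_omap Some id) => [|[t|]] //=.
by apply: eq_bigl => t; rewrite eqxx.
Qed.

Section Forest.
Variable V : finType.
Implicit Types (f : {ffun V -> option V}) (o : option V) (x y z v : V).

Definition step f : rel V := fun x y => f x == Some y.

Definition acyclic f : bool :=
  [forall x, forall y, step f x y ==> ~~ connect (step f) y x].

Definition redirect f x o : {ffun V -> option V} :=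
  [ffun v => if v == x then o else f v].

Lemma acyclicP f :
  reflect (forall x y, step f x y -> ~~ connect (step f) y x) (acyclic f).
Proof.
apply: (iffP forallP) => H x; first by move=> y; apply/implyP; exact: (forallP (H x)).
by apply/forallP => y; apply/implyP; exact: H.
Qed.

Lemma redirect_at f x o : redirect f x o x = o.
Proof. by rewrite ffunE eqxx. Qed.

Lemma redirect_other f x o v : v != x -> redirect f x o v = f v.
Proof. by rewrite ffunE => /negPf ->. Qed.

Lemma redirectK f x o : redirect (redirect f x o) x (f x) = f.
Proof. by apply/ffunP => v; rewrite !ffunE; case: eqVneq => [->|]. Qed.

Lemma connect_step f x z : connect (step f) x z ->
  x = z \/ exists2 y, f x = Some y & connect (step f) y z.
Proof.
case/connectP => [[|y p]] /= => [_ -> |/andP[/eqP fx pp] ->]; first by left.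
by right; exists y => //; apply/connectP; exists p.
Qed.

Lemma connect_ind f z (Q : V -> Prop) : Q z ->
  (forall x y, f x = Some y -> connect (step f) y z -> Q y -> Q x) ->
  forall x, connect (step f) x z -> Q x.
Proof.
move=> Qz Qs x /connectP[p]; elim: p x => [|y p IH] x /=; first by move=> _ <-.
move=> /andP[/eqP fx pp] zE; apply: (Qs x y) => //; last exact: IH.
by apply/connectP; exists p.
Qed.

(** A vertex has one successor, so the vertices reachable from x form a chain. *)
Lemma connect_linear f x y z : connect (step f) x y -> connect (step f) x z ->
  connect (step f) y z || connect (step f) z y.
Proof.
move: x; apply: connect_ind => [->//|x x' fx cx IH /connect_step[<-|[x''] ]].
  by rewrite (connect_trans (connect1 _) cx) ?orbT //; apply/eqP.
by rewrite fx => -[<-] /IH.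
Qed.

Lemma acyclic_antisym f x y : acyclic f ->
  connect (step f) x y -> connect (step f) y x -> x = y.
Proof.
move=> /acyclicP acy /connect_step[//|[x' fx cx'] cyx].
by have /negP[] := acy x x' (introT eqP fx); exact: connect_trans cyx.
Qed.

(** The path from x only uses the arrows at the vertices of that path. *)
Lemma eq_connect_agree f f' x : (forall v, connect (step f) x v -> f' v = f v) ->
  connect (step f') x =1 connect (step f) x.
Proof.
move=> agr z; apply/idP/idP.
  move=> /connectP[p pp ->]; elim: p x pp agr => [|y p IH] x /=; first by [].
  move=> /andP[/eqP f'x pp] agr.
  have sxy : step f x y by rewrite /step -agr ?f'x.
  apply: connect_trans (connect1 sxy) _; apply: IH => // v cv; apply: agr.
  exact: connect_trans (connect1 sxy) cv.
move=> cxz; move: x cxz agr; apply: connect_ind => [_|x y fx cyz IH agr].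
  exact: connect0.
have sxy : step f x y by rewrite /step fx.
apply: (@connect_trans _ _ y); first by apply: connect1; rewrite /step agr ?fx.
by apply: IH => v cv; apply: agr; exact: connect_trans (connect1 sxy) cv.
Qed.

Lemma connect_redirect f x o y : ~~ connect (step f) y x ->
  connect (step (redirect f x o)) y =1 connect (step f) y.
Proof.
move=> nyx; apply: eq_connect_agree => v cv; apply: redirect_other.
by apply: contraNneq nyx => <-.
Qed.

Lemma connect_redirect_to f x o y : connect (step f) y x ->
  connect (step (redirect f x o)) y x.
Proof.
move: y; apply: connect_ind => [//|y y' fy _ IH].
have [->//|yx] := eqVneq y x.
by apply: connect_trans IH; apply: connect1; rewrite /step redirect_other ?fy.
Qed.

Lemma acyclic_rank f (r : V -> nat) :
  (forall x y, f x = Some y -> (r y < r x)%N) -> acyclic f.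
Proof.
move=> rk; apply/acyclicP => x y /eqP fx; apply/negP => cyx.
suff: (r x <= r y)%N by rewrite leqNgt (rk _ _ fx).
move: y cyx {fx}; apply: connect_ind => [//|z z' fz _ /leq_trans -> //].
by rewrite ltnW // rk.
Qed.

Lemma acyclic_card f x y : acyclic f -> f x = Some y ->
  (#|connect (step f) y| < #|connect (step f) x|)%N.
Proof.
move=> acy fx; have sxy : step f x y by rewrite /step fx.
apply: proper_card; apply/properP; split.
  by apply/fintype.subsetP => v; rewrite !inE; exact: connect_trans (connect1 sxy).
by exists x; rewrite !inE ?connect0 //; exact: (acyclicP _ acy).
Qed.

(** The number of reachable vertices, raised by a constant at the vertices that lead
    to x, decreases along the arrows of the new function. *)
Lemma acyclic_redirect f x o : acyclic f ->
  acyclic (redirect f x o) = (if o is Some y then ~~ connect (step f) y x else true).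
Proof.
move=> acy; apply/idP/idP.
  case: o => [y|//] /acyclicP acy'; apply/negP => cyx.
  have sxy : step (redirect f x (Some y)) x y by rewrite /step redirect_at.
  by have /negP[] := acy' x y sxy; exact: connect_redirect_to.
move=> H; (* exceeds the number of vertices reachable from the new successor of x *)
pose N := (if o is Some y then #|connect (step f) y|.+1 else 0)%N.
apply: (@acyclic_rank _ (fun v => #|connect (step f) v|
                                  + (if connect (step f) v x then N else 0))%N).
move=> u v; have [->|ux] := eqVneq u x.
  rewrite redirect_at => oE; rewrite /N oE in H *.
  by rewrite (negPf H) connect0; lia.
rewrite redirect_other // => fu; have := acyclic_card acy fu.
suff -> : connect (step f) v x = connect (step f) u x by lia.
apply/idP/idP => [|/connect_step[/eqP|[v']]]; rewrite ?(negPf ux) //.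
  by apply: connect_trans; apply: connect1; rewrite /step fu.
by rewrite fu => -[->].
Qed.

Lemma acyclic_root f v : acyclic f -> exists2 r, connect (step f) v r & f r = None.
Proof.
move=> acy; have [k] := ubnP #|connect (step f) v|; elim: k v => // k IH v lek.
case fv: (f v) => [y|]; last by exists v; rewrite ?connect0.
have [|r cr fr] := IH y; first by have := acyclic_card acy fv; lia.
by exists r => //; apply: connect_trans cr; apply: connect1; rewrite /step fv.
Qed.

End Forest.

Section Weights.
Variables (R : realFieldType) (V : finType).
Implicit Types (f : {ffun V -> option V}) (w : V -> option V -> R).

Definition weight w f : R := \prod_v w v (f v).

Definition fsum w (P : {ffun V -> option V} -> bool) : R :=
  \sum_(f | acyclic f && P f) weight w f.

Lemma weight_redirect w f x o :
  weight w (redirect f x o) * w x (f x) = weight w f * w x o.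
Proof.
rewrite /weight (bigD1 x) //= [in RHS](bigD1 x) //= redirect_at.
rewrite (eq_bigr (fun v => w v (f v))); last by move=> v vx; rewrite redirect_other.
by rewrite mulrAC [in RHS]mulrAC mulrC [in RHS]mulrC; congr (_ * _); exact: mulrC.
Qed.

(** Swapping the arrow out of x with a spare arrow o preserves the weight of the
    pair (f, o), and it is an involution of the pairs for which the swap keeps f
    acyclic.  This move makes attachment probabilities subharmonic and Green
    functions harmonic. *)
Lemma exchange_arrow w x (A : {ffun V -> option V} -> option V -> R) :
  \sum_(f | acyclic f) \sum_o weight w f * w x o * A f o =
  \sum_(f | acyclic f) \sum_o weight w f * w x o *
    (if acyclic (redirect f x o) then A (redirect f x o) (f x) else A f o).
Proof.
rewrite !pair_big_dep /=.
pose s (q : {ffun V -> option V} * option V) :=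
  if acyclic q.1 && acyclic (redirect q.1 x q.2)
  then (redirect q.1 x q.2, q.1 x) else q.
have sK : involutive s.
  move=> [f o]; rewrite /s /=; case a1: (acyclic f); case a2: (acyclic (redirect f x o));
    by rewrite /= ?a1 ?a2 //= redirectK redirect_at a1.
rewrite (reindex_inj (can_inj sK)) /=; apply: eq_big => [[f o]|[f o] /=].
  by rewrite /s /=; case a1: (acyclic f); case a2: (acyclic (redirect f x o)); rewrite /= ?a1 ?a2.
rewrite andbT /s /=; case a1: (acyclic f); case a2: (acyclic (redirect f x o)) => //=.
  by rewrite weight_redirect.
by rewrite a1.
Qed.

End Weights.

(** * Attaching one more path to a forest *)

Section Attach.
Variables (R : realFieldType) (V : finType) (w : V -> option V -> R).
Hypothesis w_ge0 : forall x o, 0 <= w x o.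
Hypothesis w_total : forall x, \sum_o w x o = 1.
Hypothesis w_killed : forall x, 0 < w x None.
Implicit Types (f : {ffun V -> option V}) (X : {set V}) (x y z v : V).
Implicit Types E P Q : {ffun V -> option V} -> bool.

(** The vertices lying on the paths that start in X. *)
Definition trunk f X : pred V := fun v => [exists x in X, connect (step f) x v].

(** The path from x enters the trunk of X at y. *)
Definition lands f X y x : bool :=
  [&& trunk f X y, connect (step f) x y &
      [forall v, connect (step f) x v && trunk f X v ==> connect (step f) y v]].

(** Events that can be decided from the arrows on the trunk of X alone. *)
Definition trunk_local X E :=
  forall f f', (forall v, trunk f X v -> f' v = f v) -> E f -> E f'.

Lemma trunkP f X v :
  reflect (exists2 x, x \in X & connect (step f) x v) (trunk f X v).
Proof. exact: (iffP exists_inP). Qed.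

Lemma trunk_up f X v v' : trunk f X v -> connect (step f) v v' -> trunk f X v'.
Proof.
by move=> /trunkP[x xX xv] vv'; apply/trunkP; exists x => //; exact: connect_trans vv'.
Qed.

Lemma landsP f X y x :
  reflect [/\ trunk f X y, connect (step f) x y &
      forall v, connect (step f) x v -> trunk f X v -> connect (step f) y v]
    (lands f X y x).
Proof.
apply: (iffP and3P) => -[ty xy H]; split=> //.
  by move=> v xv tv; have /forallP/(_ v) := H; rewrite xv tv.
by apply/forallP => v; apply/implyP => /andP[xv tv]; exact: H.
Qed.

Lemma eq_trunk_agree f f' X : (forall v, trunk f X v -> f' v = f v) ->
  forall x, trunk f X x -> connect (step f') x =1 connect (step f) x.
Proof.
by move=> agr x tx; apply: eq_connect_agree => v xv; apply: agr; exact: trunk_up xv.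
Qed.

Lemma trunk_self f X x : x \in X -> trunk f X x.
Proof. by move=> xX; apply/trunkP; exists x; rewrite ?connect0. Qed.

Lemma eq_trunk f f' X : (forall v, trunk f X v -> f' v = f v) ->
  trunk f' X =1 trunk f X.
Proof.
move=> agr v; apply/trunkP/trunkP => -[x xX xv]; exists x => //; move: xv;
  by rewrite (eq_trunk_agree agr) // trunk_self.
Qed.

Lemma weight_ge0 f : 0 <= weight w f.
Proof. by apply: prodr_ge0 => v _. Qed.

Lemma fsum_ge0 P : 0 <= fsum w P.
Proof. by apply: sumr_ge0 => f _; exact: weight_ge0. Qed.

Lemma fsum_le P Q : (forall f, acyclic f -> P f -> Q f) -> fsum w P <= fsum w Q.
Proof.
move=> PQ; rewrite /fsum big_mkcondr [leRHS]big_mkcondr /=.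
apply: ler_sum => f af; case: ifP => [/(PQ _ af) -> //|_].
by case: ifP => // _; exact: weight_ge0.
Qed.

Lemma fsum_le_sum (I : finType) (A : pred I) P (Q : I -> {ffun V -> option V} -> bool) :
  (forall f, acyclic f -> P f -> exists2 i, A i & Q i f) ->
  fsum w P <= \sum_(i | A i) fsum w (Q i).
Proof.
move=> PQ; rewrite /fsum big_mkcondr /=.
under [leRHS]eq_bigr do rewrite big_mkcondr.
rewrite [leRHS]exchange_big /=; apply: ler_sum => f af; case: ifP => [/(PQ _ af)[i Ai Qi]|_].
  by rewrite (bigD1 i) //= Qi lerDl; apply: sumr_ge0 => j _; case: ifP => // _; exact: weight_ge0.
by apply: sumr_ge0 => j _; case: ifP => // _; exact: weight_ge0.
Qed.

(** At a maximum with positive value, subharmonicity would give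
    u x <= (1 - w x None) * u x. *)
Lemma maximum_principle (u : V -> R) (y : V) :
  u y <= 0 -> (forall x, x != y -> u x <= \sum_z w x (Some z) * u z) ->
  forall x, u x <= 0.
Proof.
move=> uy sub x0.
pose xm := [arg max_(x > x0) u x]%O.
have xmE x : u x <= u xm by rewrite /xm; case: arg_maxP => // i _; apply.
apply: le_trans (xmE x0) _; rewrite leNgt; apply/negP => xm_gt0.
have [xmy|xmy] := eqVneq xm y; first by rewrite xmy ltNge uy in xm_gt0.
have := sub _ xmy; rewrite leNgt => /negP[].
apply: (@le_lt_trans _ _ (\sum_z w xm (Some z) * u xm)).
  by apply: ler_sum => z _; apply: ler_wpM2l.
have : \sum_o w xm o = w xm None + \sum_z w xm (Some z).
  exact: sum_option.
rewrite w_total -mulr_suml => tot.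
rewrite -[ltRHS]mul1r ltr_pM2r // tot.
by rewrite ltrDr.
Qed.

(** Take one step of the walk with kernel w from x and use it as the spare arrow: if
    the exchange keeps f acyclic the trunk is not touched, and otherwise the spare
    arrow leads back to x, so that its path lands where the path of x does. *)
Lemma attach_subharmonic X E x y : trunk_local X E -> x != y ->
  fsum w (fun f => E f && lands f X y x) <=
  \sum_z w x (Some z) * fsum w (fun f => E f && lands f X y z).
Proof.
move=> locE xy.
have -> : fsum w (fun f => E f && lands f X y x) =
    \sum_(f | acyclic f) \sum_o weight w f * w x o * (E f && lands f X y x)%:R.
  rewrite /fsum big_mkcondr; apply: eq_bigr => f _ /=.
  by rewrite -mulr_suml -mulr_sumr w_total mulr1; case: ifP; rewrite ?mulr1 ?mulr0.
rewrite (@exchange_arrow _ _ w x (fun f _ => (E f && lands f X y x)%:R)).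
have -> : \sum_z w x (Some z) * fsum w (fun f => E f && lands f X y z) =
    \sum_(f | acyclic f) \sum_o weight w f * w x o *
      (if o is Some z then E f && lands f X y z else false)%:R.
  under [RHS]eq_bigr do rewrite sum_option mulr0 add0r.
  rewrite exchange_big; apply: eq_bigr => z _.
  rewrite /fsum big_mkcondr mulr_sumr; apply: eq_bigr => f _ /=.
  by case: ifP; rewrite ?mulr1 ?mulr0 // mulrC.
apply: ler_sum => f af; apply: ler_sum => o _; apply: ler_wpM2l.
  by rewrite mulr_ge0 ?weight_ge0.
(* first the case in which the spare arrow would close a cycle *)
case: ifP => af'; rewrite ler_nat; last first.
  case/boolP: (E f && lands f X y x) => // /andP[Ef /landsP[ty cxy H]].
  move: af'; rewrite acyclic_redirect //; case: o => // z /negbFE czx.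
  rewrite Ef /= lt0b; apply/landsP; split=> //; first exact: connect_trans cxy.
  move=> v czv tv; have /orP[cxv|cvx] := connect_linear czx czv; first exact: H.
  have cyx := H x (connect0 _ _) (trunk_up tv cvx).
  by rewrite (acyclic_antisym af cxy cyx) eqxx in xy.
case/boolP: (_ && _) => // /andP[Ef' /landsP[ty cxy H]].
set f' := redirect f x o in af' Ef' ty cxy H.
have ntx : ~~ trunk f' X x.
  apply: contra xy => tx; apply/eqP; apply: (acyclic_antisym af' cxy).
  exact: H (connect0 _ _) tx.
have agr v : trunk f' X v -> f v = f' v.
  by move=> tv; rewrite redirect_other //; apply: contraNneq ntx => <-.
have Ef := locE _ _ agr Ef'.
have [xy'|[z f'x czy]] := connect_step cxy; first by rewrite xy' eqxx in xy.
have oE : o = Some z by rewrite -f'x redirect_at.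
rewrite oE Ef /= lt0b.
have nzx : ~~ connect (step f') z x by apply: (acyclicP _ af'); rewrite /step f'x.
have fE : f = redirect f' x (f x) by rewrite redirectK.
have cz : connect (step f) z =1 connect (step f') z.
  by rewrite {1}fE; exact: connect_redirect.
apply/landsP; split; rewrite ?(eq_trunk agr) ?cz //.
move=> v; rewrite cz (eq_trunk agr) => czv tv.
rewrite (eq_trunk_agree agr) //; apply: H => //.
by apply: connect_trans czv; apply: connect1; rewrite /step f'x.
Qed.

(** Away from y the left side is subharmonic in x and Phi is superharmonic, and at y
    the bound holds because Phi y is at least 1. *)
Lemma attach_bound X E (Phi : V -> R) x y : trunk_local X E ->
  (forall x, 0 <= Phi x) ->
  (forall x, (x == y)%:R + \sum_z w x (Some z) * Phi z <= Phi x) ->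
  fsum w (fun f => E f && lands f X y x) <=
  Phi x * fsum w (fun f => E f && trunk f X y).
Proof.
move=> locE Phi_ge0 PhiS; set M := fsum w (fun f => E f && trunk f X y).
pose u x := fsum w (fun f => E f && lands f X y x).
have M_ge0 : 0 <= M by exact: fsum_ge0.
rewrite -subr_le0; apply: (@maximum_principle (fun x => u x - Phi x * M) y).
  rewrite subr_le0; apply: (@le_trans _ _ M).
    by apply: fsum_le => f _ /andP[-> /landsP[->]].
  rewrite ler_peMl //; apply: le_trans (PhiS y); rewrite eqxx lerDl.
  by apply: sumr_ge0 => z _; rewrite mulr_ge0.
move=> z zy; under eq_bigr do rewrite mulrBr mulrA.
rewrite big_split /= sumrN -mulr_suml; apply: lerB; first exact: attach_subharmonic.
rewrite ler_wpM2r //; apply: le_trans (PhiS z); by rewrite (negPf zy) add0r.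
Qed.

End Attach.

(** * Branch points and the several point bound *)

Section Branching.
Variable V : finType.
Implicit Types (f : {ffun V -> option V}) (X Y W B : {set V}) (x y z u v : V).

(** First common vertex of the paths from x and x'. *)
Definition meet f x x' v : bool :=
  [&& connect (step f) x v, connect (step f) x' v &
   [forall u, connect (step f) x u && connect (step f) x' u ==> connect (step f) v u]].

Definition meets_in f B W : bool :=
  [forall x in W, forall x' in W, exists v in B, meet f x x' v].

Lemma meetP f x x' v :
  reflect [/\ connect (step f) x v, connect (step f) x' v &
     forall u, connect (step f) x u -> connect (step f) x' u -> connect (step f) v u]
   (meet f x x' v).
Proof.
apply: (iffP and3P) => -[xv x'v H]; split=> //.
  by move=> u xu x'u; have /forallP/(_ u) := H; rewrite xu x'u.
by apply/forallP => u; apply/implyP => /andP[]; exact: H.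
Qed.

Lemma meets_inP f B W :
  reflect (forall x x', x \in W -> x' \in W -> exists2 v, v \in B & meet f x x' v)
    (meets_in f B W).
Proof.
apply: (iffP forall_inP) => [H x x' xW x'W|H x xW].
  by have /forall_inP/(_ _ x'W)/exists_inP := H x xW.
by apply/forall_inP => x' x'W; apply/exists_inP; exact: H.
Qed.

Lemma meets_in_sub f B W W' : W' \subset W -> meets_in f B W -> meets_in f B W'.
Proof.
move=> /fintype.subsetP sW /meets_inP H; apply/meets_inP => x x' xW x'W.
by apply: H; exact: sW.
Qed.

Lemma trunkS f X Y v : X \subset Y -> trunk f X v -> trunk f Y v.
Proof.
by move=> /fintype.subsetP sXY /trunkP[x xX xv]; apply/trunkP; exists x => //; exact: sXY.
Qed.

Lemma trunkU f X Y v : trunk f (X :|: Y)%SET v = trunk f X v || trunk f Y v.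
Proof.
apply/trunkP/orP => [[x]|].
  by rewrite inE => /orP[] xX xv; [left|right]; apply/trunkP; exists x.
by case=> /trunkP[x xX xv]; exists x => //; rewrite inE xX ?orbT.
Qed.

Lemma trunk1 f x v : trunk f [set x]%SET v = connect (step f) x v.
Proof.
apply/trunkP/idP => [[x']|xv]; first by rewrite inE => /eqP ->.
by exists x => //; rewrite inE.
Qed.

Lemma lands_agree f f' X Y x y : X \subset Y -> x \in Y ->
  (forall v, trunk f Y v -> f' v = f v) -> lands f X y x -> lands f' X y x.
Proof.
move=> sXY xY agr /landsP[ty xy H].
have agrX v : trunk f X v -> f' v = f v by move=> tv; apply: agr; exact: trunkS tv.
apply/landsP; split; rewrite ?(eq_trunk agrX) ?(eq_trunk_agree agr) //; first exact: trunk_self.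
move=> v; rewrite ?(eq_trunk agrX) ?(eq_trunk_agree agr) //; last exact: trunk_self.
  by move=> xv tv; exact: H.
exact: trunkS ty.
Qed.

Lemma meets_in_agree f f' B W Y : W \subset Y ->
  (forall v, trunk f Y v -> f' v = f v) -> meets_in f B W -> meets_in f' B W.
Proof.
move=> sWY agr /meets_inP H; apply/meets_inP => x x' xW x'W.
have [v vB /meetP[xv x'v Hv]] := H _ _ xW x'W; exists v => //.
have tx : trunk f Y x by apply: trunk_self; exact: (fintype.subsetP sWY).
have tx' : trunk f Y x' by apply: trunk_self; exact: (fintype.subsetP sWY).
apply/meetP; split; rewrite ?(eq_trunk_agree agr) //.
by move=> u; rewrite !(eq_trunk_agree agr) //; [exact: Hv | exact: trunk_up xv].
Qed.

Lemma acyclic_card_connect f x y : acyclic f -> connect (step f) x y ->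
  (#|connect (step f) x| <= #|connect (step f) y|)%N -> x = y.
Proof.
move=> af /[dup] cxy /connect_step[//|[x' fx cx'y]] le.
have := acyclic_card af fx; rewrite ltnNge => /negP[]; apply: leq_trans le _.
apply: subset_leq_card; apply/fintype.subsetP => v; rewrite !inE.
exact: connect_trans cx'y.
Qed.

(** Fix x0 in W and let z be the highest of its meets with the points of W.  The
    points whose path joins that of x0 before z form one part, unless x0 = z, when
    x0 alone does. *)
Lemma branch_point f B W : acyclic f -> (1 < #|W|)%N -> meets_in f B W ->
  exists z W1, [/\ z \in B, W1 \proper W, W1 != finset.set0,
    forall x, x \in W -> connect (step f) x z &
    forall x x' u, x \in W1 -> x' \in (W :\: W1)%SET ->
      connect (step f) x u -> connect (step f) x' u -> connect (step f) z u].
Proof.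
move=> af W2 /meets_inP mW.
have /card_gt0P[x0 x0W] : (0 < #|W|)%N by exact: ltnW.
pose S := [set v in B | [exists x in W, meet f x0 x v]]%SET.
have [v0 v0S] : exists v, v \in S.
  have [v vB mv] := mW _ _ x0W x0W; exists v; rewrite inE vB; apply/exists_inP.
  by exists x0.
pose z := [arg min_(z < v0 in S) #|connect (step f) z|]%N.
have [zS zmin] : z \in S /\ forall v, v \in S ->
    (#|connect (step f) z| <= #|connect (step f) v|)%N.
  by rewrite /z; case: arg_minnP => // i iS H; split.
move: (zS); rewrite inE => /andP[zB /exists_inP[x1 x1W /meetP[x0z x1z Hz]]].
have Wz x : x \in W -> connect (step f) x z.
  move=> xW; have [v vB mv] := mW _ _ x0W xW.
  have vS : v \in S by rewrite inE vB; apply/exists_inP; exists x.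
  have /meetP[x0v xv _] := mv; apply: connect_trans xv _.
  have /orP[//|zv] := connect_linear x0v x0z.
  by rewrite (acyclic_card_connect af zv (zmin _ vS)).
have [x0E|x0z'] := eqVneq x0 z.
  exists z, [set x0]%SET; split=> //.
  - rewrite finset.properEcard finset.sub1set x0W cards1; exact: W2.
  - by apply/set0Pn; exists x0; rewrite inE.
  - by move=> x x' u; rewrite inE => /eqP ->; rewrite -x0E.
pose W1 := [set x in W | [exists u, [&& connect (step f) x0 u, connect (step f) x u
                                      & ~~ connect (step f) z u]]]%SET.
exists z, W1; split=> //.
- apply/properP; split; first by apply/fintype.subsetP => x; rewrite inE => /andP[].
  exists x1 => //; rewrite inE x1W /=; apply/existsPn => u.
  by apply/negP => /and3P[a b /negP[]]; exact: Hz.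
- apply/set0Pn; exists x0; rewrite inE x0W; apply/existsP; exists x0.
  rewrite connect0 /=; apply: contra x0z' => zx0; apply/eqP.
  exact: acyclic_antisym zx0.
move=> x x' u; rewrite !inE => /andP[xW /existsP[u0 /and3P[x0u0 xu0 nzu0]]] /andP[].
move=> + x'W; rewrite x'W => /existsPn H xu x'u.
have /orP[u0u|uu0] := connect_linear xu0 xu.
  by have := H u; rewrite x'u (connect_trans x0u0 u0u) /= negbK.
by have := H u0; rewrite x0u0 (connect_trans x'u uu0) (negPf nzu0).
Qed.

End Branching.

Section MultiPoint.
Variables (R : realFieldType) (V : finType) (w : V -> option V -> R).
Hypothesis w_ge0 : forall x o, 0 <= w x o.
Hypothesis w_total : forall x, \sum_o w x o = 1.
Hypothesis w_killed : forall x, 0 < w x None.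
Variables (B : {set V}) (Phi g q : V -> V -> R) (s : {set V} -> R) (C K : R).
Hypothesis Phi_ge0 : forall x y, 0 <= Phi x y.
Hypothesis Phi_super : forall x y, y \in B ->
  (x == y)%:R + \sum_z w x (Some z) * Phi z y <= Phi x y.
Hypothesis C_ge0 : 0 <= C.
Hypothesis K_ge0 : 0 <= K.
Hypothesis Phi_le : forall x y, x \in B -> y \in B -> Phi x y <= C * g x y.
Hypothesis g_ge0 : forall x y, 0 <= g x y.
Hypothesis sum_gg : forall a b, a \in B -> b \in B ->
  \sum_(z in B) g a z * g b z <= K * q a b.
Hypothesis sum_ggg : forall a b y, a \in B -> b \in B -> y \in B ->
  \sum_(z in B) g a z * g b z * g z y <= K * q a b * (g a y + g b y).
Hypothesis q_ge0 : forall x y, 0 <= q x y.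
Hypothesis s_ge0 : forall W, 0 <= s W.
Hypothesis s_single : forall x, 1 <= s [set x]%SET.
Hypothesis s_glue : forall (W1 W2 : {set V}) a b, a \in W1 -> b \in W2 ->
  s W1 * s W2 * q a b <= s (W1 :|: W2)%SET.
Implicit Types (f : {ffun V -> option V}) (X W : {set V}).

(** The recursion counts the splits of a set of n points and the pairs of points in
    the two parts; the value is a crude constant. *)
Fixpoint join_const (C K : R) (n : nat) : R :=
  if n is n'.+1 then C + (2 ^ n * n ^ 2)%:R * (1 + C) * K * join_const C K n' ^+ 2 else 0.

Lemma join_const_ge0 n : 0 <= join_const C K n.
Proof.
case: n => //= n; rewrite addr_ge0 // mulr_ge0 ?sqr_ge0 //.
by rewrite mulr_ge0 // mulr_ge0 ?ler0n // addr_ge0.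
Qed.

Definition joins_bound n := forall W X (E : {ffun V -> option V} -> bool) y,
  trunk_local X E -> (0 < #|W| <= n)%N -> W \subset B -> y \in B ->
  fsum w (fun f => [&& E f, [forall x in W, lands f X y x] & meets_in f B W]) <=
  join_const C K n * s W * (\sum_(a in W) g a y) * fsum w (fun f => E f && trunk f X y).

(** The first branch becomes part of the trunk to which the second one is attached. *)
Lemma two_branches_le n W1 W2 X (E : {ffun V -> option V} -> bool) z :
  joins_bound n -> trunk_local X E -> z \in X -> z \in B ->
  (0 < #|W1| <= n)%N -> (0 < #|W2| <= n)%N -> W1 \subset B -> W2 \subset B ->
  fsum w (fun f => [&& E f, [forall x in W1, lands f X z x], meets_in f B W1,
     [forall x in W2, lands f (W1 :|: X)%SET z x] & meets_in f B W2]) <=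
  join_const C K n ^+ 2 * (s W1 * s W2) *
    (\sum_(a in W1) \sum_(b in W2) g a z * g b z) * fsum w E.
Proof.
move=> IH locE zX zB W1n W2n W1B W2B; set c := join_const C K n.
have c_ge0 : 0 <= c by exact: join_const_ge0.
pose E2 f := [&& E f, [forall x in W1, lands f X z x] & meets_in f B W1].
have locE2 : trunk_local (W1 :|: X)%SET E2.
  move=> f f' agr /and3P[Ef /forall_inP l1 m1].
  have agrX v : trunk f X v -> f' v = f v.
    by move=> tv; apply: agr; apply: trunkS tv; exact: finset.subsetUr.
  apply/and3P; split; first exact: locE Ef.
    apply/forall_inP => x xW1; apply: lands_agree agr _; last exact: l1.
      exact: finset.subsetUr.
    by rewrite inE xW1.
  apply: meets_in_agree agr m1; exact: finset.subsetUl.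
apply: (@le_trans _ _ (c * s W2 * (\sum_(b in W2) g b z) *
   (c * s W1 * (\sum_(a in W1) g a z) * fsum w E))); last first.
  by rewrite -big_distrlr /= le_eqVlt; apply/orP; left; apply/eqP; ring.
apply: le_trans (_ : fsum w (fun f => [&& E2 f, [forall x in W2, lands f (W1 :|: X)%SET z x] & meets_in f B W2]) <= _).
  by apply: fsum_le => // f _ /and5P[a b d e i]; rewrite /E2 a b d e i.
apply: le_trans (IH W2 _ E2 z locE2 W2n W2B zB) _.
apply: ler_wpM2l; first by rewrite !mulr_ge0 ?sumr_ge0.
apply: le_trans (_ : fsum w E2 <= _); first by apply: fsum_le => // f _ /andP[].
apply: le_trans (IH W1 _ E z locE W1n W1B zB) _.
apply: ler_wpM2l; first by rewrite !mulr_ge0 ?sumr_ge0.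
by apply: fsum_le => // f _ /andP[].
Qed.

Lemma branch_lands f X y z W1 W : W1 \subset W ->
  (exists x, x \in W) ->
  (forall x, x \in W -> connect (step f) x z) ->
  (forall x x' u, x \in W1 -> x' \in (W :\: W1)%SET ->
      connect (step f) x u -> connect (step f) x' u -> connect (step f) z u) ->
  connect (step f) z y ->
  (forall x, x \in W -> lands f X y x) ->
  [/\ lands f X y z, forall x, x \in W1 -> lands f (z |: X)%SET z x &
      forall x, x \in (W :\: W1)%SET -> lands f (W1 :|: (z |: X))%SET z x].
Proof.
move=> /fintype.subsetP sW1 [x0 x0W] Wz dis zy la.
have [ty _ _] := landsP _ _ _ _ (la _ x0W).
have key x v : x \in W -> connect (step f) x v -> trunk f X v -> connect (step f) z v.
  by move=> xW xv tv; have /landsP[_ _ H] := la _ xW; exact: connect_trans zy (H _ xv tv).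
split.
- apply/landsP; split=> // v zv tv; have /landsP[_ _ H] := la _ x0W.
  by apply: H => //; apply: connect_trans zv; exact: Wz.
- move=> x xW1; apply/landsP; split; [|exact/Wz/sW1|].
    by rewrite trunkU trunk1 connect0.
  move=> v xv; rewrite trunkU trunk1 => /orP[//|tv].
  by apply: key xv tv; exact: sW1.
- move=> x xW2; have xW : x \in W by move: xW2; rewrite inE => /andP[].
  apply/landsP; split; [|exact: Wz|].
    by rewrite !trunkU trunk1 connect0 orbT.
  move=> v xv; rewrite !trunkU trunk1 => /orP[/trunkP[x1 x1W x1v]|/orP[//|tv]].
    exact: dis x1v xv.
  exact: key xv tv.
Qed.

Lemma proper_card_bounds n (W1 W : {set V}) : (#|W| <= n.+1)%N -> W1 \proper W ->
  W1 != finset.set0 -> (0 < #|W1| <= n)%N && (0 < #|(W :\: W1)%SET| <= n)%N.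
Proof.
move=> Wn pW; rewrite -card_gt0 => W1_gt0; have := proper_card pW.
have := cardsD W W1; rewrite (finset.setIidPr (proper_sub pW)).
by move: #|_| #|_| #|_| Wn W1_gt0 => *; lia.
Qed.

Definition is_split W (i : {set V} * V) :=
  [&& i.1 \in powerset W, (i.1 \proper W) && (i.1 != finset.set0) & i.2 \in B].

(** For a split of W into W1 and W2, gluing turns the product of the two spread
    factors into that of W once the branch point z has been summed out. *)
Lemma sum_splits_le n W (h : V -> V -> V -> R) (D T : R) :
  (#|W| <= n.+1)%N -> W \subset B -> 0 <= D -> 0 <= T ->
  (forall a b, a \in W -> b \in W -> a != b ->
    \sum_(z in B) h a b z <= K * q a b * T) ->
  \sum_(i | is_split W i) D * (s i.1 * s (W :\: i.1)%SET) *
     (\sum_(a in i.1) \sum_(b in (W :\: i.1)%SET) h a b i.2) <=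
  (2 ^ n.+1 * n.+1 ^ 2)%:R * D * K * s W * T.
Proof.
move=> Wn WB D_ge0 T_ge0 sum_h.
rewrite (_ : \sum_(i | _) _ = \sum_(W1 | (W1 \in powerset W) && (W1 \proper W) && (W1 != finset.set0))
   \sum_(z in B) D * (s W1 * s (W :\: W1)%SET) *
     (\sum_(a in W1) \sum_(b in (W :\: W1)%SET) h a b z)); last first.
  rewrite pair_big_dep /=; apply: eq_bigl => -[W1 z] /=.
  by rewrite /is_split /= !andbA.
have one W1 : (W1 \in powerset W) && (W1 \proper W) && (W1 != finset.set0) ->
    \sum_(z in B) D * (s W1 * s (W :\: W1)%SET) *
     (\sum_(a in W1) \sum_(b in (W :\: W1)%SET) h a b z) <= (n.+1 ^ 2)%:R * D * K * s W * T.
  move=> /andP[/andP[_ W1W] W1n]; have /andP[/andP[_ c1] /andP[_ c2]] := proper_card_bounds Wn W1W W1n.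
  rewrite -mulr_sumr exchange_big /=.
  under eq_bigr do rewrite exchange_big /=.
  apply: (@le_trans _ _ (\sum_(a in W1) \sum_(b in (W :\: W1)%SET) D * K * s W * T)).
    rewrite mulr_sumr; apply: ler_sum => a aW1; rewrite mulr_sumr; apply: ler_sum => b bW2.
    have aW : a \in W by apply: (fintype.subsetP (proper_sub W1W)).
    have [bW bW1] : b \in W /\ b \notin W1 by move: bW2; rewrite inE => /andP[].
    have ab : a != b by apply: contraNneq bW1 => <-.
    apply: le_trans (ler_wpM2l _ (sum_h a b aW bW ab)) _; first by rewrite !mulr_ge0.
    have := s_glue aW1 bW2.
    rewrite (_ : W1 :|: W :\: W1 = W)%SET; last first.
      by rewrite -{1}(finset.setIidPr (proper_sub W1W)) finset.setID.
    move=> le; rewrite -subr_ge0.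
    rewrite (_ : _ - _ = D * K * T * (s W - s W1 * s (W :\: W1)%SET * q a b)); last by ring.
    by rewrite !mulr_ge0 // subr_ge0.
  have Y_ge0 : 0 <= D * K * s W * T by rewrite !mulr_ge0.
  rewrite !sumr_const -mulrnA -!(mulrA (n.+1 ^ 2)%:R) [leRHS]mulr_natl.
  by apply: ler_wpMn2l => //; rewrite mulnC; apply: leq_mul; lia.
apply: le_trans (ler_sum _ one) _.
have Y_ge0 : 0 <= (n.+1 ^ 2)%:R * D * K * s W * T by rewrite !mulr_ge0 ?ler0n.
rewrite sumr_const natrM -!(mulrA (2 ^ n.+1)%:R) [leRHS]mulr_natl.
apply: ler_wpMn2l => //; apply: leq_trans (_ : #|powerset W| <= _)%N.
  apply: subset_leq_card; apply/fintype.subsetP => W1 W1P.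
  by have /andP[/andP[]] : (W1 \in powerset W) && (W1 \proper W) && (W1 != finset.set0) := W1P.
by rewrite card_powerset leq_exp2l.
Qed.

(** Induction on the size: the branch point of W is attached to the trunk first,
    and the two parts of W to the branch point. *)
Lemma joins_boundP n : joins_bound n.
Proof.
elim: n => [|n IH] W X E y locE /andP[W0 Wn] WB yB; first by lia.
have M_ge0 : 0 <= fsum w (fun f => E f && trunk f X y) by exact: fsum_ge0.
have [/cards1P[x WE]|W2] := boolP (#|W| == 1)%N.
  rewrite WE big_set1; have xB : x \in B by apply: (fintype.subsetP WB); rewrite WE inE.
  apply: (@le_trans _ _ (Phi x y * fsum w (fun f => E f && trunk f X y))).
    apply: le_trans _ (attach_bound w_ge0 w_total w_killed x locE (Phi_ge0^~ y) (fun x => @Phi_super x y yB)).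
    apply: fsum_le => // f _ /and3P[-> /forall_inP la _] /=.
    by apply: la; rewrite inE.
  apply: ler_wpM2r => //; apply: le_trans (Phi_le xB yB) _.
  rewrite ler_wpM2r // -[leLHS]mulr1; apply: ler_pM => //=.
  by rewrite lerDl mulr_ge0 ?sqr_ge0 // mulr_ge0 // mulr_ge0 ?ler0n // addr_ge0.
have {}W2 : (1 < #|W|)%N by lia.
set M := fsum w _ in M_ge0 *; set c := join_const C K n.
have c_ge0 : 0 <= c by exact: join_const_ge0.
pose Q (i : {set V} * V) f := let: (W1, z) := i in
  [&& E f && lands f X y z, [forall x in W1, lands f (z |: X)%SET z x], meets_in f B W1,
     [forall x in (W :\: W1)%SET, lands f (W1 :|: (z |: X))%SET z x]
   & meets_in f B (W :\: W1)%SET].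
apply: le_trans (@fsum_le_sum _ _ _ w_ge0 _ (is_split W) _ Q _) _.
  move=> f af /and3P[Ef /forall_inP la mW].
  have [z [W1 [zB W1W W1n Wz dis]]] := branch_point af W2 mW.
  have /set0Pn[x1 x1W1] := W1n.
  have sW1 := proper_sub W1W.
  have [x2 x2W x2W1] : exists2 x2, x2 \in W & x2 \notin W1.
    by have /properP[_ [x2 a b]] := W1W; exists x2.
  have zy : connect (step f) z y.
    apply: (dis x1 x2) => //; first by rewrite inE x2W1.
      by have /landsP[] := la _ (fintype.subsetP sW1 _ x1W1).
    by have /landsP[] := la _ x2W.
  have [la0 la1 la2] := branch_lands sW1 (ex_intro _ x2 x2W) Wz dis zy la.
  exists (W1, z); first by rewrite /is_split /= powersetE sW1 W1W W1n.
  rewrite /Q Ef la0 /=; apply/and4P; split.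
  - by apply/forall_inP.
  - exact: meets_in_sub mW.
  - by apply/forall_inP.
  - by apply: meets_in_sub mW; exact: finset.subsetDl.
have bound i : is_split W i -> fsum w (Q i) <=
    (1 + C) * c ^+ 2 * M * (s i.1 * s (W :\: i.1)%SET) *
      \sum_(a in i.1) \sum_(b in (W :\: i.1)%SET) g a i.2 * g b i.2 * g i.2 y.
  case: i => W1 z /and3P[/= _ /andP[W1W W1n] zB].
  have /andP[c1 c2] := proper_card_bounds Wn W1W W1n.
  have W1B : W1 \subset B := fintype.subset_trans (proper_sub W1W) WB.
  have W2B : (W :\: W1)%SET \subset B := fintype.subset_trans (finset.subsetDl _ _) WB.
  have locE1 : trunk_local (z |: X)%SET (fun f => E f && lands f X y z).
    move=> f f' agr /andP[Ef lz]; apply/andP; split.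
      by apply: locE Ef => v tv; apply: agr; apply: trunkS tv; exact: finset.subsetUr.
    by apply: lands_agree agr lz; rewrite ?finset.subsetUr // inE set11.
  apply: le_trans (two_branches_le IH locE1 _ zB c1 c2 W1B W2B) _; first by rewrite !inE eqxx.
  have := attach_bound w_ge0 w_total w_killed z locE (Phi_ge0^~ y) (fun x => @Phi_super x y yB).
  move=> /le_trans/(_ (ler_wpM2r M_ge0 (Phi_le zB yB))) le1.
  apply: le_trans (ler_wpM2l _ le1) _.
    by rewrite !mulr_ge0 ?sqr_ge0 ?sumr_ge0 // => a _; rewrite sumr_ge0 // => b _; rewrite mulr_ge0.
  have -> : \sum_(a in W1) \sum_(b in (W :\: W1)%SET) g a z * g b z * g z y =
     (\sum_(a in W1) \sum_(b in (W :\: W1)%SET) g a z * g b z) * g z y.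
    by rewrite mulr_suml; apply: eq_bigr => a _; rewrite mulr_suml.
  set S := \sum_(a in W1) _.
  have S_ge0 : 0 <= S by rewrite sumr_ge0 // => a _; rewrite sumr_ge0 // => b _; rewrite mulr_ge0.
  rewrite -subr_ge0 (_ : _ - _ = c ^+ 2 * M * (s W1 * s (W :\: W1)%SET) * (S * g z y)).
    by rewrite !mulr_ge0 ?sqr_ge0.
  by rewrite -/c; ring.
apply: le_trans (ler_sum _ bound) _.
set T := \sum_(a in W) g a y.
have T_ge0 : 0 <= T by rewrite sumr_ge0.
have T2 a b : a \in W -> b \in W -> a != b -> g a y + g b y <= T.
  move=> aW bW ab; rewrite /T (bigD1 a) //= lerD2l (bigD1 b) /=; last by rewrite bW eq_sym.
  by rewrite lerDl sumr_ge0.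
apply: le_trans (@sum_splits_le n W (fun a b z => g a z * g b z * g z y) _ T Wn WB _ T_ge0 _) _.
- by rewrite !mulr_ge0 ?sqr_ge0 ?addr_ge0.
- move=> a b aW bW ab; have WB' := fintype.subsetP WB.
  apply: le_trans (sum_ggg (WB' _ aW) (WB' _ bW) yB) _.
  by rewrite ler_wpM2l ?mulr_ge0 // T2.
rewrite /= -/c; rewrite -subr_ge0 (_ : _ - _ = C * s W * T * M); first by rewrite !mulr_ge0.
by ring.
Qed.

(** Here nothing is given to attach to: the branch point itself starts the trunk. *)
Lemma joined_bound n W : (1 < #|W| <= n.+1)%N -> W \subset B ->
  fsum w (fun f => meets_in f B W) <= join_const C K n.+1 * s W * fsum w (fun _ => true).
Proof.
move=> /andP[W2 Wn] WB.
set M := fsum w (fun _ => true); set c := join_const C K n.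
have M_ge0 : 0 <= M by exact: fsum_ge0.
have c_ge0 : 0 <= c by exact: join_const_ge0.
pose Q (i : {set V} * V) f := let: (W1, z) := i in
  [&& true, [forall x in W1, lands f [set z]%SET z x], meets_in f B W1,
     [forall x in (W :\: W1)%SET, lands f (W1 :|: [set z])%SET z x]
   & meets_in f B (W :\: W1)%SET].
apply: le_trans (@fsum_le_sum _ _ _ w_ge0 _ (is_split W) _ Q _) _.
  move=> f af mW.
  have [z [W1 [zB W1W W1n Wz dis]]] := branch_point af W2 mW.
  have sW1 := proper_sub W1W; have /fintype.subsetP sW1' := sW1.
  exists (W1, z); first by rewrite /is_split /= powersetE sW1 W1W W1n.
  rewrite /Q /=; apply/and4P; split.
  - apply/forall_inP => x xW1; apply/landsP.
    by split; rewrite ?trunk1 ?connect0 //; [exact/Wz/sW1' | move=> v _; rewrite trunk1].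
  - exact: meets_in_sub mW.
  - apply/forall_inP => x xW2; have xW : x \in W by move: xW2; rewrite inE => /andP[].
    apply/landsP; split; [by rewrite trunkU trunk1 connect0 orbT | exact: Wz |].
    move=> v xv; rewrite trunkU trunk1 => /orP[/trunkP[x1 x1W1 x1v]|//].
    exact: dis x1v xv.
  - by apply: meets_in_sub mW; exact: finset.subsetDl.
have bound i : is_split W i -> fsum w (Q i) <=
    c ^+ 2 * M * (s i.1 * s (W :\: i.1)%SET) *
      \sum_(a in i.1) \sum_(b in (W :\: i.1)%SET) g a i.2 * g b i.2.
  case: i => W1 z /and3P[/= _ /andP[W1W W1n] zB].
  have /andP[c1 c2] := proper_card_bounds Wn W1W W1n.
  have W1B : W1 \subset B := fintype.subset_trans (proper_sub W1W) WB.
  have W2B : (W :\: W1)%SET \subset B := fintype.subset_trans (finset.subsetDl _ _) WB.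
  have loc1 : trunk_local [set z]%SET (fun _ => true) by [].
  apply: le_trans (two_branches_le (@joins_boundP n) loc1 _ zB c1 c2 W1B W2B) _; first by rewrite inE.
  by rewrite -/c -/M le_eqVlt; apply/orP; left; apply/eqP; ring.
apply: le_trans (ler_sum _ bound) _.
apply: le_trans (@sum_splits_le n W (fun a b z => g a z * g b z) _ 1 Wn WB _ ler01 _) _.
- by rewrite !mulr_ge0 ?sqr_ge0.
- move=> a b aW bW ab; have WB' := fintype.subsetP WB.
  by rewrite mulr1; apply: sum_gg; exact: WB'.
rewrite /= -/c; set N := (_ * _)%:R; rewrite -subr_ge0.
rewrite (_ : _ - _ = C * s W * M + N * C * K * c ^+ 2 * s W * M); last by ring.
by rewrite addr_ge0 // !mulr_ge0 ?ler0n ?sqr_ge0.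
Qed.

End MultiPoint.

(** * Rooted spanning trees as successor functions *)

Section ForestEdges.
Variable V : finType.
Implicit Types (f : {ffun V -> option V}) (x y z u v r : V) (T S : {set {set V}}).

Definition edges f : {set {set V}} :=
  [set e | [exists x, exists y, step f x y && (e == [set x; y]%SET)]]%SET.

Lemma edgesP f (e : {set V}) :
  reflect (exists x y, f x = Some y /\ e = [set x; y]%SET) (e \in edges f).
Proof.
rewrite inE; apply: (iffP existsP) => [[x /existsP[y /andP[/eqP fx /eqP ->]]]|[x [y [fx ->]]]].
  by exists x, y.
by exists x; apply/existsP; exists y; rewrite /step fx !eqxx.
Qed.

Lemma set2_eq (a b x y : V) : [set a; b]%SET = [set x; y]%SET ->
  (a = x /\ b = y) \/ (a = y /\ b = x).
Proof.
move=> E.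
have : a \in [set x; y]%SET by rewrite -E set21.
have : b \in [set x; y]%SET by rewrite -E set22.
have : x \in [set a; b]%SET by rewrite E set21.
have : y \in [set a; b]%SET by rewrite E set22.
rewrite !inE => /orP[]/eqP -> /orP[]/eqP -> /orP[]/eqP ? /orP[]/eqP ?; subst; auto.
Qed.

Lemma adj_sym T : symmetric (adj T).
Proof. by move=> x y; rewrite /adj finset.setUC. Qed.

Lemma adj_edges f x y : adj (edges f) x y = step f x y || step f y x.
Proof.
apply/edgesP/orP => [[a [b [fa /set2_eq[[-> ->]|[-> ->]]]]]|].
- by left; rewrite /step fa.
- by right; rewrite /step fa.
- by case=> /eqP fx; [exists x, y|exists y, x]; rewrite // finset.setUC.
Qed.

Lemma connect_edges f x y : connect (step f) x y -> connect (adj (edges f)) x y.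
Proof. by apply: connect_sub => u v uv; apply: connect1; rewrite adj_edges uv. Qed.

Definition one_root f : bool := #|[pred v | f v == None]| == 1%N.

Lemma one_rootP f : acyclic f -> one_root f ->
  exists2 r, f r = None & forall v, connect (step f) v r.
Proof.
move=> af /card1P[r rE]; exists r; first by apply/eqP; have := rE r; rewrite !inE eqxx.
move=> v; have [r' vr' fr'] := acyclic_root v af.
by have := rE r'; rewrite !inE fr' eqxx => /esym/eqP <-.
Qed.

(** On a cycle of the undirected graph the vertex farthest from the root would need
    two arrows. *)
Lemma edges_tree f : acyclic f -> one_root f -> is_tree (edges f).
Proof.
move=> af f1; have [r fr cr] := one_rootP af f1.
have sym := sym_connect_sym (adj_sym (edges f)).
split.
- move=> e /edgesP[x [y [fx ->]]]; rewrite cards2.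
  case: eqVneq => // xy; have := acyclicP _ af x y; rewrite /step fx eqxx => /(_ isT).
  by rewrite xy connect0.
- move=> x y; apply: connect_trans (connect_edges (cr x)) _.
  by rewrite sym; apply: connect_edges.
move=> c c3 uc; apply/negP => cyc.
case: c c3 uc cyc => [//|c0 c'] c3 uc cyc; set c := c0 :: c' in c3 uc cyc.
pose h v := #|connect (step f) v|.
have [m mc mmax] : exists2 m, m \in c & forall v, v \in c -> (h v <= h m)%N.
  pose m := [arg max_(m > c0 in c) h m]%N.
  have c0c : c0 \in c by rewrite inE eqxx.
  by exists m; rewrite /m; case: arg_maxnP.
have fE u : u \in c -> adj (edges f) m u -> f m = Some u.
  move=> uc'; rewrite adj_edges => /orP[/eqP //|/eqP fu].
  by have := acyclic_card af fu; rewrite ltnNge mmax.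
have [i q qE] := rot_to mc.
have {}uc : uniq (m :: q) by rewrite -qE rot_uniq.
have {}cyc : cycle (adj (edges f)) (m :: q) by rewrite -qE rot_cycle.
have {}c3 : (2 < size (m :: q))%N by rewrite -qE size_rot.
have {}fE u : u \in m :: q -> adj (edges f) m u -> f m = Some u.
  by rewrite -qE mem_rot; exact: fE.
case: q uc cyc c3 fE {qE} => [//|a [//|b q]] /=; rewrite !inE !negb_or.
move=> /andP[_ /andP[/andP[ab aq] _]] /andP[ma]; rewrite rcons_path => /and3P[_ _ lm] _ fE.
have fa : f m = Some a by apply: fE; rewrite // !inE eqxx orbT.
have fl : f m = Some (last b q).
  by apply: fE; rewrite 1?adj_sym // !inE -in_cons mem_last !orbT.
move: fl; rewrite fa => -[al]; have := mem_last b q.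
by rewrite -al inE (negPf ab) (negPf aq).
Qed.

(** Take arrows along edges of T so that as many vertices as possible lead to r.  An
    edge of T leaving this set could be added, so all vertices do; an edge of T
    without arrow would close a cycle. *)
Lemma tree_orient T r : is_tree T ->
  exists f, [/\ acyclic f, one_root f, f r = None & edges f = T].
Proof.
move=> [T2 Tc Tacyc].
pose good f := [&& acyclic f, f r == None & edges f \subset T].
pose cov f := #|[pred v | connect (step f) v r]|.
have good0 : good [ffun=> None].
  apply/and3P; split; last 1 first.
  - by apply/fintype.subsetP => e /edgesP[x [y [+ _]]]; rewrite ffunE.
  - by apply/acyclicP => x y; rewrite /step ffunE.
  - by rewrite ffunE.
pose f := [arg max_(f > [ffun=> None] | good f) cov f]%N.
have [/and3P[af /eqP fr fT] fmax] : good f /\ forall f', good f' -> (cov f' <= cov f)%N.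
  by rewrite /f; case: arg_maxnP.
have all_r v : connect (step f) v r.
  apply/negPn/negP => nvr.
  pose A := [pred u | connect (step f) u r].
  have [x [y [xA yA xy]]] : exists x y, [/\ x \notin A, y \in A & adj T x y].
    have /connectP[p pp rl] := Tc v r; have vA : v \notin A by rewrite inE.
    elim: p v vA pp rl {nvr} => [|y p IH] x xA /=; first by move=> _ xr; rewrite inE -xr connect0 in xA.
    move=> /andP[xy pp] rl; have [yA|yA] := boolP (y \in A); first by exists x, y.
    exact: IH yA pp rl.
  rewrite inE in yA; rewrite inE in xA.
  have nyx : ~~ connect (step f) y x.
    apply: contra xA => yx; have /orP[//|rx] := connect_linear yx yA.
    by case/connect_step: rx => [->|[? ]]; rewrite ?connect0 // fr.
  have xr : x != r by apply: contraNneq xA => ->; exact: connect0.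
  pose f' := redirect f x (Some y).
  have gf' : good f'.
    apply/and3P; split; first by rewrite acyclic_redirect.
      by rewrite redirect_other 1?eq_sym // fr.
    apply/fintype.subsetP => e /edgesP[u [v' [+ ->]]].
    have [->|ux] := eqVneq u x; first by rewrite redirect_at => -[<-].
    rewrite redirect_other // => fu; apply: (fintype.subsetP fT).
    by apply/edgesP; exists u, v'.
  have := fmax _ gf'; rewrite leqNgt => /negP[].
  have yr' : connect (step f') y r by rewrite connect_redirect.
  apply: proper_card; apply/properP; split.
    apply/fintype.subsetP => u; rewrite !inE => ur.
    rewrite /f' connect_redirect //; apply: contra xA => ux.
    have /orP[//|rx] := connect_linear ux ur.
    by case/connect_step: rx => [->|[? ]]; rewrite ?connect0 // fr.
  exists x; rewrite !inE //; apply: connect_trans yr'.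
  by apply: connect1; rewrite /step redirect_at.
have f1 : one_root f.
  apply/card1P; exists r => v; rewrite !inE; apply/eqP/eqP => [fv|-> //].
  by have /connect_step[//|[? ]] := all_r v; rewrite fv.
exists f; split=> //; apply/eqP; rewrite finset.eqEsubset fT /=.
apply/fintype.subsetP => e eT; have E2 := T2 _ eT; move/eqP/cards2P: E2 => [x [y [xy eE]]].
rewrite eE; change (is_true (adj (edges f) x y)).
apply/negPn/negP => nxy; have [_ ec _] := edges_tree af f1.
have /connectP[p0 pp0 pl0] := ec x y.
case/shortenP: pp0 pl0 => p pp up _ pl.
have yx : adj T y x by rewrite adj_sym /adj -eE.
have ppT : path (adj T) x p.
  by apply: sub_path pp => u v; exact: (fintype.subsetP fT).
have /negP[] : ~~ cycle (adj T) (x :: p).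
  apply: Tacyc => //; case: p pp pl {up ppT} => [|a [|b p]] //= pp ya.
    by rewrite -ya eqxx in xy.
  by move: nxy pp; rewrite ya => /negPf ->.
by rewrite /= rcons_path ppT /= -pl.
Qed.

(** If f' disagrees with f at v, the edge from v to u = f' v is owned by u in f, so f'
    disagrees with f at u as well: the path of f' from v would never end. *)
Lemma orient_unique f f' r : acyclic f -> one_root f -> acyclic f' -> one_root f' ->
  f r = None -> f' r = None -> edges f = edges f' -> f = f'.
Proof.
move=> af f1 af' f1' fr fr' eE; apply/ffunP => v; apply/eqP/negPn/negP => vN.
have [r' fr'' cr] := one_rootP af' f1'.
have rr' : r = r'.
  by have /connect_step[//|[? ]] := cr r; rewrite fr'.
have [r'' fr3 cr''] := one_rootP af f1.
have rr'' : r = r''.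
  by have /connect_step[//|[? ]] := cr'' r; rewrite fr.
move: (cr v) vN; rewrite -rr'; move: v; apply: connect_ind; first by rewrite fr fr' eqxx.
move=> v u f'v _ IH fv; apply: IH.
have uv : step f u v.
  have : adj (edges f) v u by rewrite eE adj_edges /step f'v eqxx.
  by rewrite adj_edges => /orP[/eqP fE|//]; rewrite fE f'v eqxx in fv.
rewrite (eqP uv); apply/negP => /eqP/esym f'u.
have /negP[] := acyclicP _ af' v u (introT eqP f'v).
by apply: connect1; rewrite /step f'u.
Qed.

(** Every tree can be rooted at each of its vertices in exactly one way. *)
Lemma card_rooted (e : rel V) (P : {set {set V}} -> bool) : symmetric e ->
  #|[pred f | [&& acyclic f, one_root f, [forall x, if f x is Some y then e x y else true]
             & P (edges f)]]| =
  (#|[pred T | (T \in spanning_trees e) && P T]| * #|V|)%N.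
Proof.
move=> esym; set A := [pred f | _].
pose h f := (edges f, [pick r | f r == None]).
have hr f : A f -> exists2 r, f r = None & [pick r | f r == None] = Some r.
  case/and4P => _ /card1P[r rE] _ _; case: pickP => [r' /eqP fr'|]; first by exists r'.
  by move=> /(_ r); have := rE r; rewrite !inE eqxx => ->.
have hinj : {in A &, injective h}.
  move=> f f' fA fA' [eE]; have [r fr ->] := hr _ fA; have [r' fr' ->] := hr _ fA' => -[rr].
  case/and4P: fA => af f1 _ _; case/and4P: fA' => af' f1' _ _.
  by apply: orient_unique eE => //; [exact: fr | rewrite rr].
rewrite -(card_in_image hinj).
pose k (p : {set {set V}} * V) := (p.1, Some p.2).
have kinj : injective k by move=> [T r] [T' r'] [-> ->].
pose TT := [set T | (T \in spanning_trees e) && P T]%SET.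
transitivity #|[seq k p | p in finset.setX TT [set: V]%SET]|; last first.
  rewrite fintype.card_image // cardsX cardsT; congr (_ * _)%N.
  by apply: fintype.eq_card => T; rewrite !inE.
apply: fintype.eq_card => p; apply/fintype.imageP/fintype.imageP => [[f fA ->]|[[T r] TrA ->]].
  have [r fr hE] := hr _ fA; rewrite /h hE; exists (edges f, r) => //.
  case/and4P: fA => af f1 /forallP fe fP; rewrite !inE fP !andbT; apply/andP; split.
    by apply/asboolP; exact: edges_tree.
  apply/forallP => x; apply/forallP => y; apply/implyP; rewrite adj_edges.
  by case/orP => /eqP fx; [have := fe x|have := fe y]; rewrite fx // esym.
move: TrA; rewrite !inE /= andbT => /andP[/andP[/asboolP Tt /forallP Te] PT].
have [f [af f1 fr fT]] := tree_orient r Tt.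
have fA : f \in A.
  rewrite inE af f1 fT PT andbT; apply/forallP => x; case fx: (f x) => [y|//].
  have /forallP/(_ y)/implyP := Te x; apply.
  by rewrite -fT adj_edges /step fx eqxx.
exists f => //; have [r' fr' hE] := hr _ fA; rewrite /k /h hE fT /=; congr (_, Some _).
have [r0 fr0 cr] := one_rootP af f1.
have /connect_step[->|[? ]] := cr r; last by rewrite fr.
by have /connect_step[->|[? ]] := cr r'; last by rewrite fr'.
Qed.

End ForestEdges.

(** * Kirchhoff's formula and effective resistance *)

Section Kirchhoff.
Variables (R : realFieldType) (V : finType).
Implicit Types (f : {ffun V -> option V}) (x y z v a b : V) (w : V -> option V -> R).

(** Forces a to be a root. *)
Definition kill a w : V -> option V -> R :=
  fun v o => if v == a then (o == None)%:R else w v o.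

(** Up to the total weight, the Green function with pole a of the walk that
    jumps at the rates w. *)
Definition green w a x : R := fsum (kill a w) (fun f => connect (step f) x a).

Lemma weight_kill a w f : weight (kill a w) f = (f a == None)%:R * \prod_(v | v != a) w v (f v).
Proof.
rewrite /weight (bigD1 a) //= {1}/kill eqxx; congr (_ * _).
by apply: eq_bigr => v /negPf va; rewrite /kill va.
Qed.

Lemma weight_kill0 a w f : f a != None -> weight (kill a w) f = 0.
Proof. by move=> fa; rewrite weight_kill (negPf fa) mul0r. Qed.

(** Cutting the arrow out of a gives a forest in which a is a root. *)
Lemma fsum_arrow w a o : fsum w (fun f => f a == o) =
  w a o * fsum (kill a w) (fun f => acyclic (redirect f a o)).
Proof.
rewrite /fsum (reindex_onto (fun g => redirect g a o) (fun f => redirect f a None)) /=; last first.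
  by move=> f /andP[_ /eqP <-]; rewrite redirectK.
rewrite mulr_sumr [RHS]big_mkcond [LHS]big_mkcond /=; apply: eq_bigr => g _.
have -> : (redirect (redirect g a o) a None == g) = (g a == None).
  apply/eqP/eqP => [<-|ga]; first by rewrite redirect_at.
  by rewrite -ga redirectK.
rewrite redirect_at eqxx andbT weight_kill.
case: eqP => [ga|_]; last by rewrite andbF mul0r mulr0 if_same.
have -> : acyclic g && acyclic (redirect g a o) = acyclic (redirect g a o).
  case ag: (acyclic (redirect g a o)); last by rewrite andbF.
  have := acyclic_redirect a None ag.
  by rewrite -{1}ga redirectK => ->.
rewrite andbT; case: ifP => // _; rewrite mul1r /weight (bigD1 a) //= redirect_at.
by congr (_ * _); apply: eq_bigr => v va; rewrite redirect_other.
Qed.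

Lemma green_self w a : green w a a = fsum (kill a w) (fun _ => true).
Proof. by rewrite /green /fsum; apply: eq_bigl => f; rewrite connect0. Qed.

Lemma fsum_arrow_some w a y :
  fsum w (fun f => f a == Some y) = w a (Some y) * (green w a a - green w a y).
Proof.
rewrite fsum_arrow; congr (_ * _); rewrite green_self /green /fsum.
apply/eqP; rewrite eq_sym subr_eq; apply/eqP.
rewrite [LHS](eq_bigl (fun f => acyclic f)); last by move=> f; rewrite andbT.
rewrite (bigID (fun f => connect (step f) y a)) /= addrC; congr (_ + _).
by apply: eq_bigl => f; apply/andb_id2l => af; rewrite acyclic_redirect.
Qed.

Lemma fsum_arrow_none w a : fsum w (fun f => f a == None) = w a None * green w a a.
Proof.
rewrite fsum_arrow green_self /fsum; congr (_ * _).
by apply: eq_bigl => f; apply/andb_id2l => af; rewrite acyclic_redirect.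
Qed.

Lemma green_pole w a :
  (\sum_o w a o) * green w a a - \sum_y w a (Some y) * green w a y = fsum w (fun _ => true).
Proof.
have -> : fsum w (fun _ => true) = \sum_o fsum w (fun f => f a == o).
  rewrite /fsum (eq_bigl (fun f => acyclic f)); last by move=> f; rewrite andbT.
  exact: (partition_big (fun f => f a) predT).
rewrite !sum_option fsum_arrow_none; under [in RHS]eq_bigr do rewrite fsum_arrow_some mulrBr.
by rewrite sumrB -mulr_suml mulrDl addrA.
Qed.

(** The exchange at x is exact here: once a is a root, a path that runs into x reaches
    a if and only if the path of x does. *)
Lemma green_harmonic w a x : x != a ->
  (\sum_o w x o) * green w a x = \sum_y w x (Some y) * green w a y.
Proof.
move=> xa; have wk o : kill a w x o = w x o by rewrite /kill (negPf xa).
transitivity (\sum_(f | acyclic f) \sum_o weight (kill a w) f * kill a w x o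
     * (connect (step f) x a)%:R).
  rewrite /green /fsum big_mkcondr mulr_sumr /=; apply: eq_bigr => f _.
  under [RHS]eq_bigr do rewrite wk.
  rewrite -mulr_suml -mulr_sumr; case: ifP; rewrite ?mulr1 ?mulr0 //.
  by rewrite mulrC.
rewrite (@exchange_arrow _ _ (kill a w) x (fun f _ => (connect (step f) x a)%:R)).
transitivity (\sum_(f | acyclic f) \sum_o weight (kill a w) f * kill a w x o
     * (if o is Some y then connect (step f) y a else false)%:R); last first.
  under eq_bigr do rewrite sum_option mulr0 add0r.
  rewrite exchange_big; apply: eq_bigr => y _.
  rewrite /green /fsum big_mkcondr mulr_sumr; apply: eq_bigr => f _ /=.
  by rewrite wk; case: ifP; rewrite ?mulr1 ?mulr0 // mulrC.
apply: eq_bigr => f af; apply: eq_bigr => o _.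
have [/eqP fa|fa] := boolP (f a == None); last by rewrite weight_kill0 ?mul0r.
congr (_ * _); rewrite acyclic_redirect //.
case: o => [y|]; last first.
  case: (boolP (connect _ x a)) => // /connect_step[xE|[? ]]; last by rewrite redirect_at.
  by rewrite xE eqxx in xa.
case: ifP => [nyx|/negbFE cyx]; last first.
  congr ((nat_of_bool _)%:R); apply/idP/idP => [|ya]; first exact: connect_trans.
  have /orP[//|/connect_step[ax|[? ]]] := connect_linear cyx ya; last by rewrite fa.
  by rewrite ax eqxx in xa.
congr ((nat_of_bool _)%:R); rewrite -(connect_redirect (Some y) nyx).
apply/idP/idP => [/connect_step[xE|[y' ]]|ya].
- by rewrite xE eqxx in xa.
- by rewrite redirect_at => -[->].
- by apply: connect_trans ya; apply: connect1; rewrite /step redirect_at.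
Qed.

End Kirchhoff.

Section Resistance.
Variables (R : realFieldType) (V : finType).
Implicit Types (f : {ffun V -> option V}) (x y z v a b : V) (c : V -> V -> R) (u t : V -> R).

(** Conductances c with an extra sink reached from every vertex at rate eps. *)
Definition sunk c (eps : R) : V -> option V -> R :=
  fun x o => if o is Some y then c x y else eps.

(** Potential of a unit current entering at a and leaving at b. *)
Definition is_potential c (eps : R) a b u := forall x,
  eps * u x + \sum_y c x y * (u x - u y) = (x == a)%:R - (x == b)%:R.

(** The forests that use the edge ab are counted by differences of Green functions
    with poles at a and b. *)
Lemma kirchhoff c eps a b : (forall x y, c x y = c y x) ->
  0 < fsum (sunk c eps) (fun _ => true) ->
  exists2 u, is_potential c eps a b u &
    fsum (sunk c eps) (fun f => f a == Some b) + fsum (sunk c eps) (fun f => f b == Some a)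
    = c a b * (u a - u b) * fsum (sunk c eps) (fun _ => true).
Proof.
move=> csym; set w := sunk c eps; set Z := fsum w _ => Z_gt0.
have Zn0 : Z != 0 by rewrite gt_eqF.
exists (fun x => (green w a x - green w b x) / Z); last first.
  rewrite !fsum_arrow_some /w /= (csym b a) -/w.
  by field.
have green_eq d x : eps * green w d x + \sum_y c x y * (green w d x - green w d y)
    = (x == d)%:R * Z.
  transitivity ((\sum_o w x o) * green w d x - \sum_y w x (Some y) * green w d y).
    rewrite sum_option mulrDl -addrA; congr (_ + _).
    by under eq_bigr do rewrite mulrBr; rewrite sumrB mulr_suml.
  have [->|xd] := eqVneq x d; first by rewrite green_pole mul1r.
  by rewrite green_harmonic // subrr mul0r.
move=> x; apply: (mulIf Zn0).
rewrite [RHS]mulrBl -!green_eq mulrDl -mulrA divfK // mulr_suml.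
rewrite (eq_bigr (fun y => c x y * (green w a x - green w a y) - c x y * (green w b x - green w b y))).
  by rewrite sumrB; ring.
by move=> y _; field.
Qed.

Lemma laplace_selfadjoint c u t : (forall x y, c x y = c y x) ->
  \sum_x t x * (\sum_y c x y * (u x - u y)) = \sum_x u x * (\sum_y c x y * (t x - t y)).
Proof.
move=> csym.
have E (p q : V -> R) : \sum_x p x * (\sum_y c x y * (q x - q y)) =
   \sum_x \sum_y c x y * p x * q x - \sum_x \sum_y c x y * p x * q y.
  rewrite -sumrB; apply: eq_bigr => x _; rewrite mulr_sumr -sumrB.
  by apply: eq_bigr => y _; ring.
rewrite !E; congr (_ - _).
  by apply: eq_bigr => x _; apply: eq_bigr => y _; ring.
rewrite exchange_big; apply: eq_bigr => x _; apply: eq_bigr => y _.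
by rewrite csym; ring.
Qed.

Lemma dirichlet_form c u : (forall x y, c x y = c y x) ->
  (\sum_x u x * (\sum_y c x y * (u x - u y))) * 2 = \sum_x \sum_y c x y * (u x - u y) ^+ 2.
Proof.
move=> csym; rewrite -[RHS](_ : \sum_x \sum_y (c x y * u x * (u x - u y) + c y x * u y * (u y - u x)) = _); last first.
  by apply: eq_bigr => x _; apply: eq_bigr => y _; rewrite (csym y x); ring.
under [RHS]eq_bigr do rewrite big_split.
rewrite big_split /= [X in _ = _ + X]exchange_big /=.
suff -> : \sum_x u x * (\sum_y c x y * (u x - u y)) = \sum_x \sum_y c x y * u x * (u x - u y) by ring.
by apply: eq_bigr => x _; rewrite mulr_sumr; apply: eq_bigr => y _; ring.
Qed.

Lemma sum_indicator_diff a b u : \sum_x u x * ((x == a)%:R - (x == b)%:R) = u a - u b.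
Proof.
under eq_bigr do rewrite mulrBr.
rewrite sumrB; congr (_ - _).
  by rewrite (bigD1 a) //= eqxx mulr1 big1 ?addr0 // => x /negPf ->; rewrite mulr0.
by rewrite (bigD1 b) //= eqxx mulr1 big1 ?addr0 // => x /negPf ->; rewrite mulr0.
Qed.

Section Compare.
Variables (e c : V -> V -> R) (kappa : R).
Hypothesis csym : forall x y, c x y = c y x.
Hypothesis e_ge0 : forall x y, 0 <= e x y.
Hypothesis ec : forall x y, e x y <= c x y.
Hypothesis kappa_ge0 : 0 <= kappa.
Hypothesis poincare : forall u, \sum_x u x = 0 ->
  \sum_x u x ^+ 2 <= kappa * \sum_x \sum_y e x y * (u x - u y) ^+ 2.
Variables (a b : V).
Hypothesis ab : a != b.
Hypothesis cab : 1 <= c a b.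

(** The energy of the current equals its voltage R and is at least R ^ 2.  The mean of
    u vanishes, so the energy also controls the squares of u. *)
Lemma potential_bounds (eps : R) u : 0 < eps -> is_potential c eps a b u ->
  0 <= u a - u b <= 1 /\ \sum_x u x ^+ 2 <= 2 * kappa.
Proof.
move=> eps_gt0 up; set D := \sum_x \sum_y c x y * (u x - u y) ^+ 2.
have c_ge0 x y : 0 <= c x y by exact: le_trans (ec x y).
have term_ge0 x y : 0 <= c x y * (u x - u y) ^+ 2 by rewrite mulr_ge0 ?sqr_ge0.
have energy : eps * \sum_x u x ^+ 2 + D / 2 = u a - u b.
  rewrite -(sum_indicator_diff a b u); under [RHS]eq_bigr do rewrite -up mulrDr.
  rewrite big_split /= /D -dirichlet_form // mulfK ?pnatr_eq0 //; congr (_ + _).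
  by rewrite mulr_sumr; apply: eq_bigr => x _; ring.
have mean0 : \sum_x u x = 0.
  have : \sum_x (1 : R) * (eps * u x + \sum_y c x y * (u x - u y)) = 0.
    under eq_bigr do rewrite up.
    by have := sum_indicator_diff a b (fun=> 1); rewrite subrr.
  under eq_bigr do rewrite mulrDr.
  rewrite big_split /= (laplace_selfadjoint _ (fun=> 1)) // [X in _ + X]big1; last first.
    by move=> x _; rewrite big1 ?mulr0 // => y _; rewrite subrr mulr0.
  under eq_bigr do rewrite mul1r.
  by rewrite addr0 -mulr_sumr => /eqP; rewrite mulf_eq0 gt_eqF //= => /eqP.
have sq_ge0 : 0 <= \sum_x u x ^+ 2 by apply: sumr_ge0 => x _; exact: sqr_ge0.
have D_ge : 2 * (u a - u b) ^+ 2 <= D.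
  have inner_ge x y : c x y * (u x - u y) ^+ 2 <= \sum_z c x z * (u x - u z) ^+ 2.
    by rewrite (bigD1 y) //= lerDl; apply: sumr_ge0.
  have D_two : c a b * (u a - u b) ^+ 2 + c b a * (u b - u a) ^+ 2 <= D.
    rewrite /D (bigD1 a) //= [X in _ <= _ + X](bigD1 b) 1?eq_sym //= addrA.
    apply: (@le_trans _ _ (\sum_y c a y * (u a - u y) ^+ 2 + \sum_y c b y * (u b - u y) ^+ 2)).
      exact: lerD.
    by rewrite lerDl; apply: sumr_ge0 => x _; apply: sumr_ge0.
  apply: le_trans D_two.
  rewrite (csym b a) (_ : (u b - u a) ^+ 2 = (u a - u b) ^+ 2); last by ring.
  have := ler_wpM2r (sqr_ge0 (u a - u b)) cab; rewrite mul1r; lra.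
have D_ge0 : 0 <= D by apply: sumr_ge0 => x _; apply: sumr_ge0.
have es_ge0 : 0 <= eps * \sum_x u x ^+ 2 by rewrite mulr_ge0 // ltW.
have R_ge0 : 0 <= u a - u b by lra.
have R_le1 : u a - u b <= 1 by nra.
split; first by rewrite R_ge0.
have D2 : D <= 2 by lra.
apply: le_trans (poincare mean0) _; rewrite mulrC ler_wpM2r //.
apply: le_trans D2; apply: ler_sum => x _; apply: ler_sum => y _.
by rewrite ler_wpM2r ?sqr_ge0.
Qed.

(** The resolvent identity writes the difference of the voltages as
    (eps - eps') * sum_x u x * v x. *)
Lemma potential_compare (eps eps' : R) (u v : V -> R) : 0 < eps -> 0 < eps' -> eps' <= eps ->
  is_potential c eps a b u -> is_potential c eps' a b v ->
  `|(v a - v b) - (u a - u b)| <= 2 * kappa * eps.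
Proof.
move=> eps0 eps'0 le up vp.
have [_ u2] := potential_bounds eps0 up; have [_ v2] := potential_bounds eps'0 vp.
have -> : (v a - v b) - (u a - u b) = (eps - eps') * \sum_x u x * v x.
  rewrite -(sum_indicator_diff a b v) -(sum_indicator_diff a b u).
  under eq_bigr do rewrite -up mulrDr.
  under [X in _ - X]eq_bigr do rewrite -vp mulrDr.
  rewrite !big_split /= (laplace_selfadjoint u v csym).
  rewrite opprD addrACA subrr addr0 -sumrB mulr_sumr.
  by apply: eq_bigr => x _; ring.
rewrite normrM ger0_norm ?subr_ge0 // mulrC.
have : `|\sum_x u x * v x| <= 2 * kappa.
  apply: le_trans (ler_norm_sum _ _ _) _.
  apply: (@le_trans _ _ (\sum_x (u x ^+ 2 + v x ^+ 2) / 2)).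
    apply: ler_sum => x _; rewrite ler_norml.
    have := sqr_ge0 (u x - v x); have := sqr_ge0 (u x + v x); nra.
  by rewrite -mulr_suml big_split /=; lra.
by move=> H; apply: ler_pM; rewrite // ?subr_ge0 // gerBl ltW.
Qed.

End Compare.
End Resistance.

(** * Removing the killing *)

Lemma ratio_perturb (R : realFieldType) (a n X Y ep eta : R) :
  0 < n -> a <= n -> 0 <= X -> X <= Y -> 0 < ep -> 0 < eta -> Y <= eta * (ep * n) ->
  a / n <= (ep * a + X) / (ep * n + Y) + eta.
Proof.
move=> n0 an X0 XY ep0 eta0 Yb; have Y0 := le_trans X0 XY.
have den0 : 0 < ep * n + Y by rewrite ltr_wpDr // mulr_gt0.
rewrite -lerBlDr ler_pdivlMr // mulrBl.
have -> : a / n * (ep * n + Y) = ep * a + a / n * Y by field; rewrite gt_eqF.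
have : a / n * Y <= Y by rewrite ler_piMl // ler_pdivrMr // mul1r.
have : 0 <= eta * Y by rewrite mulr_ge0 // ltW.
rewrite mulrDr; lra.
Qed.

Lemma product_step (R : realFieldType) (p q r t k M N : R) :
  0 <= p <= M -> 0 <= q <= M -> `|q - p| <= N * k -> 0 <= r /\ r <= 1 -> 0 <= t /\ t <= 1 ->
  `|t - r| <= k ->
  [/\ 0 <= p * (1 + r) <= 2 * M, 0 <= q * (1 + t) <= 2 * M &
     `|q * (1 + t) - p * (1 + r)| <= (2 * N + M) * k].
Proof.
move=> /andP[p0 p1] /andP[q0 q1] qp [r0 r1] [t0 t1] tr.
have bound x y : 0 <= x -> x <= M -> 0 <= y -> y <= 1 -> 0 <= x * (1 + y) <= 2 * M.
  by move=> x0 x1 y0 y1; apply/andP; split; [rewrite mulr_ge0 ?addr_ge0|nra].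
split; [exact: bound | exact: bound |].
rewrite (_ : q * (1 + t) - p * (1 + r) = (q - p) * (1 + t) + p * (t - r)); last by ring.
apply: le_trans (ler_normD _ _) _; rewrite !normrM (ger0_norm p0) (@ger0_norm _ (1 + t)) ?addr_ge0 //.
have b1 : `|q - p| * (1 + t) <= (N * k) * 2 by apply: ler_pM; rewrite ?addr_ge0 //; lra.
have b2 : p * `|t - r| <= M * k by apply: ler_pM.
by lra.
Qed.

Section FreeVersusKilled.
Variables (R : realFieldType) (V : finType) (e : rel V) (kappa : R).
Hypothesis e_sym : symmetric e.
Hypothesis e_irr : irreflexive e.
Hypothesis kappa_ge0 : 0 <= kappa.
Hypothesis poincare : forall u : V -> R, \sum_x u x = 0 ->
  \sum_x u x ^+ 2 <= kappa * \sum_x \sum_y (e x y)%:R * (u x - u y) ^+ 2.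
Implicit Types (f : {ffun V -> option V}) (x y z v a b : V) (S T E : {set {set V}}).

Definition conductance S x y : R := (e x y)%:R * (1 + ([set x; y]%SET \in S)%:R).

(** Means of these variables are ratios of total weights, and they span all
    functions of finitely many edges. *)
Definition doubled S T : R := 2 ^+ #|(T :&: S)%SET|.

Definition partition_function eps S : R := fsum (sunk (conductance S) eps) (fun _ => true).

Definition killed_mean eps (phi : {set {set V}} -> R) : R :=
  (\sum_(f | acyclic f) weight (sunk (conductance finset.set0) eps) f * phi (edges f)) /
  partition_function eps finset.set0.

Lemma conductance_sym S x y : conductance S x y = conductance S y x.
Proof. by rewrite /conductance e_sym finset.setUC. Qed.

Lemma sunk_ge0 eps S x o : 0 < eps -> 0 <= sunk (conductance S) eps x o.
Proof. by case: o => [y|] /= eps0; rewrite ?mulr_ge0 ?addr_ge0 ?ler0n // ltW. Qed.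

Lemma partition_function_gt0 eps S : 0 < eps -> 0 < partition_function eps S.
Proof.
move=> eps0; rewrite /partition_function /fsum (bigD1 [ffun=> None]) /=; last first.
  by rewrite andbT; apply/acyclicP => x y; rewrite /step ffunE.
apply: ltr_pwDl; last first.
  by apply: sumr_ge0 => f _; apply: weight_ge0 => x o; exact: sunk_ge0.
by apply: prodr_gt0 => v _; rewrite ffunE.
Qed.

Lemma edge_in_edges f a b : ([set a; b]%SET \in edges f) = (f a == Some b) || (f b == Some a).
Proof. by rewrite -[LHS]/(adj (edges f) a b) adj_edges. Qed.

Lemma weight_double eps S a b f : acyclic f -> a != b -> [set a; b]%SET \notin S ->
  weight (sunk (conductance ([set a; b]%SET |: S)%SET) eps) f =
  weight (sunk (conductance S) eps) f * (1 + (f a == Some b)%:R + (f b == Some a)%:R).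
Proof.
move=> af ab abS.
pose m v (o : option V) : R := if o is Some y then 1 + ([set v; y]%SET == [set a; b]%SET)%:R else 1.
have sE v o : sunk (conductance ([set a; b]%SET |: S)%SET) eps v o =
   sunk (conductance S) eps v o * m v o.
  case: o => [y|] /=; last by rewrite mulr1.
  rewrite /conductance in_setU1 -mulrA; congr (_ * _).
  by case: eqP => [->|_]; rewrite ?(negPf abS) /=; ring.
rewrite /weight; under eq_bigr do rewrite sE.
rewrite big_split /=; congr (_ * _).
have ba : b != a by rewrite eq_sym.
rewrite (bigD1 a) //= (bigD1 b) //= big1 ?mulr1; last first.
  move=> v /andP[va vb]; rewrite /m; case: (f v) => // y.
  case: eqP => [/set2_eq[[vE _]|[vE _]]|]; rewrite ?addr0 //.
    by rewrite vE eqxx in va.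
  by rewrite vE eqxx in vb.
have mE v v' : v != v' -> [set v; v']%SET = [set a; b]%SET -> m v (f v) = 1 + (f v == Some v')%:R :> R.
  move=> vv' vE'; rewrite /m; case: (f v) => [y|]; last by rewrite addr0.
  rewrite -vE'; congr (1 + (nat_of_bool _)%:R); apply/eqP/eqP => [/set2_eq[[_ ->]|[vE _]]|[->]] //.
  by rewrite vE eqxx in vv'.
rewrite (mE a b ab erefl) (mE b a ba (finset.setUC _ _)).
case: (f a =P Some b) => [fa|_]; last by rewrite mulr0n !addr0 mul1r.
case: (f b =P Some a) => [fb|_]; last by rewrite mulr0n !addr0 mulr1.
have /negP[] := acyclicP _ af a b (introT eqP fa).
by apply: connect1; rewrite /step fb.
Qed.

Lemma doubledU1 S f a b : acyclic f -> [set a; b]%SET \notin S ->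
  doubled ([set a; b]%SET |: S)%SET (edges f) =
  doubled S (edges f) * (1 + (f a == Some b)%:R + (f b == Some a)%:R).
Proof.
move=> af abS; have := edge_in_edges f a b.
have nfab : ~~ ((f a == Some b) && (f b == Some a)).
  apply/negP => /andP[/eqP fa fb].
  by have /negP[] := acyclicP _ af a b (introT eqP fa); exact: connect1.
rewrite /doubled finset.setIUr; case: (boolP ([set a; b]%SET \in edges f)) => abf.
  have -> : (edges f :&: [set [set a; b]])%SET = [set [set a; b]]%SET.
    by apply/finset.setIidPr; rewrite finset.sub1set.
  rewrite cardsU1 inE (negPf abS) andbF add1n exprS => /esym abE.
  rewrite mulrC; congr (_ * _); move: nfab abE.
  by case: (f a == Some b); case: (f b == Some a) => //= _ _; rewrite ?mulr0n ?mulr1n ?addr0 mulr2n.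
have -> : (edges f :&: [set [set a; b]])%SET = finset.set0.
  by apply/eqP; rewrite setI_eq0 disjoint_sym disjoints1.
by rewrite finset.set0U => /esym/negbT; rewrite negb_or => /andP[/negPf -> /negPf ->]; rewrite !addr0 mulr1.
Qed.

Definition edge_set S := forall ed, ed \in S -> exists a b, e a b /\ ed = [set a; b]%SET.

Lemma weight_doubled eps S f : acyclic f -> edge_set S ->
  weight (sunk (conductance S) eps) f =
  weight (sunk (conductance finset.set0) eps) f * doubled S (edges f).
Proof.
move=> af; have [n] := ubnP #|S|; elim: n S => // n IH S Sn eS.
have [->|[ed edS]] := set_0Vmem S.
  by rewrite /doubled finset.setI0 cards0 mulr1.
have [a [b [eab edE]]] := eS _ edS.
have ab : a != b by apply: contraTneq eab => ->; rewrite e_irr.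
pose S' := (S :\ ed)%SET.
have SE : S = ([set a; b]%SET |: S')%SET by rewrite -edE finset.setD1K.
have nab : [set a; b]%SET \notin S' by rewrite -edE !inE eqxx.
have eS' : edge_set S' by move=> ed'; rewrite inE => /andP[_ /eS].
clearbody S'; rewrite SE weight_double // doubledU1 // IH ?mulrA //.
by move: Sn; rewrite SE cardsU1 nab add1n ltnS.
Qed.

Lemma partition_function_doubled eps S : 0 < eps -> edge_set S ->
  partition_function eps S =
  killed_mean eps (doubled S) * partition_function eps finset.set0.
Proof.
move=> eps0 eS; rewrite /killed_mean divfK ?gt_eqF ?partition_function_gt0 //.
rewrite /partition_function /fsum (eq_bigl (fun f => acyclic f)) => [|f]; last by rewrite andbT.
by apply: eq_bigr => f af; rewrite weight_doubled.
Qed.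

(** Doubling one edge multiplies the total weight by 1 plus its resistance. *)
Lemma partition_function_step eps S a b : 0 < eps -> e a b -> [set a; b]%SET \notin S ->
  exists2 u, is_potential (conductance S) eps a b u &
    partition_function eps ([set a; b]%SET |: S)%SET =
    partition_function eps S * (1 + (u a - u b)).
Proof.
move=> eps0 eab abS.
have ab : a != b by apply: contraTneq eab => ->; rewrite e_irr.
have [u up uE] := kirchhoff a b (conductance_sym S) (partition_function_gt0 S eps0).
exists u => //; rewrite mulrDr mulr1 [X in _ + X]mulrC.
have cab : conductance S a b = 1 by rewrite /conductance eab (negPf abS) addr0 mulr1.
rewrite cab mul1r in uE; rewrite -uE /partition_function /fsum.
rewrite (eq_bigl (fun f => acyclic f)) => [|f]; last by rewrite andbT.
rewrite [X in _ = X + _](eq_bigl (fun f => acyclic f)) => [|f]; last by rewrite andbT.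
rewrite [X in _ = _ + (X + _)]big_mkcondr [X in _ = _ + (_ + X)]big_mkcondr -!big_split /=.
apply: eq_bigr => f af; rewrite weight_double //.
by case: ifP => _; case: ifP => _ /=; ring.
Qed.

(** Double the edges of S one at a time; the graph only gains conductance, so the
    Poincare inequality of the original graph serves at every step. *)
Lemma killed_mean_doubled_compare eps eps' S : 0 < eps -> 0 < eps' -> eps' <= eps ->
  edge_set S ->
  [/\ 0 <= killed_mean eps (doubled S) <= 2 ^+ #|S|, 0 <= killed_mean eps' (doubled S) <= 2 ^+ #|S| &
   `|killed_mean eps' (doubled S) - killed_mean eps (doubled S)| <=
     (#|S| * 2 ^ #|S|)%:R * (2 * kappa * eps)].
Proof.
move=> eps0 eps'0 le; have [n] := ubnP #|S|; elim: n S => // n IH S Sn eS.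
have one ep : 0 < ep -> killed_mean ep (doubled finset.set0) = 1.
  move=> ep0; have Z0 := partition_function_gt0 finset.set0 ep0.
  apply: (mulIf (lt0r_neq0 Z0)); rewrite mul1r -partition_function_doubled //.
  by move=> ed; rewrite inE.
have [->|[ed edS]] := set_0Vmem S.
  by rewrite !one // cards0 expr0 ler01 lexx subrr normr0 mul0n mul0r.
have [a [b [eab edE]]] := eS _ edS.
have ab : a != b by apply: contraTneq eab => ->; rewrite e_irr.
pose S' := (S :\ ed)%SET.
have SE : S = ([set a; b]%SET |: S')%SET by rewrite -edE finset.setD1K.
have nab : [set a; b]%SET \notin S' by rewrite -edE !inE eqxx.
have eS' : edge_set S' by move=> ed'; rewrite inE => /andP[_ /eS].
clearbody S'; have S'n : (#|S'| < n)%N by move: Sn; rewrite SE cardsU1 nab add1n ltnS.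
have [h1 h2 h3] := IH S' S'n eS'; rewrite SE.
have [u up uE] := partition_function_step eps0 eab nab.
have [v vp vE] := partition_function_step eps'0 eab nab.
have eS2 : edge_set ([set a; b]%SET |: S')%SET.
  by move=> ed'; rewrite in_setU1 => /orP[/eqP ->|/eS' //]; exists a, b.
have cab : 1 <= conductance S' a b by rewrite /conductance eab mul1r lerDl ler0n.
have e_ge0 x y : 0 <= (e x y)%:R :> R by rewrite ler0n.
have ec x y : (e x y)%:R <= conductance S' x y.
  by rewrite /conductance ler_peMr // lerDl ler0n.
have csym := conductance_sym S'.
have cmp := potential_compare csym e_ge0 ec kappa_ge0 poincare ab cab eps0 eps'0 le up vp.
have [ub _] := potential_bounds csym e_ge0 ec kappa_ge0 poincare ab cab eps0 up.
have [vb _] := potential_bounds csym e_ge0 ec kappa_ge0 poincare ab cab eps'0 vp.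
have stepE ep (t : V -> R) : 0 < ep ->
  partition_function ep ([set a; b]%SET |: S')%SET = partition_function ep S' * (1 + (t a - t b)) ->
  killed_mean ep (doubled ([set a; b]%SET |: S')%SET) = killed_mean ep (doubled S') * (1 + (t a - t b)).
  move=> ep0; rewrite (partition_function_doubled ep0 eS2) (partition_function_doubled ep0 eS').
  move: (killed_mean _ _) (killed_mean _ _) => k1 k2 kE.
  have /lt0r_neq0/mulIf := partition_function_gt0 finset.set0 ep0; apply.
  by rewrite kE mulrAC.
rewrite (stepE _ _ eps0 uE) (stepE _ _ eps'0 vE) cardsU1 nab add1n exprS.
move: (killed_mean eps _) (killed_mean eps' _) h1 h2 h3 => p q h1 h2 h3.
move: (u a - u b) (v a - v b) ub vb cmp => r t /andP[r0 r1] /andP[t0 t1] cmp.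
set k := 2 * kappa * eps in cmp h3 *.
have k0 : 0 <= k by apply: le_trans cmp.
have [a1 a2 a3] := product_step h1 h2 h3 (conj r0 r1) (conj t0 t1) cmp.
split=> //; apply: le_trans a3 _; apply: ler_wpM2r => //.
rewrite -natrX -natrM -natrD ler_nat expnS; move: (2 ^ _)%N => m.
by rewrite (mulSn #|S'|) mulnCA addnC leq_add2r leq_pmull.
Qed.

(** The indicator that i is an edge of T is doubled {i} - 1 and its complement is
    2 - doubled {i}; expanding along i costs a factor 1 + 1 + 2 + 1 = 5. *)
Lemma local_function_bound (L : ({set {set V}} -> R) -> R) (eta : R) E0 :
  (forall phi psi, L (fun T => phi T + psi T) = L phi + L psi) ->
  (forall k phi, L (fun T => k * phi T) = k * L phi) ->
  (forall S, S \subset E0 -> `|L (doubled S)| <= eta) ->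
  forall E S (A : {set {set V}} -> R), E \subset E0 -> S \subset E0 -> [disjoint E & S] ->
  (forall T, `|A T| <= 1) ->
  `|L (fun T => A (T :&: E)%SET * doubled S T)| <= 5 ^+ #|E| * eta.
Proof.
move=> LD LZ LS E; have [n] := ubnP #|E|; elim: n E => // n IH E En S A EE SE dES A1.
have [->|[i iE]] := set_0Vmem E.
  rewrite (_ : (fun T => _) = (fun T => A finset.set0 * doubled S T)).
    rewrite LZ normrM cards0 expr0 mul1r -[leRHS]mul1r.
    by apply: ler_pM => //; exact: LS.
  by apply/funext => T; rewrite finset.setI0.
pose E' := (E :\ i)%SET.
have EE' : E = (i |: E')%SET by rewrite finset.setD1K.
have iE' : i \notin E' by rewrite !inE eqxx.
have iS : i \notin S by move: dES => /disjointFr/(_ iE) ->.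
have iE0 : i \in E0 by exact: (fintype.subsetP EE).
have E'E0 : E' \subset E0 by apply: fintype.subset_trans EE; exact: finset.subsetDl.
have dE'S : [disjoint E' & S] by apply: disjointWl dES; exact: finset.subsetDl.
have SiE0 : (i |: S)%SET \subset E0 by rewrite finset.subUset finset.sub1set iE0.
have dE'Si : [disjoint E' & (i |: S)%SET].
  rewrite disjoint_subset; apply/fintype.subsetP => j jE'.
  rewrite !inE negb_or (disjointFr dE'S jE') andbT.
  by apply: contraNneq iE' => <-.
pose A1' B := A (i |: B)%SET.
have E'n : (#|E'| < n)%N by move: En; rewrite EE' cardsU1 iE' add1n ltnS.
clearbody E'.
have key T : A (T :&: E)%SET * doubled S T =
  (A1' (T :&: E')%SET * doubled (i |: S)%SET T + (-1) * (A1' (T :&: E')%SET * doubled S T))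
    + (2 * (A (T :&: E')%SET * doubled S T) + (-1) * (A (T :&: E')%SET * doubled (i |: S)%SET T)).
  have [iT|iT] := boolP (i \in T).
    have TiE : (T :&: [set i] = [set i])%SET by apply/finset.setIidPr; rewrite finset.sub1set.
    have -> : doubled (i |: S)%SET T = 2 * doubled S T.
      by rewrite /doubled finset.setIUr TiE cardsU1 inE (negPf iS) andbF exprS.
    rewrite /A1' EE' finset.setIUr TiE.
    move: (A _) (A _) (doubled _ _) => x y m; ring.
  have TiE : (T :&: [set i] = finset.set0)%SET.
    by apply/eqP; rewrite setI_eq0 disjoint_sym disjoints1.
  have -> : doubled (i |: S)%SET T = doubled S T by rewrite /doubled finset.setIUr TiE finset.set0U.
  rewrite EE' finset.setIUr TiE finset.set0U.
  move: (A1' _) (A _) (doubled _ _) => x y m; ring.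
rewrite (funext key) !LD !LZ.
have b1 := IH E' E'n (i |: S)%SET A1' E'E0 SiE0 dE'Si (fun B => A1 _).
have b2 := IH E' E'n S A1' E'E0 SE dE'S (fun B => A1 _).
have b3 := IH E' E'n S A E'E0 SE dE'S A1.
have b4 := IH E' E'n (i |: S)%SET A E'E0 SiE0 dE'Si A1.
rewrite EE' cardsU1 iE' add1n exprS -mulrA; set bb := 5 ^+ _ * eta in b1 b2 b3 b4 *.
move: b1 b2 b3 b4; rewrite !ler_norml => /andP[? ?] /andP[? ?] /andP[? ?] /andP[? ?].
by apply/andP; split; lra.
Qed.

Definition follows f : bool := [forall x, if f x is Some y then e x y else true].

Lemma weight_follows eps f : weight (sunk (conductance finset.set0) eps) f =
  (follows f)%:R * eps ^+ #|[pred v | f v == None]|.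
Proof.
have [/forallP ff|nf] := boolP (follows f); last first.
  rewrite mul0r /weight; move: nf; rewrite negb_forall => /existsP[x].
  case fx: (f x) => [y|//] nexy; rewrite (bigD1 x) //= fx /= /conductance.
  by rewrite (negPf nexy) !mul0r.
rewrite mul1r /weight (bigID [pred v | f v == None]) /= [X in _ * X]big1 ?mulr1.
  rewrite (eq_bigr (fun=> eps)) => [|v /eqP -> //]; exact: prodr_const.
move=> v; have := ff v; case: (f v) => [y|//] evy _ /=.
by rewrite /conductance evy inE addr0 mulr1.
Qed.

(** As eps' tends to 0 only the forests with a single root keep their weight, and these
    are the rooted spanning trees. *)
Lemma free_le_small_killing (v0 : V) (A : {set {set V}} -> bool) eta eps :
  0 < eta -> 0 < eps -> (0 < #|spanning_trees e|)%N ->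
  exists eps', [/\ 0 < eps', eps' <= eps &
    #|[pred T | (T \in spanning_trees e) && A T]|%:R / #|spanning_trees e|%:R <=
      killed_mean eps' (fun T => (A T)%:R) + eta].
Proof.
move=> eta0 eps0 trees_gt0.
pose F1 := [pred f | [&& acyclic f, one_root f, follows f & true]].
pose FA := [pred f | [&& acyclic f, one_root f, follows f & A (edges f)]].
have cF1 : #|F1| = (#|spanning_trees e| * #|V|)%N.
  rewrite (card_rooted (fun=> true) e_sym); congr (_ * _)%N.
  by apply: fintype.eq_card => T; rewrite !inE andbT.
have cFA : #|FA| = (#|[pred T | (T \in spanning_trees e) && A T]| * #|V|)%N by rewrite (card_rooted A e_sym).
pose M : R := #|[pred f : {ffun V -> option V} | acyclic f]|%:R.
have V_gt0 : (0 < #|V|)%N by apply/card_gt0P; exists v0.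
have n1_gt0 : 0 < #|F1|%:R :> R by rewrite ltr0n cF1 muln_gt0 trees_gt0.
have ratioE : #|[pred T | (T \in spanning_trees e) && A T]|%:R / #|spanning_trees e|%:R
    = #|FA|%:R / #|F1|%:R :> R.
  by rewrite cFA cF1 !natrM -mulf_div divff ?mulr1 // pnatr_eq0 -lt0n.
(* small against the number of rooted trees divided by that of all forests *)
pose eps' := Num.min eps (Num.min 1 (eta * #|F1|%:R / (M + 1))).
have M_ge0 : 0 <= M by rewrite ler0n.
have eps'0 : 0 < eps'.
  by rewrite !lt_min eps0 ltr01 divr_gt0 ?mulr_gt0 // ltr_wpDl.
have eps'1 : eps' <= 1 by rewrite !ge_min lexx /= orbT.
have eps'M : eps' * (M + 1) <= eta * #|F1|%:R.
  rewrite -ler_pdivlMr ?ltr_wpDl //.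
  by rewrite /eps' !ge_min lexx !orbT.
exists eps'; split=> //; first by rewrite ge_min lexx.
rewrite ratioE.
pose W f := weight (sunk (conductance finset.set0) eps') f.
have W1 f : one_root f -> W f = (follows f)%:R * eps'.
  by move=> /eqP f1; rewrite /W weight_follows f1 expr1.
have W2 f : acyclic f -> ~~ one_root f -> 0 <= W f <= eps' ^+ 2.
  move=> af f1; rewrite /W weight_follows.
  have r2 : (2 <= #|[pred v | f v == None]|)%N.
    rewrite ltn_neqAle eq_sym f1 /=; apply/card_gt0P.
    by have [r _ fr] := acyclic_root v0 af; exists r; rewrite inE fr.
  apply/andP; split; first by rewrite mulr_ge0 ?ler0n ?exprn_ge0 ?ltW.
  apply: (@le_trans _ _ (eps' ^+ #|[pred v | f v == None]|)).
    by apply: ler_piMl; [exact/exprn_ge0/ltW | rewrite lern1 leq_b1].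
  by apply: ler_wiXn2l => //; exact: ltW.
pose X := \sum_(f | acyclic f && ~~ one_root f) W f * (A (edges f))%:R.
pose Y := \sum_(f | acyclic f && ~~ one_root f) W f.
have XY : 0 <= X /\ X <= Y.
  split; first by apply: sumr_ge0 => f /andP[af f1]; have /andP[? _] := W2 _ af f1; rewrite mulr_ge0.
  apply: ler_sum => f /andP[af f1]; have /andP[? _] := W2 _ af f1.
  by rewrite ler_piMr // lern1 leq_b1.
have YM : Y <= eps' ^+ 2 * M.
  apply: (@le_trans _ _ (\sum_(f | acyclic f) eps' ^+ 2)); last first.
    rewrite sumr_const /M mulr_natr; exact: lexx.
  rewrite /Y big_mkcondr; apply: ler_sum => f af; case: ifP => [f1|_]; rewrite ?sqr_ge0 //.
  by have /andP[_] := W2 _ af f1.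
have numE : \sum_(f | acyclic f) W f * (A (edges f))%:R = eps' * #|FA|%:R + X.
  rewrite (bigID (fun f => one_root f)) /=; congr (_ + _).
  rewrite mulr_natr -sumr_const big_mkcond [RHS]big_mkcond; apply: eq_bigr => f _.
  rewrite inE; case: acyclic => //=; case: ifP => //= f1; rewrite W1 //.
  by case: follows; case: (A _); rewrite /= ?mul1r ?mulr1 ?mul0r ?mulr0.
have denE : partition_function eps' finset.set0 = eps' * #|F1|%:R + Y.
  rewrite /partition_function /fsum (eq_bigl (fun f => acyclic f)) => [|f]; last by rewrite andbT.
  rewrite (bigID (fun f => one_root f)) /=; congr (_ + _).
  rewrite mulr_natr -sumr_const big_mkcond [RHS]big_mkcond; apply: eq_bigr => f _.
  rewrite inE; case: acyclic => //=; case: ifP => //= f1; rewrite -/(W f) W1 //.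
  by case: follows; rewrite /= ?mul1r ?mulr1 ?mul0r ?mulr0.
rewrite /killed_mean numE denE.
have aN : #|FA|%:R <= #|F1|%:R :> R.
  rewrite ler_nat; apply: subset_leq_card; apply/fintype.subsetP => f; rewrite !inE.
  by case/and4P => -> -> ->.
move: (#|FA|%:R : R) (#|F1|%:R : R) aN n1_gt0 eps'M => a n aN n0 eps'M.
have [X0 XleY] := XY.
apply: ratio_perturb => //; apply: le_trans YM _.
rewrite expr2 -mulrA [leRHS]mulrCA; apply: ler_wpM2l; first exact: ltW.
by apply: le_trans eps'M; rewrite mulrDr mulr1 lerDl ltW.
Qed.

(** Compare first with a killing rate eps' so small that it does not matter, then eps'
    with eps. *)
Theorem free_le_killed (v0 : V) eps E (A : {set {set V}} -> bool) : 0 < eps -> edge_set E ->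
  (forall T, A T = A (T :&: E)%SET) -> (0 < #|spanning_trees e|)%N ->
  #|[pred T | (T \in spanning_trees e) && A T]|%:R / #|spanning_trees e|%:R <=
  killed_mean eps (fun T => (A T)%:R) +
    5 ^+ #|E| * ((#|E| * 2 ^ #|E|)%:R * (2 * kappa * eps)).
Proof.
move=> eps0 eE AE trees_gt0; apply/ler_addgt0Pr => eta eta0.
have [eps' [eps'0 le lim]] := free_le_small_killing v0 A eta0 eps0 trees_gt0.
apply: le_trans lim _; rewrite lerD2r.
pose L (phi : {set {set V}} -> R) := killed_mean eps' phi - killed_mean eps phi.
have meanD ep phi psi : killed_mean ep (fun T => phi T + psi T) = killed_mean ep phi + killed_mean ep psi.
  by rewrite /killed_mean -mulrDl -big_split /=; congr (_ / _); apply: eq_bigr => f _; rewrite mulrDr.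
have meanZ ep k phi : killed_mean ep (fun T => k * phi T) = k * killed_mean ep phi.
  by rewrite /killed_mean mulrA mulr_sumr; congr (_ / _); apply: eq_bigr => f _; rewrite mulrCA.
have LD phi psi : L (fun T => phi T + psi T) = L phi + L psi by rewrite /L !meanD; ring.
have LZ k phi : L (fun T => k * phi T) = k * L phi by rewrite /L !meanZ; ring.
set eta' := (#|E| * 2 ^ #|E|)%:R * (2 * kappa * eps).
have Lb S : S \subset E -> `|L (doubled S)| <= eta'.
  move=> SE; have eS : edge_set S by move=> ed edS; apply: eE; exact: (fintype.subsetP SE).
  have [_ _ H] := killed_mean_doubled_compare eps0 eps'0 le eS; apply: le_trans H _.
  apply: ler_wpM2r; first by rewrite !mulr_ge0 // ltW.
  by rewrite ler_nat leq_mul ?leq_exp2l // subset_leq_card.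
have A1 T : `|(A T)%:R| <= 1 :> R by case: (A T); rewrite ?normr1 ?normr0.
have := @local_function_bound L eta' E LD LZ Lb E finset.set0 (fun T => (A T)%:R).
have -> : (fun T => (A (T :&: E)%SET)%:R * doubled finset.set0 T) = (fun T => (A T)%:R).
  by apply/funext => T; rewrite -AE /doubled finset.setI0 cards0 expr0 mulr1.
have dE0 : [disjoint E & finset.set0] by rewrite -setI_eq0 finset.setI0.
move=> /(_ (fintype.subxx _) (finset.sub0set _) dE0 A1).
by rewrite ler_norml /L => /andP[_]; rewrite lerBlDl.
Qed.

End FreeVersusKilled.

(** * The Poincare inequality on a grid *)

Section GridPoincare.
Variables (R : realFieldType) (d M : nat).
Local Notation K := {ffun 'I_d -> 'I_M}.
Implicit Types (k l : K) (i : 'I_d) (a b c : 'I_M) (F : K -> R).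

Definition setc k i c : K := [ffun j : 'I_d => if j == i then c else k j].

Definition consec a b := (b == a.+1 :> nat) || (a == b.+1 :> nat).

Lemma sum_sqr_le (n : nat) (f : nat -> R) :
  (\sum_(i < n) f i) ^+ 2 <= n%:R * \sum_(i < n) f i ^+ 2.
Proof.
elim: n => [|n IH]; first by rewrite !big_ord0 mulr0 expr0n.
rewrite !big_ord_recr /=; set s := \sum_(i < n) f i in IH *; set q := \sum_(i < n) f i ^+ 2 in IH *.
suff H : 2 * s * f n <= n%:R * f n ^+ 2 + q by rewrite -natr1 sqrrD; lra.
have : 0 <= \sum_(i < n) (f i - f n) ^+ 2 by apply: sumr_ge0 => i _; exact: sqr_ge0.
have -> : \sum_(i < n) (f i - f n) ^+ 2 = q - 2 * s * f n + n%:R * f n ^+ 2; last by lra.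
rewrite (eq_bigr (fun i : 'I_n => f i ^+ 2 - 2 * f i * f n + f n ^+ 2)); last by move=> i _; ring.
rewrite big_split sumrB /= sumr_const card_ord -[X in _ + X = _]mulr_natl.
by congr (_ - _ + _); rewrite -mulr_suml -mulr_sumr.
Qed.

Lemma line_bound (h : nat -> R) (m a b : nat) : (a <= m)%N -> (b <= m)%N ->
  (h a - h b) ^+ 2 <= m%:R * \sum_(c < m) (h c.+1 - h c) ^+ 2.
Proof.
wlog ab : a b / (a <= b)%N.
  move=> H am bm; case: (leqP a b) => [ab|/ltnW ba]; first exact: H.
  by rewrite -(opprB (h b)) sqrrN; exact: H.
move=> am bm.
pose f (c : nat) : R := if (a <= c < b)%N then h c.+1 - h c else 0.
have fE : \sum_(c < m) f c = h b - h a.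
  rewrite -(big_mkord xpredT f) /f -big_mkcond /= (big_cat_nat _ (n := a)) //= big1_seq ?add0r; last first.
    by move=> c; rewrite mem_index_iota => /andP[/andP[? _] /andP[_ ?]]; lia.
  rewrite (big_cat_nat _ (n := b)) //= [X in _ + X]big1_seq ?addr0; last first.
    by move=> c; rewrite mem_index_iota => /andP[/andP[_ ?] /andP[? _]]; lia.
  rewrite big_nat_cond (eq_bigl (fun t : nat => (a <= t < b)%N && true)) => [|c]; last by rewrite andbT andbb.
  by rewrite -big_nat_cond telescope_sumr.
have := sum_sqr_le m f; rewrite fE -sqrrN opprB => /le_trans; apply.
apply: ler_wpM2l; first exact: ler0n.
by apply: ler_sum => c _; rewrite /f; case: ifP => // _; rewrite expr0n sqr_ge0.
Qed.

Lemma setcE k i c j : setc k i c j = if j == i then c else k j.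
Proof. by rewrite ffunE. Qed.

Lemma setc_setc k i c c' : setc (setc k i c) i c' = setc k i c'.
Proof. by apply/ffunP => j; rewrite !setcE; case: eqP. Qed.

Lemma setc_id k i : setc k i (k i) = k.
Proof. by apply/ffunP => j; rewrite !setcE; case: eqP => [->|]. Qed.

(** The first t coordinates of l and the others of k: the steps of a path from k to l
    that changes one coordinate at a time. *)
Definition splice (t : nat) k l : K := [ffun j : 'I_d => if (j < t)%N then l j else k j].

Lemma spliceK t : involutive (fun p : K * K => (splice t p.1 p.2, splice t p.2 p.1)).
Proof.
by move=> [k l] /=; congr (_, _); apply/ffunP => j; rewrite !ffunE; case: (j < t)%N.
Qed.

Lemma splice_step i k l :
  splice i.+1 k l = setc (splice i k l) i (splice i l k i).
Proof.
apply/ffunP => j; rewrite !ffunE ltnn ltnS leq_eqVlt.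
have [->|ji] := eqVneq j i; first by rewrite eqxx.
by rewrite (_ : (j == i :> nat) = false) //; apply: contraNF ji => /eqP/ord_inj ->.
Qed.

Lemma sum_splice (t : nat) (G : K -> K -> R) :
  \sum_(k : K) \sum_(l : K) G (splice t k l) (splice t l k) = \sum_(k : K) \sum_(l : K) G k l.
Proof.
rewrite !pair_big /= [RHS](reindex_inj (can_inj (spliceK t))) /=.
by apply: eq_bigr.
Qed.

Definition coordinate_energy i F := \sum_(k : K) \sum_(c < M) (consec (k i) c)%:R * (F k - F (setc k i c)) ^+ 2.

Lemma sum_line i (G : K -> 'I_M -> R) :
  \sum_(k : K) \sum_(c < M) G (setc k i c) (k i) = \sum_(k : K) \sum_(c < M) G k c.
Proof.
pose s (p : K * 'I_M) := (setc p.1 i p.2, p.1 i).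
have sK : involutive s.
  by move=> [k c]; rewrite /s /= setc_setc setc_id setcE eqxx.
rewrite !pair_big /= [RHS](reindex_inj (can_inj sK)) /=.
by apply: eq_bigr.
Qed.

Definition line_energy i F k : R :=
  \sum_a \sum_b (consec a b)%:R * (F (setc k i a) - F (setc k i b)) ^+ 2.

(** Telescope along the line through k in direction i. *)
Lemma coordinate_step i F k c :
  (F k - F (setc k i c)) ^+ 2 <= M%:R * line_energy i F k.
Proof.
(* the line through k in direction i, extended by 0 outside the grid *)
pose h (a : nat) := if insub a is Some a' then F (setc k i a') else 0.
have hE (a : 'I_M) : h a = F (setc k i a) by rewrite /h valK.
have M0 : (0 < M)%N by exact: leq_ltn_trans (ltn_ord c).
rewrite -{1}(setc_id k i) -!hE.
have aM (a : 'I_M) : (a <= M.-1)%N by rewrite -ltnS prednK.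
apply: le_trans (line_bound h (aM (k i)) (aM c)) _.
apply: ler_pM; rewrite ?ler0n ?ler_nat ?leq_pred //.
  by apply: sumr_ge0 => j _; exact: sqr_ge0.
have wd : (M.-1 <= M)%N by exact: leq_pred.
have nx (j : 'I_M.-1) : (j.+1 < M)%N by have := ltn_ord j; rewrite -ltnS prednK.
apply: (@le_trans _ _ (\sum_(j < M.-1) \sum_b (consec (Ordinal (nx j)) b)%:R * (F (setc k i (Ordinal (nx j))) - F (setc k i b)) ^+ 2)).
  apply: ler_sum => j _; rewrite (bigD1 (widen_ord wd j)) //=.
  rewrite {1}/consec /= eqxx orbT mul1r -!hE lerDl.
  by apply: sumr_ge0 => b _; rewrite mulr_ge0 ?sqr_ge0.
pose G a := \sum_b (consec a b)%:R * (F (setc k i a) - F (setc k i b)) ^+ 2.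
have G0 a : 0 <= G a by apply: sumr_ge0 => b _; rewrite mulr_ge0 ?sqr_ge0.
rewrite -/(G _) (eq_bigr (fun j => G (Ordinal (nx j)))) //.
pose P := [set Ordinal (nx j) | j in [set: 'I_M.-1]]%SET.
rewrite [leRHS](bigID (mem P)) /= -[leLHS]addr0; apply: lerD; last by apply: sumr_ge0 => a _; exact: G0.
rewrite big_imset /=; last by move=> j j' _ _ [] /val_inj.
by rewrite le_eqVlt; apply/orP; left; apply/eqP; apply: eq_bigl => j; rewrite inE.
Qed.

Lemma sum_line_energy i F : \sum_k line_energy i F k = M%:R * coordinate_energy i F.
Proof.
pose G k (_ : 'I_M) := \sum_b (consec (k i) b)%:R * (F k - F (setc k i b)) ^+ 2.
transitivity (\sum_(k : K) \sum_(c < M) G (setc k i c) (k i)).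
  apply: eq_bigr => k _; apply: eq_bigr => c _; rewrite /G setcE eqxx.
  by apply: eq_bigr => b _; rewrite setc_setc.
rewrite sum_line /coordinate_energy mulr_sumr; apply: eq_bigr => k _.
by rewrite /G sumr_const card_ord mulr_natl.
Qed.

Lemma coordinate_energy_le (e : rel K) i F : (forall k c, consec (k i) c -> e k (setc k i c)) ->
  coordinate_energy i F <= \sum_(k : K) \sum_(l : K) (e k l)%:R * (F k - F l) ^+ 2.
Proof.
move=> eP; apply: ler_sum => k _; pose G l := (e k l)%:R * (F k - F l) ^+ 2.
have G0 l : 0 <= G l by rewrite mulr_ge0 ?sqr_ge0.
apply: (@le_trans _ _ (\sum_c G (setc k i c))).
  apply: ler_sum => c _; rewrite ler_wpM2r ?sqr_ge0 // ler_nat.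
  by case: (boolP (consec _ _)) => // /eP ->.
pose P := [set setc k i c | c in [set: 'I_M]]%SET.
rewrite [leRHS](bigID (mem P)) /= -[leLHS]addr0; apply: lerD; last by apply: sumr_ge0 => a _; exact: G0.
rewrite big_imset /=; last first.
  by move=> c c' _ _ /ffunP/(_ i); rewrite !setcE eqxx.
by rewrite le_eqVlt; apply/orP; left; apply/eqP; apply: eq_bigl => j; rewrite inE.
Qed.

Lemma splice0 k l : splice 0 k l = k.
Proof. by apply/ffunP => j; rewrite ffunE. Qed.

Lemma splice_all k l : splice d k l = l.
Proof. by apply/ffunP => j; rewrite ffunE ltn_ord. Qed.

(** Compare all pairs of points along paths that change one coordinate at a time.  At
    step i the pair formed by the current point and the complementary one is again
    uniform, so each coordinate contributes at most the energy in its direction. *)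
Lemma grid_poincare (e : rel K) F :
  (forall k i c, consec (k i) c -> e k (setc k i c)) -> \sum_k F k = 0 ->
  \sum_k F k ^+ 2 <= (d ^ 2 * M ^ 2)%:R * \sum_(k : K) \sum_(l : K) (e k l)%:R * (F k - F l) ^+ 2.
Proof.
move=> eP F0; set En := \sum_(k : K) \sum_(l : K) _.
have En0 : 0 <= En by apply: sumr_ge0 => k _; apply: sumr_ge0 => l _; rewrite mulr_ge0 ?sqr_ge0.
have lhs : \sum_(k : K) \sum_(l : K) (F k - F l) ^+ 2 = #|{: K}|%:R * 2 * \sum_k F k ^+ 2.
  transitivity (\sum_k (#|{: K}|%:R * F k ^+ 2 + \sum_l F l ^+ 2)).
    apply: eq_bigr => k _; rewrite (eq_bigr (fun l => F k ^+ 2 - 2 * F k * F l + F l ^+ 2)); last by move=> l _; ring.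
    by rewrite big_split sumrB /= -[X in _ - X + _]mulr_sumr F0 mulr0 subr0 sumr_const mulr_natl.
  rewrite big_split /= -mulr_sumr sumr_const -[X in _ + X = _]mulr_natl.
  by rewrite -mulrDl; congr (_ * _); rewrite mulr_natr mulr2n.
have rhs : \sum_(k : K) \sum_(l : K) (F k - F l) ^+ 2 <= d%:R * \sum_(i < d) (#|{: K}|%:R * (M%:R * (M%:R * En))).
  apply: (@le_trans _ _ (\sum_(k : K) \sum_(l : K) d%:R * \sum_(i < d) (F (splice i k l) - F (splice i.+1 k l)) ^+ 2)).
    apply: ler_sum => k _; apply: ler_sum => l _.
    have := sum_sqr_le d (fun t : nat => F (splice t k l) - F (splice t.+1 k l)).
    suff -> : \sum_(i < d) (F (splice i k l) - F (splice i.+1 k l)) = F k - F l by [].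
    rewrite -(big_mkord xpredT (fun t : nat => F (splice t k l) - F (splice t.+1 k l))).
    rewrite (eq_bigr (fun t : nat => - (F (splice t.+1 k l) - F (splice t k l)))); last by move=> i _; rewrite opprB.
    by rewrite sumrN (telescope_sumr (fun t : nat => F (splice t k l))) // opprB splice0 splice_all.
  under eq_bigr do rewrite -mulr_sumr exchange_big /=.
  rewrite -mulr_sumr exchange_big /=; apply: ler_wpM2l; first exact: ler0n.
  apply: ler_sum => i _.
  under eq_bigr do under eq_bigr do rewrite splice_step.
  rewrite (sum_splice i (fun k l => (F k - F (setc k i (l i))) ^+ 2)).
  apply: (@le_trans _ _ (\sum_(k : K) \sum_(l : K) M%:R * line_energy i F k)).
    by apply: ler_sum => k _; apply: ler_sum => l _; exact: coordinate_step.
  under eq_bigr do rewrite sumr_const -[_ *+ #|_|]mulr_natl.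
  rewrite -mulr_sumr -mulr_sumr sum_line_energy.
  do 3 (apply: ler_wpM2l; first exact: ler0n).
  by apply: coordinate_energy_le => k c; exact: eP.
have [K0|K0] := posnP #|{: K}|.
  rewrite big1 ?mulr_ge0 ?ler0n // => k _; exfalso.
  by have := max_card (pred1 k); rewrite card1 K0.
have K0' : 0 < #|{: K}|%:R * 2 :> R by rewrite mulr_gt0 ?ltr0n.
rewrite -(ler_pM2l K0') -lhs; apply: le_trans rhs _.
rewrite sumr_const card_ord -[X in d%:R * X]mulr_natl.
rewrite -subr_ge0 (_ : _ - _ = #|{: K}|%:R * (d%:R ^+ 2 * M%:R ^+ 2) * En).
  by rewrite !mulr_ge0 ?exprn_ge0 ?ler0n.
rewrite natrM !natrX; move: (#|_|%:R : R) (d%:R : R) (M%:R : R) En {En0 lhs K0'} => *; ring.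
Qed.

End GridPoincare.

(** * Convolutions of powers of the distance *)

Section LatticeMetric.
Variable d : nat.
Implicit Types (x y z a b : vertex d).

Lemma l1distC x y : l1dist x y = l1dist y x.
Proof. by apply: eq_bigr => i _; lia. Qed.

Lemma l1dist_triangle x y z : (l1dist x z <= l1dist x y + l1dist y z)%N.
Proof. by rewrite -big_split; apply: leq_sum => i _ /=; lia. Qed.

Lemma bracketC x y : bracket x y = bracket y x.
Proof. by rewrite /bracket l1distC. Qed.

Lemma bracket_triangle x y z : (bracket x z <= bracket x y + bracket y z)%N.
Proof. by have := l1dist_triangle x y z; rewrite /bracket; lia. Qed.

Lemma coord_le_l1dist x y i : (`|x ord0 i - y ord0 i| <= l1dist x y)%N.
Proof. by rewrite /l1dist (bigD1 i) //= leq_addr. Qed.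

End LatticeMetric.

(** All but one coordinate are free, and the last one is then determined up to sign. *)
Lemma sphere_count d (a : vertex d.+1) (s : seq (vertex d.+1)) (j : nat) : uniq s ->
  (count (fun y => bracket a y == j) s <= (2 * 3 ^ d) * j ^ d)%N.
Proof.
move=> us; rewrite -size_filter; set t := seq.filter _ s.
have ut : uniq t by exact: filter_uniq.
have tj y : y \in t -> l1dist a y = j.-1 /\ (0 < j)%N.
  by rewrite mem_filter /bracket => /andP[/eqP <- _].
have [j0|j_gt0] := posnP j.
  case tE: t => [//|y t']; have := tj y; rewrite tE inE eqxx => /(_ isT)[_]; lia.
(* all coordinates but the last, shifted to be nonnegative, and the sign of the last *)
pose h (y : vertex d.+1) : {ffun 'I_d -> 'I_(2 * j).+1} * bool :=
  ([ffun i => inord (absz (y ord0 (lift ord_max i) - a ord0 (lift ord_max i) + j%:Z)%R)],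
   0 <= y ord0 ord_max - a ord0 ord_max).
have hinj : {in t &, injective h}.
  move=> y y' /tj[dy _] /tj[dy' _] [/ffunP E sE].
  have co i : y ord0 (lift ord_max i) = y' ord0 (lift ord_max i).
    have := E i; rewrite !ffunE => /(congr1 val); rewrite /= !inordK.
    - have := coord_le_l1dist a y (lift ord_max i); have := coord_le_l1dist a y' (lift ord_max i).
      by rewrite dy dy'; lia.
    - have := coord_le_l1dist a y' (lift ord_max i); rewrite dy'; lia.
    - have := coord_le_l1dist a y (lift ord_max i); rewrite dy; lia.
  have last_eq : y ord0 ord_max = y' ord0 ord_max.
    have : l1dist a y = l1dist a y' by rewrite dy dy'.
    rewrite /l1dist !(bigD1_ord ord_max) //=.
    rewrite (eq_bigr (fun i : 'I_d => `|a ord0 (lift ord_max i) - y' ord0 (lift ord_max i)|%N)); last by move=> i _; rewrite co.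
    move=> /eqP; rewrite eqn_add2r => /eqP; move: sE.
    move: (y ord0 _) (y' ord0 _) (a ord0 _) => u u' v; lia.
  apply/rowP => i; case: (unliftP ord_max i) => [i'|] -> //.
rewrite -(size_map h) -(card_uniqP _); last by rewrite map_inj_in_uniq.
apply: leq_trans (max_card _) _; rewrite card_prod card_ffun card_bool !card_ord.
rewrite mulnC -mulnA leq_mul2l /= -expnMn.
by have [->|d0] := posnP d; rewrite ?expn0 // leq_exp2r //; lia.
Qed.

Section ShellSums.
Variable R : realFieldType.

Lemma shell_sum_le d (a : vertex d.+1) (s : seq (vertex d.+1)) (phi : nat -> R) (N : nat) :
  uniq s -> (forall j, 0 <= phi j) -> (forall y, y \in s -> (bracket a y <= N)%N) ->
  \sum_(y <- s) phi (bracket a y) <=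
  (2 * 3 ^ d)%:R * \sum_(1 <= j < N.+1) phi j * j%:R ^+ d.
Proof.
move=> us phi0 sN.
have -> : \sum_(y <- s) phi (bracket a y) =
    \sum_(1 <= j < N.+1) phi j * (count (fun y => bracket a y == j) s)%:R.
  rewrite (eq_big_seq (fun y => \sum_(1 <= j < N.+1) phi j * (bracket a y == j)%:R)).
    rewrite exchange_big /=; apply: eq_bigr => j _; rewrite -mulr_sumr; congr (_ * _).
    by rewrite -sum1_count natr_sum [RHS]big_mkcond; apply: eq_bigr => y _; case: ifP.
  move=> y ys; rewrite (bigD1_seq (bracket a y)) ?iota_uniq //=; last first.
    by rewrite mem_index_iota ltnS sN.
  rewrite eqxx mulr1 big1 ?addr0 // => j /negPf; rewrite eq_sym => ->; exact: mulr0.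
rewrite mulr_sumr; apply: ler_sum => j _; rewrite mulrCA; apply: ler_wpM2l => //.
by rewrite -natrX -natrM ler_nat sphere_count.
Qed.

Lemma inverse_square_tail (r N : nat) : (0 < r)%N ->
  \sum_(r.+1 <= j < N.+1) (j%:R ^- 2 : R) <= r%:R^-1.
Proof.
move=> r0; have [Nr|rN] := leqP N r; first by rewrite big_geq // invr_ge0 ler0n.
apply: (@le_trans _ _ (\sum_(r.+1 <= j < N.+1) (j.-1%:R^-1 - j%:R^-1))).
  rewrite big_nat_cond [leRHS]big_nat_cond; apply: ler_sum => -[|[|j]] /andP[/andP[jr _] _]; [lia|lia|].
  have x0 : 0 < j.+1%:R :> R by rewrite ltr0n.
  rewrite [j.+2.-1]/= -[j.+2%:R]natr1; move: (j.+1%:R) x0 => x x0.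
  have x1 : 0 < x + 1 by rewrite addr_gt0.
  rewrite -subr_ge0 (_ : _ - _ = (x * (x + 1) ^+ 2)^-1); first by rewrite invr_ge0 ltW // mulr_gt0 ?exprn_gt0.
  by field; rewrite !gt_eqF.
rewrite big_add1 /= (eq_bigr (fun j => - (j.+1%:R^-1 - j%:R^-1))); last by move=> j _; rewrite opprB.
rewrite sumrN telescope_sumr; last exact: ltnW.
by rewrite opprB gerBl invr_ge0 ler0n.
Qed.

(** Below r the summand is of order j * r ^ (-p), beyond r it is j ^ (1 - p), which is
    summable as p >= 3. *)
Lemma radial_sum_le (p r N : nat) : (2 < p)%N -> (0 < r)%N ->
  \sum_(1 <= j < N.+1) (if (j <= r)%N then j%:R ^- p * (2 ^+ p * r%:R ^- p) else j%:R ^- p * j%:R ^- p)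
     * j%:R ^+ p.+1 <= (2 ^+ p + 1) * r%:R ^- (p - 2) :> R.
Proof.
move=> p2 r0; have x0 : 0 < r%:R :> R by rewrite ltr0n.
have rE : r%:R ^- (p - 2) = r%:R ^- p * r%:R ^+ 2 :> R.
  rewrite -{2}(subnK (ltnW p2)) exprD invfM -mulrA mulVf ?mulr1 //.
  by rewrite expf_neq0 ?gt_eqF.
rewrite (@le_trans _ _ (\sum_(1 <= j < (maxn N r).+1) (if (j <= r)%N then j%:R ^- p * (2 ^+ p * r%:R ^- p) else j%:R ^- p * j%:R ^- p)
     * j%:R ^+ p.+1)) //.
  rewrite [leRHS](big_cat_nat _ (n := N.+1)) //=; last by rewrite ltnS leq_maxl.
  rewrite lerDl; apply: sumr_ge0 => j _; rewrite mulr_ge0 ?exprn_ge0 //.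
  by case: ifP => _; rewrite !mulr_ge0 ?invr_ge0 ?exprn_ge0 ?ler0n.
rewrite (big_cat_nat _ (n := r.+1)) //=; last by rewrite ltnS leq_maxr.
rewrite mulrDl mul1r; apply: lerD.
  apply: (@le_trans _ _ (\sum_(1 <= j < r.+1) 2 ^+ p * r%:R ^- p * r%:R)).
    rewrite big_nat_cond [leRHS]big_nat_cond; apply: ler_sum => j /andP[/andP[j0 jr] _].
    have jp : j%:R ^+ p != 0 :> R by rewrite expf_neq0 // pnatr_eq0; lia.
    rewrite -ltnS jr exprSr (_ : _ * _ = 2 ^+ p * r%:R ^- p * j%:R); last first.
      by move: (j%:R ^+ p : R) jp (2 ^+ p * r%:R ^- p) => u u0 v; field.
    apply: ler_wpM2l; last by rewrite ler_nat.
    by rewrite mulr_ge0 ?invr_ge0 ?exprn_ge0 ?ler0n.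
  by rewrite sumr_const_nat subn1 /= -[X in X <= _]mulr_natr rE expr2 !mulrA.
case: p p2 {rE} => [|[|[|k]]] // _; rewrite (_ : k.+3 - 2 = k.+1)%N; last by lia.
apply: (@le_trans _ _ (\sum_(r.+1 <= j < (maxn N r).+1) r%:R ^- k * j%:R ^- 2)); last first.
  rewrite -mulr_sumr exprSr invfM; apply: ler_wpM2l; first by rewrite invr_ge0 exprn_ge0.
  exact: inverse_square_tail.
rewrite big_nat_cond [leRHS]big_nat_cond; apply: ler_sum => j /andP[/andP[jr _] _].
rewrite leqNgt jr /=.
have y0 : 0 < j%:R :> R by rewrite ltr0n; lia.
have -> : j%:R ^- k.+3 * j%:R ^- k.+3 * j%:R ^+ k.+4 = j%:R ^- k * j%:R ^- 2 :> R.
  rewrite !exprS; have /lt0r_neq0 yk : 0 < j%:R ^+ k :> R by rewrite exprn_gt0.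
  by move: (j%:R ^+ k : R) yk (j%:R : R) (lt0r_neq0 y0) => z zk y yn; field; rewrite ?zk ?yn ?expf_neq0.
apply: ler_wpM2r; first by rewrite invr_ge0 exprn_ge0 // ltW.
by rewrite lef_pV2 ?posrE ?exprn_gt0 // lerXn2r ?nnegrE ?ler0n // ler_nat ltnW.
Qed.

End ShellSums.

Section Convolution.
Variables (R : realFieldType) (p : nat).
Hypothesis p2 : (2 < p)%N.
Local Notation d := p.+2.
Implicit Types (x y z a b : vertex d) (s : seq (vertex d)).

Definition decay (k : nat) x y : R := (bracket x y)%:R ^- k.

Lemma bracket_gt0 x y : 0 < (bracket x y)%:R :> R.
Proof. by rewrite ltr0n. Qed.

Lemma decay_ge0 k x y : 0 <= decay k x y.
Proof. by rewrite invr_ge0 exprn_ge0 // ler0n. Qed.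

Lemma decayC k x y : decay k x y = decay k y x.
Proof. by rewrite /decay bracketC. Qed.

Lemma decay_le (k c : nat) x y x' y' : (0 < c)%N -> (bracket x' y' <= c * bracket x y)%N ->
  decay k x y <= c%:R ^+ k * decay k x' y'.
Proof.
move=> c0 le; rewrite /decay -ler_pdivrMl ?exprn_gt0 ?ltr0n //.
rewrite -invfM lef_pV2 ?posrE ?mulr_gt0 ?exprn_gt0 ?ltr0n // -exprMn -natrM.
by rewrite lerXn2r ?nnegrE ?ler0n // ler_nat.
Qed.

Definition conv_const : R := 2 * (2 * 3 ^ p.+1)%:R * (2 ^+ p + 1).

(** The one of a and b farther from z is at distance at least half of that from a to b, and at
    least that of the nearer one, which leaves a radial sum around the nearer one. *)
Lemma convolution_le a b s : uniq s ->
  \sum_(z <- s) decay p a z * decay p b z <= conv_const * decay (p - 2) a b.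
Proof.
move=> us; set r := bracket a b.
pose psi j : R := if (j <= r)%N then j%:R ^- p * (2 ^+ p * r%:R ^- p) else j%:R ^- p * j%:R ^- p.
have psi0 j : 0 <= psi j.
  by rewrite /psi; case: ifP => _; rewrite !mulr_ge0 ?invr_ge0 ?exprn_ge0 ?ler0n.
have half u v z : (bracket u z <= bracket v z)%N -> (r <= bracket u z + bracket v z)%N ->
    decay p u z * decay p v z <= psi (bracket u z).
  move=> uv ruv; rewrite /psi; case: ifP => _; apply: ler_wpM2l; rewrite ?decay_ge0 //.
    by apply: (@decay_le p 2 v z a b) => //; rewrite -/r; lia.
  rewrite lef_pV2 ?posrE ?exprn_gt0 ?bracket_gt0 //.
  by rewrite lerXn2r ?nnegrE ?ler0n // ler_nat.
pose N := (\max_(z <- s) maxn (bracket a z) (bracket b z))%N.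
have side u : u = a \/ u = b ->
    \sum_(z <- s) psi (bracket u z) <= (2 * 3 ^ p.+1)%:R * ((2 ^+ p + 1) * r%:R ^- (p - 2)).
  move=> ub; apply: le_trans (shell_sum_le us psi0 (N := N) _) _.
    move=> y ys; apply: leq_trans (leq_bigmax_seq _ ys isT).
    by rewrite leq_max; case: ub => ->; rewrite leqnn ?orbT.
  by apply: ler_wpM2l; rewrite ?ler0n //; exact: radial_sum_le.
apply: (@le_trans _ _ (\sum_(z <- s) (psi (bracket a z) + psi (bracket b z)))).
  apply: ler_sum => z _; have tri : (r <= bracket a z + bracket b z)%N.
    by rewrite [bracket b z]bracketC; exact: bracket_triangle.
  have [ab|/ltnW ba] := leqP (bracket a z) (bracket b z).
    by apply: le_trans (half _ _ _ ab tri) _; rewrite lerDl.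
  rewrite mulrC; rewrite addnC in tri.
  by apply: le_trans (half _ _ _ ba tri) _; rewrite lerDr.
rewrite big_split /=; apply: le_trans (lerD (side a _) (side b _)) _; [by left|by right|].
rewrite /conv_const /decay -/r; set c := (2 * 3 ^ p.+1)%:R; set e := _ ^- _; set f := 2 ^+ p + 1.
by rewrite le_eqVlt; apply/orP; left; apply/eqP; ring.
Qed.

Definition conv3_const : R := conv_const * 2 ^+ p * (1 + 2 ^+ p).

Lemma conv_const_ge0 : 0 <= conv_const.
Proof. by rewrite !mulr_ge0 ?ler0n // addr_ge0 // exprn_ge0. Qed.

(** Either z is far from y or a is far from z, on the scale of the distance from a to
    y; in each case the corresponding factor is pulled out as decay p a y. *)
Lemma convolution3_half a b y s : uniq s -> (bracket a b <= 2 * bracket b y)%N ->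
  \sum_(z <- s) decay p a z * decay p b z * decay p z y <=
  conv3_const * decay (p - 2) a b * decay p a y.
Proof.
move=> us aby.
have term z : decay p a z * decay p b z * decay p z y <=
    2 ^+ p * decay p a y * (decay p a z * decay p b z + decay p b z * decay p y z).
  have g1 := decay_ge0 p a z; have g2 := decay_ge0 p b z; have g3 := decay_ge0 p y z.
  have g4 := decay_ge0 p a y; rewrite (decayC p z y).
  have [zy|zy] := leqP (bracket a y) (2 * bracket y z).
    have := decay_le p (isT : (0 < 2)%N) zy; rewrite -[2%:R]/(2 : R) => h.
    apply: (@le_trans _ _ (decay p a z * decay p b z * (2 ^+ p * decay p a y))).
      by apply: ler_wpM2l; rewrite ?mulr_ge0.
    rewrite mulrDr [leLHS]mulrC lerDl !mulr_ge0 ?exprn_ge0 //.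
  have az : (bracket a y <= 2 * bracket a z)%N.
    by have := bracket_triangle a z y; rewrite (bracketC z y); lia.
  have := decay_le p (isT : (0 < 2)%N) az => h.
  apply: (@le_trans _ _ (2 ^+ p * decay p a y * decay p b z * decay p y z)).
    by do 2 (apply: ler_wpM2r => //).
  by rewrite mulrDr -!mulrA lerDr !mulr_ge0 ?exprn_ge0.
apply: le_trans (ler_sum _ (fun z _ => term z)) _.
rewrite -mulr_sumr big_split /=.
have q1 := convolution_le a b us; have q2 := convolution_le b y us.
have q3 := decay_le (p - 2) (isT : (0 < 2)%N) aby.
have q4 : (2 : R) ^+ (p - 2) <= 2 ^+ p by apply: ler_weXn2l; rewrite ?ler1n // leq_subr.
have d0 := decay_ge0 (p - 2) a b.
have q5 : decay (p - 2) b y <= 2 ^+ p * decay (p - 2) a b.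
  by apply: le_trans q3 _; apply: ler_wpM2r.
have c0 := conv_const_ge0.
have q6 := ler_wpM2l c0 q5.
apply: (@le_trans _ _ (2 ^+ p * decay p a y * (conv_const * decay (p - 2) a b + conv_const * (2 ^+ p * decay (p - 2) a b)))).
  apply: ler_wpM2l; first by rewrite mulr_ge0 ?exprn_ge0 ?decay_ge0.
  by apply: lerD q1 (le_trans q2 q6).
rewrite /conv3_const; move: conv_const (decay _ a b) (decay p a y) (2 ^+ p : R) => *.
by rewrite le_eqVlt; apply/orP; left; apply/eqP; ring.
Qed.

(** By the triangle inequality a or b is far from y on the scale of the distance from a
    to b. *)
Lemma convolution3_le a b y s : uniq s ->
  \sum_(z <- s) decay p a z * decay p b z * decay p z y <=
  conv3_const * decay (p - 2) a b * (decay p a y + decay p b y).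
Proof.
move=> us; have c0 : 0 <= conv3_const * decay (p - 2) a b.
  by rewrite !mulr_ge0 ?conv_const_ge0 ?decay_ge0 ?addr_ge0 ?exprn_ge0.
have [aby|aby] := leqP (bracket a b) (2 * bracket b y).
  apply: le_trans (convolution3_half us aby) _; apply: ler_wpM2l => //.
  by rewrite lerDl decay_ge0.
have bay : (bracket b a <= 2 * bracket a y)%N.
  by have := bracket_triangle a y b; rewrite (bracketC y b) (bracketC b a); lia.
under eq_bigr do rewrite [decay p a _ * _]mulrC.
apply: le_trans (convolution3_half us bay) _; rewrite (decayC (p - 2) b a).
by apply: ler_wpM2l => //; rewrite lerDr decay_ge0.
Qed.

End Convolution.

(** * Gluing spreads *)

Section SpanningTrees.
Variable V : finType.
Implicit Types (E T : {set {set V}}) (x y z u v : V).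

Definition connected_by E : bool := [forall x, forall y, connect (adj E) x y].

Lemma connected_byP E : reflect (forall x y, connect (adj E) x y) (connected_by E).
Proof.
apply: (iffP forallP) => H x; first by move=> y; have /forallP := H x; apply.
by apply/forallP => y.
Qed.

Lemma connected_remove E (e : {set V}) : connected_by E ->
  (forall u v, [set u; v]%SET = e -> connect (adj (E :\ e)%SET) u v) ->
  connected_by (E :\ e)%SET.
Proof.
move=> /connected_byP cE H; apply/connected_byP => x y.
apply: connect_sub (cE x y) => u v uv.
have [/H //|ne] := eqVneq [set u; v]%SET e.
by apply: connect1; rewrite /adj !inE ne.
Qed.

(** A minimal connected set of edges has no cycle, as deleting an edge of a cycle does
    not disconnect. *)
Lemma connected_tree E : connected_by E -> exists2 T : {set {set V}}, T \subset E & is_tree T.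
Proof.
move=> cE; have [T /minsetP[cT minT] TE] := minset_exists cE.
exists T => //.
have minimal (e : {set V}) : e \in T -> ~ connected_by (T :\ e)%SET.
  move=> eT ce; have := minT _ ce (finset.subD1set _ _).
  by move=> /finset.setP/(_ e); rewrite !inE eqxx eT.
split; last 1 first.
- move=> [|x [|y [|z p]]] // _ uc; apply/negP => cyc.
  have xy : adj T x y by case/andP: cyc.
  apply: (minimal _ xy); apply: connected_remove => // u v uv.
  have yx : connect (adj (T :\ [set x; y])%SET) y x.
    move: cyc uc; rewrite /= !inE !negb_or !rcons_path => /and4P[_ yz zp lx].
    move=> /andP[/and3P[nxy nxz nxp] /andP[/andP[nyz nyp] _]].
    have nyE u' v' : u' != y -> v' != y -> [set u'; v']%SET != [set x; y]%SET.
      move=> uy vy; apply/eqP => /finset.setP/(_ y); rewrite !inE eqxx orbT.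
      by rewrite ![y == _]eq_sym (negPf uy) (negPf vy).
    apply: (@connect_trans _ _ z).
      apply: connect1; rewrite /adj in_setD1 -/(adj T y z) yz andbT.
      apply/eqP => /finset.setP/(_ x); rewrite !inE eqxx.
      by rewrite (negPf nxy) (negPf nxz).
    apply/connectP; exists (rcons p x); last by rewrite last_rcons.
    have sub : {in (predC1 y) &, subrel (adj T) (adj (T :\ [set x; y])%SET)}.
      by move=> u' v'; rewrite !inE => uy vy; rewrite /adj in_setD1 => ->; rewrite andbT nyE.
    apply: (sub_in_path sub); last by rewrite rcons_path zp.
    rewrite /= all_rcons /= eq_sym nyz nxy /=; apply/allP => t tp /=.
    by apply: contraNneq nyp => <-.
  have [[-> ->]|[-> ->]] := set2_eq uv; last by [].
  by rewrite (sym_connect_sym (adj_sym _)).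
- move=> e eT; apply/eqP/negPn/negP => e2; apply: (minimal _ eT).
  apply: connected_remove => // u v uv; move: e2; rewrite -uv cards2.
  by have [->|//] := eqVneq u v; rewrite connect0.
- exact/connected_byP.
Qed.

End SpanningTrees.

Section Spread.
Variable d : nat.
Implicit Types (A B W : {fset vertex d}).

Lemma edge_bracket_gt0 W (e : {set W}) : e != finset.set0 -> (0 < edge_bracket e)%N.
Proof.
case/set0Pn => x xe; rewrite /edge_bracket (bigD1 x) //= leq_max; apply/orP; left.
by rewrite (bigD1 x) //= leq_max; apply/orP; left.
Qed.

(** All brackets are at least 1, so a spanning subtree weighs no more. *)
Lemma spread_le_connected W (E : {set {set W}}) : connected_by E ->
  (forall e, e \in E -> e != finset.set0) -> W != fset0 -> (spread W <= tree_weight E)%N.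
Proof.
move=> cE E0 W0; have [T TE Tt] := connected_tree cE.
have [_ /(_ _ Tt) le] := spread_min W0; apply: leq_trans le _.
rewrite /tree_weight [leqRHS](big_setID T) /= (finset.setIidPr TE) leq_pmulr //.
by apply: prodn_cond_gt0 => e; rewrite inE => /andP[_ /E0]; exact: edge_bracket_gt0.
Qed.

Lemma spread_gt0 W : W != fset0 -> (0 < spread W)%N.
Proof.
move=> W0; have [[T [T2 _ _] ->] _] := spread_min W0.
apply: prodn_cond_gt0 => e eT; apply: edge_bracket_gt0.
by rewrite -card_gt0 T2.
Qed.

Lemma spread_fset1 (x : vertex d) : (spread [fset x]%fset <= 1)%N.
Proof.
have W0 : ([fset x] != fset0 :> {fset vertex d})%fset by apply/fset0Pn; exists x; rewrite inE.
apply: leq_trans (spread_le_connected (E := finset.set0) _ _ W0) _.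
- apply/connected_byP => u v; suff -> : u = v by exact: connect0.
  apply: val_inj; have := valP u; have := valP v.
  by rewrite /= !inE => /eqP -> /eqP ->.
- by move=> e; rewrite inE.
- by rewrite /tree_weight big_set0.
Qed.

Lemma edge_bracket_incl A W (AW : (A `<=` W)%fset) (e : {set A}) :
  edge_bracket (fincl AW @: e)%SET = edge_bracket e.
Proof.
have inj : injective (fincl AW).
  by move=> x y /(congr1 val); rewrite /= => /val_inj.
rewrite /edge_bracket big_imset /=; last by move=> x y _ _; exact: inj.
apply: eq_bigr => x _; rewrite big_imset //=; by move=> u v _ _; exact: inj.
Qed.

(** Optimal trees of A and of B together with the edge ab connect the union. *)
Lemma spread_glue A B a b : a \in A -> b \in B ->
  (spread (A `|` B)%fset <= spread A * spread B * bracket a b)%N.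
Proof.
move=> aA bB; set W := (A `|` B)%fset.
have A0 : A != fset0 by apply/fset0Pn; exists a.
have B0 : B != fset0 by apply/fset0Pn; exists b.
have W0 : W != fset0 by apply/fset0Pn; exists a; rewrite inE aA.
have [[TA [TA2 TAc _] ->] _] := spread_min A0.
have [[TB [TB2 TBc _] ->] _] := spread_min B0.
have AW : (A `<=` W)%fset by exact: fsubsetUl.
have BW : (B `<=` W)%fset by exact: fsubsetUr.
pose iA := fincl AW; pose iB := fincl BW.
pose a' : W := iA (FSetSub aA); pose b' : W := iB (FSetSub bB).
pose EA : {set {set W}} := ((fun e : {set A} => (iA @: e)%SET) @: TA)%SET.
pose EB : {set {set W}} := ((fun e : {set B} => (iB @: e)%SET) @: TB)%SET.
pose E := ([set a'; b']%SET |: (EA :|: EB))%SET.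
have cA x y : connect (adj E) (iA x) (iA y).
  have : connect (adj TA) x y by exact: TAc.
  move=> /connectP[p pp ->]; elim: p x pp => [|z p IH] x /=; first by rewrite connect0.
  move=> /andP[xz pp]; apply: connect_trans (IH z pp); apply: connect1.
  rewrite /adj !inE; apply/orP; right; apply/orP; left.
  by apply/imsetP; exists [set x; z]%SET => //; rewrite imsetU1 imset_set1.
have cB x y : connect (adj E) (iB x) (iB y).
  have : connect (adj TB) x y by exact: TBc.
  move=> /connectP[p pp ->]; elim: p x pp => [|z p IH] x /=; first by rewrite connect0.
  move=> /andP[xz pp]; apply: connect_trans (IH z pp); apply: connect1.
  rewrite /adj !inE; apply/orP; right; apply/orP; right.
  by apply/imsetP; exists [set x; z]%SET => //; rewrite imsetU1 imset_set1.
have sE := sym_connect_sym (adj_sym E).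
have ca x : connect (adj E) a' x.
  have := valP x; rewrite inE => /orP[xA|xB].
    rewrite (_ : x = iA (FSetSub xA)); last exact: val_inj.
    exact: cA.
  apply: (@connect_trans _ _ b'); first by apply: connect1; rewrite /adj !inE eqxx.
  rewrite (_ : x = iB (FSetSub xB)); last exact: val_inj.
  exact: cB.
have cE : connected_by E.
  by apply/connected_byP => x y; apply: connect_trans (ca y); rewrite sE.
have E0 e : e \in E -> e != finset.set0.
  rewrite !inE => /orP[/eqP -> |/orP[]/imsetP[e' e'T ->]].
  - by apply/set0Pn; exists a'; rewrite !inE eqxx.
  - by rewrite imset_eq0 -card_gt0 TA2.
  - by rewrite imset_eq0 -card_gt0 TB2.
have E1 e : e \in E -> (0 < edge_bracket e)%N by move=> /E0; exact: edge_bracket_gt0.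
apply: leq_trans (spread_le_connected cE E0 W0) _.
have prod_le (S1 S2 : {set {set W}}) : (S1 :|: S2)%SET \subset E ->
    (\prod_(e in (S1 :|: S2)%SET) edge_bracket e <=
     (\prod_(e in S1) edge_bracket e) * \prod_(e in S2) edge_bracket e)%N.
  move=> /fintype.subsetP sS; rewrite (big_setID S1) /= finset.setUK finset.setDUl finset.setDv finset.set0U.
  rewrite leq_mul2l; apply/orP; right.
  rewrite [leqRHS](big_setID S1) /= leq_pmull //.
  apply: prodn_cond_gt0 => e; rewrite inE => /andP[eS2 _]; apply: E1; apply: sS.
  by rewrite inE eS2 orbT.
have EAB : (EA :|: EB)%SET \subset E by exact: finset.subsetUr.
rewrite /tree_weight; apply: leq_trans (prod_le _ _ (fintype.subxx _)) _.
rewrite big_set1 mulnC; apply: leq_mul; last first.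
  apply/bigmax_leqP => x; rewrite !inE => xE; apply/bigmax_leqP => y; rewrite !inE => yE.
  by case/orP: xE => /eqP ->; case/orP: yE => /eqP -> /=; rewrite ?(bracketC b a) // /bracket /l1dist big1 // => i _; rewrite subrr.
apply: leq_trans (prod_le _ _ EAB) _.
have injA : injective iA by move=> x y /(congr1 val); rewrite /= => /val_inj.
have injB : injective iB by move=> x y /(congr1 val); rewrite /= => /val_inj.
apply: leq_mul; rewrite big_imset /=; try by move=> e1 e2 _ _; exact: imset_inj.
  by apply: leq_prod => e _; rewrite edge_bracket_incl.
by apply: leq_prod => e _; rewrite edge_bracket_incl.
Qed.

End Spread.

(** * A superharmonic function on the lattice *)

Section InverseSquareRootPowers.
Variable R : realFieldType.

(** Third order expansion of (1 + t) ^ (- m / 2) at 0. *)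
Definition taylor3 (m : nat) (t : R) : R :=
  let q := m%:R / 2 in
  1 - q * t + q * (q + 1) / 2 * t ^+ 2 - q * (q + 1) * (q + 2) / 6 * t ^+ 3.

Lemma inv_sqrt_le (s t : R) : - (1 / 2) <= t -> t <= 1 / 2 -> 0 < s -> s ^+ 2 * (1 + t) = 1 ->
  s <= taylor3 1 t + t ^+ 4.
Proof.
move=> t1 t2 s0 sE; set y := taylor3 1 t + t ^+ 4.
have yE : y = 1 - t / 2 + 3 / 8 * t ^+ 2 - 5 / 16 * t ^+ 3 + t ^+ 4.
  by rewrite /y /taylor3; field.
have tt : t ^+ 2 <= 1 / 4 by nra.
have y0 : 0 < y by rewrite yE; nra.
(* the expansion is exact to third order and its fourth order remainder is positive *)
have key : 1 <= y ^+ 2 * (1 + t).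
  have -> : y ^+ 2 * (1 + t) = 1 + (t ^+ 2) ^+ 2 *
      (93 / 64 + 39 / 32 * t - 99 / 256 * t ^+ 2 + 57 / 256 * t ^+ 3 + 3 / 8 * t ^+ 4 + t ^+ 5).
    by rewrite yE; field.
  rewrite lerDl; apply: mulr_ge0; first exact: sqr_ge0.
  have t3 : - (1 / 8) <= t ^+ 3 by rewrite exprS; nra.
  have t5 : - (1 / 8) <= t ^+ 5.
    rewrite (_ : t ^+ 5 = t ^+ 3 * t ^+ 2); last by rewrite -exprD.
    have := sqr_ge0 t; nra.
  have t4 : 0 <= t ^+ 4 by rewrite (_ : t ^+ 4 = (t ^+ 2) ^+ 2) ?sqr_ge0 // -exprM.
  lra.
rewrite leNgt; apply/negP => ys.
have : y ^+ 2 * (1 + t) < s ^+ 2 * (1 + t).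
  rewrite ltr_pM2r; last lra.
  by rewrite ltrXn2r // ?nnegrE ltW.
by rewrite sE ltNge key.
Qed.

(** Induction on m: multiply the bounds for s ^ m and for s and collect the terms of
    order at least 4. *)
Lemma inv_sqrt_pow_le (m : nat) : exists2 C : R, 0 <= C &
  forall s t, - (1 / 2) <= t -> t <= 1 / 2 -> 0 < s -> s ^+ 2 * (1 + t) = 1 ->
  s ^+ m <= taylor3 m t + C * t ^+ 4.
Proof.
elim: m => [|m [C C0 IH]].
  by exists 0 => // s t _ _ _ _; rewrite /taylor3 !mul0r expr0 !subr0 !addr0.
pose q : R := m%:R / 2; pose a := - q; pose b := q * (q + 1) / 2.
pose c := - (q * (q + 1) * (q + 2) / 6).
(* bounds the coefficients of t ^ 4, ..., t ^ 8 in the product of the two expansions *)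
pose C' := `|a * (- (5/16)) + b * (3/8) + c * (- (1/2))| + `|b * (- (5/16)) + c * (3/8)| +
  `|c * (- (5 / 16))| + C * 3 + (1 + `|a| + `|b| + `|c|) + C.
have C'0 : 0 <= C' by rewrite !addr_ge0 ?normr_ge0 ?mulr_ge0.
exists C' => // s t t1 t2 s0 sE.
have h1 := IH s t t1 t2 s0 sE; have h2 := inv_sqrt_le t1 t2 s0 sE.
have sm : 0 <= s ^+ m by rewrite exprn_ge0 // ltW.
rewrite exprSr; apply: le_trans (ler_pM sm (ltW s0) h1 h2) _.
have tn : `|t| <= 1 by rewrite ler_norml; apply/andP; split; lra.
have tb (x : R) k : x * t ^+ k <= `|x|.
  apply: le_trans (ler_norm _) _; rewrite normrM normrX ler_piMr //.
  by rewrite exprn_ile1.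
have t4 : 0 <= t ^+ 4 by rewrite (_ : t ^+ 4 = (t ^+ 2) ^+ 2) ?sqr_ge0 // -exprM.
pose Q := (a * (- (5/16)) + b * (3/8) + c * (- (1/2))) + (b * (- (5/16)) + c * (3/8)) * t ^+ 1 +
  (c * (- (5 / 16))) * t ^+ 2 + C * (1 - 1 / 2 * t ^+ 1 + 3 / 8 * t ^+ 2 - 5 / 16 * t ^+ 3) +
  (1 + a * t ^+ 1 + b * t ^+ 2 + c * t ^+ 3) + C * t ^+ 4.
have QC : Q <= C'.
  rewrite /Q /C'; apply: lerD; last first.
    by apply: le_trans (tb _ _) _; rewrite ger0_norm.
  apply: lerD; last by rewrite !lerD.
  apply: lerD; last first.
    apply: ler_wpM2l => //.
    have := tb (- (1/2)) 1; have := tb (3/8) 2; have := tb (- (5/16)) 3.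
    rewrite !normrN !ger0_norm; lra.
  by rewrite !lerD // ler_norm.
rewrite -subr_ge0 (_ : _ - _ = (C' - Q) * t ^+ 4); first by rewrite mulr_ge0 // subr_ge0.
clear -C'; clearbody C'; rewrite /Q /taylor3 -[m.+1%:R]natr1 /a /b /c /q.
by move: (m%:R : R) => n; field.
Qed.

End InverseSquareRootPowers.

Section Superharmonic.
Variables (R : rcfType) (p : nat).
Local Notation d := p.+2.
Implicit Types (x : 'I_d -> R) (i : 'I_d) (A : R).

Definition sqnorm x : R := \sum_i x i ^+ 2.

Definition shift x i (s : R) : 'I_d -> R := fun j => x j + (if j == i then s else 0).

(** The function (|x| ^ 2 + A) ^ (- p / 2), with p = d - 2. *)
Definition pot A x : R := Num.sqrt (sqnorm x + A) ^- p.

Lemma sqnorm_ge0 x : 0 <= sqnorm x.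
Proof. by apply: sumr_ge0 => i _; exact: sqr_ge0. Qed.

Lemma sqnorm_ge x i : x i ^+ 2 <= sqnorm x.
Proof. by rewrite /sqnorm (bigD1 i) //= lerDl sumr_ge0 // => j _; exact: sqr_ge0. Qed.

Lemma sqnorm_shift x i s : sqnorm (shift x i s) = sqnorm x + (2 * s * x i + s ^+ 2).
Proof.
rewrite /sqnorm (bigD1 i) //= [in RHS](bigD1 i) //= /shift eqxx.
rewrite (eq_bigr (fun j => x j ^+ 2)); last by move=> j /negPf ->; rewrite addr0.
by ring.
Qed.

Lemma pot_gt0 A x : 0 < A -> 0 < pot A x.
Proof.
by move=> A0; rewrite invr_gt0 exprn_gt0 // sqrtr_gt0 ltr_wpDl // sqnorm_ge0.
Qed.

Lemma pot_shift_le C A x i s (t : R) : 6 <= A ->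
  (forall s t : R, - (1 / 2) <= t -> t <= 1 / 2 -> 0 < s -> s ^+ 2 * (1 + t) = 1 ->
    s ^+ p <= taylor3 p t + C * t ^+ 4) ->
  s ^+ 2 = 1 -> t * (sqnorm x + A) = 1 + 2 * s * x i ->
  pot A (shift x i s) <= pot A x * (taylor3 p t + C * t ^+ 4).
Proof.
move=> A6 HC s2 tE; have := sqnorm_ge x i; have := sqnorm_ge0 x.
rewrite {2}/pot /pot sqnorm_shift s2; set N := sqnorm x in tE *; set u := N + A in tE *.
move=> N0 xN; have u0 : 0 < u by rewrite /u; lra.
have xu : x i ^+ 2 + 6 <= u by rewrite /u; lra.
have sx : (2 * s * x i) ^+ 2 = 4 * x i ^+ 2 by rewrite !exprMn s2; ring.
have t_lo : - (1 / 2) <= t.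
  rewrite -(ler_pM2r u0) tE; move: (2 * s * x i) sx => y sx; have := sqr_ge0 (y + 4); nra.
have t_hi : t <= 1 / 2.
  rewrite -(ler_pM2r u0) tE; move: (2 * s * x i) sx => y sx; have := sqr_ge0 (y - 4); nra.
have vE : N + (2 * s * x i + 1) + A = u * (1 + t).
  by rewrite mulrDr mulr1 [u * t]mulrC tE /u; ring.
rewrite vE; have v0 : 0 < u * (1 + t) by rewrite mulr_gt0 //; lra.
have su : 0 < Num.sqrt u by rewrite sqrtr_gt0.
have sv : 0 < Num.sqrt (u * (1 + t)) by rewrite sqrtr_gt0.
pose r := Num.sqrt u / Num.sqrt (u * (1 + t)).
have r0 : 0 < r by rewrite divr_gt0.
have r2 : r ^+ 2 * (1 + t) = 1.
  have un : u != 0 by rewrite gt_eqF.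
  have tn : 1 + t != 0 by rewrite gt_eqF //; lra.
  by rewrite exprMn exprVn !sqr_sqrtr ?ltW //; field; rewrite un tn.
rewrite (_ : _ ^- p = Num.sqrt u ^- p * r ^+ p); last first.
  by rewrite exprMn mulrA mulVf ?mul1r ?exprVn // expf_neq0 // gt_eqF.
by rewrite ler_pM2l ?invr_gt0 ?exprn_gt0 // HC.
Qed.

(** Add the expansions at the two neighbours in direction i: the two cubic terms have a
    nonpositive sum, and the quartic ones are of order u ^ (-2). *)
Lemma pot_pair_le C A x i : 0 <= C -> 6 <= A ->
  (forall s t : R, - (1 / 2) <= t -> t <= 1 / 2 -> 0 < s -> s ^+ 2 * (1 + t) = 1 ->
    s ^+ p <= taylor3 p t + C * t ^+ 4) ->
  forall u q b, u = sqnorm x + A -> q = p%:R / 2 -> b = q * (q + 1) / 2 ->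
  pot A (shift x i 1) + pot A (shift x i (-1)) <=
  pot A x * (2 - p%:R / u + b * (2 + 8 * x i ^+ 2) / u ^+ 2 + C * (2 + 80 * x i ^+ 2 / u) / u ^+ 2).
Proof.
move=> C0 A6 HC u q b uE qE bE; have N0 := sqnorm_ge0 x; have xN := sqnorm_ge x i.
have u1 : 1 <= u by rewrite uE; lra.
have u0 : 0 < u by lra.
have un : u != 0 by rewrite gt_eqF.
have xu : x i ^+ 2 <= u by rewrite uE; lra.
pose t1 := (1 + 2 * x i) / u; pose t2 := (1 - 2 * x i) / u.
have p0 : 0 < pot A x by apply: pot_gt0; lra.
have h1 : pot A (shift x i 1) <= pot A x * (taylor3 p t1 + C * t1 ^+ 4).
  by apply: pot_shift_le => //; rewrite ?expr1n // -uE /t1 divfK // mulr1.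
have h2 : pot A (shift x i (-1)) <= pot A x * (taylor3 p t2 + C * t2 ^+ 4).
  by apply: pot_shift_le => //; rewrite ?sqrrN ?expr1n // -uE /t2 divfK // mulrN1 mulNr.
apply: le_trans (lerD h1 h2) _; rewrite -mulrDr ler_pM2l //.
have b0 : 0 <= b by rewrite bE qE !mulr_ge0 ?invr_ge0 ?addr_ge0 ?mulr_ge0 ?invr_ge0 ?ler0n.
pose c := q * (q + 1) * (q + 2) / 6.
have c0 : 0 <= c by rewrite /c qE !mulr_ge0 ?invr_ge0 ?addr_ge0 ?mulr_ge0 ?invr_ge0 ?ler0n.
pose y := x i ^+ 2; have y0 : 0 <= y by exact: sqr_ge0.
have -> : taylor3 p t1 + C * t1 ^+ 4 + (taylor3 p t2 + C * t2 ^+ 4) =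
   2 - p%:R / u + b * (2 + 8 * y) / u ^+ 2 - c * (2 + 24 * y) / u ^+ 3
   + C * (2 + 48 * y + 32 * y ^+ 2) / u ^+ 4.
  rewrite /taylor3 /t1 /t2 bE /c qE /y; move: (p%:R : R) (x i) => n z.
  by field.
have drop : 0 <= c * (2 + 24 * y) / u ^+ 3.
  apply: mulr_ge0; last by rewrite invr_ge0 exprn_ge0 // ltW.
  by apply: mulr_ge0 => //; rewrite addr_ge0 // mulr_ge0.
have quart : C * (2 + 48 * y + 32 * y ^+ 2) / u ^+ 4 <= C * (2 + 80 * y / u) / u ^+ 2.
  rewrite (_ : C * (2 + 80 * y / u) / u ^+ 2 = C * (2 * u ^+ 2 + 80 * y * u) / u ^+ 4); last by field.
  rewrite ler_pM2r ?invr_gt0 ?exprn_gt0 //; apply: ler_wpM2l => //.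
  have yu : y <= y * u by rewrite ler_peMr.
  have y2u : y ^+ 2 <= y * u by rewrite expr2; apply: ler_wpM2l.
  have u2 : 1 <= u ^+ 2 by apply: exprn_ege1.
  lra.
rewrite -/y; lra.
Qed.

(** In the sum over the directions the terms of order 1 / u cancel since p = d - 2.  Among
    those of order u ^ (-2) the one coming from A is negative and wins for A large. *)
Lemma pot_superharmonic : (0 < p)%N -> exists2 A : R, 6 <= A &
  forall x, \sum_i (pot A (shift x i 1) + pot A (shift x i (-1))) <=
    pot A x * ((2 * d)%:R - (sqnorm x + A) ^- 2).
Proof.
move=> p_gt0; have [C C0 HC] := inv_sqrt_pow_le R p.
pose q : R := p%:R / 2; pose b := q * (q + 1) / 2; pose D : R := d%:R.
have b0 : 0 <= b by rewrite /b /q !mulr_ge0 ?invr_ge0 ?addr_ge0 ?mulr_ge0 ?invr_ge0 ?ler0n.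
have D0 : 0 <= D by rewrite ler0n.
(* p * d * A then exceeds the other contributions of order u ^ (-2) by at least 1 *)
pose A := 7 + 2 * b * D + C * (2 * D + 80).
have A6 : 6 <= A.
  have := mulr_ge0 b0 D0; have : 0 <= C * (2 * D + 80) by rewrite mulr_ge0 // addr_ge0 // mulr_ge0.
  by rewrite /A; lra.
exists A => // x; set N := sqnorm x; set u := N + A.
have N0 : 0 <= N by exact: sqnorm_ge0.
have u0 : 0 < u by rewrite /u; lra.
have un : u != 0 by rewrite gt_eqF.
have p0 : 0 < pot A x by apply: pot_gt0; lra.
apply: (@le_trans _ _ (\sum_i pot A x * (2 - p%:R / u + b * (2 + 8 * x i ^+ 2) / u ^+ 2
    + C * (2 + 80 * x i ^+ 2 / u) / u ^+ 2))).
  by apply: ler_sum => i _; exact: pot_pair_le.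
rewrite -mulr_sumr ler_pM2l //.
have -> : \sum_i (2 - p%:R / u + b * (2 + 8 * x i ^+ 2) / u ^+ 2 + C * (2 + 80 * x i ^+ 2 / u) / u ^+ 2)
   = 2 * D - p%:R * D / u + b * (2 * D + 8 * N) / u ^+ 2 + C * (2 * D + 80 * N / u) / u ^+ 2.
  rewrite (eq_bigr (fun i => (2 - p%:R / u + (b * 2 + C * 2) / u ^+ 2) +
      (b * 8 / u ^+ 2 + C * 80 / u ^+ 3) * x i ^+ 2)); last by move=> i _; field.
  rewrite big_split /= -mulr_sumr -/(sqnorm x) -/N sumr_const card_ord -[X in X + _]mulr_natl -/D.
  by field.
have DE : D = p%:R + 2 by rewrite /D -natr1 -natr1; ring.
rewrite natrM -/D -subr_ge0.
rewrite (_ : _ - _ = (p%:R * D * A - 2 * b * D - C * (2 * D + 80 * N / u) - 1) / u ^+ 2); last first.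
  by rewrite /b /q DE /u; field; rewrite -/u.
apply: mulr_ge0; last by rewrite invr_ge0 exprn_ge0 // ltW.
have pD : 1 <= p%:R * D by rewrite /D -natrM ler1n muln_gt0 p_gt0.
have pDA : A <= p%:R * D * A by rewrite ler_peMl //; lra.
have Nu : C * (2 * D + 80 * N / u) <= C * (2 * D + 80).
  apply: ler_wpM2l => //; rewrite lerD2l -mulrA ler_piMr //.
  by rewrite ler_pdivrMr // mul1r /u; lra.
move: pDA Nu; rewrite {1}/A; lra.
Qed.

End Superharmonic.

(** * The nearest neighbour graph of a box *)

Section BoxGraph.
Variables (d n : nat).
Implicit Types (x y z : vertex d) (i : 'I_d).

Lemma mem_boxP x : reflect (forall i, (`|x ord0 i| <= n)%N) (x \in box d n).
Proof.
rewrite /box; apply: (iffP idP) => [/imfsetP[k _ ->] i|xn].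
  rewrite mxE; move: (nat_of_ord (k ord0 i)) (ltn_ord (k ord0 i)) => t; rewrite -addnn; lia.
apply/imfsetP; exists (\row_i inord (absz (x ord0 i + n%:Z)%R)); first by rewrite inE.
by apply/rowP => i; rewrite !mxE inordK; have := xn i; move: (x ord0 i) => t; rewrite -?addnn; lia.
Qed.

Definition nbr x (ib : 'I_d * bool) : vertex d :=
  \row_j (x ord0 j + if j == ib.1 then (if ib.2 then 1 else -1) else 0).

Lemma nbr_inj x : injective (nbr x).
Proof.
move=> [i b] [i' b'] /rowP E; have := E i; have := E i'; rewrite !mxE /= !eqxx.
have [->|ii'] := eqVneq i i'; last by case: b b' {E} => [] []; lia.
by case: b b' {E} => [] []; rewrite // => ? ?; lia.
Qed.

Lemma nnP x y : reflect (exists ib, y = nbr x ib) (nn x y).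
Proof.
apply: (iffP eqP) => [dxy|[[i b] ->]]; last first.
  rewrite /l1dist (bigD1 i) //= mxE eqxx big1 => [|j /negPf ji]; last by rewrite mxE /= ji addr0 subrr.
  by case: b => /=; lia.
have [i xyi] : exists i, x ord0 i != y ord0 i.
  apply/existsP; rewrite -negb_forall; apply/negP => /forallP E.
  by move: dxy; rewrite /l1dist big1 // => i _; rewrite (eqP (E i)) subrr.
move: dxy; rewrite /l1dist (bigD1 i) //= => dxy.
have rest j : j != i -> y ord0 j = x ord0 j.
  move=> ji; move: dxy; rewrite (bigD1 j) //=; move: (\sum_(_ | _) _)%N; lia.
have xyE : `|x ord0 i - y ord0 i|%N = 1%N by move: dxy xyi; move: (\sum_(_ | _) _)%N; lia.
exists (i, x ord0 i < y ord0 i); apply/rowP => j; rewrite mxE /=.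
case: eqVneq => [->|/rest ->]; last by rewrite addr0.
by move: (x ord0 i) (y ord0 i) xyE {xyi dxy rest} => s t st; case: ltrP => ? /=; lia.
Qed.

Lemma nn_sym : symmetric (@nn d).
Proof. by move=> x y; rewrite /nn l1distC. Qed.

Lemma nn_irr : irreflexive (@nn d).
Proof. by move=> x; rewrite /nn /l1dist big1 // => i _; rewrite subrr. Qed.

Lemma sum_neighbours (R : nzRingType) x (F : vertex d -> R) :
  \sum_(y : box d n) (nn x (val y))%:R * F (val y) =
  \sum_(ib : 'I_d * bool) (nbr x ib \in box d n)%:R * F (nbr x ib).
Proof.
transitivity (\sum_(y : box d n) \sum_ib (val y == nbr x ib)%:R * F (val y)).
  apply: eq_bigr => y _; rewrite -mulr_suml; congr (_ * _).
  have [[ib yE]|nyx] := nnP x (val y).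
    rewrite (bigD1 ib) //= yE eqxx big1 ?addr0 // => ib' ne.
    by rewrite (inj_eq (@nbr_inj x)) eq_sym (negPf ne).
  by rewrite big1 // => ib _; case: eqP => // yE; case: nyx; exists ib.
rewrite exchange_big; apply: eq_bigr => ib _.
have [xb|xb] := boolP (nbr x ib \in box d n).
  rewrite (bigD1 (FSetSub xb)) //= eqxx big1 ?addr0 // => y yne.
  case: eqP => [yE|]; last by rewrite mul0r.
  by case/eqP: yne; apply: val_inj.
rewrite big1 ?mul0r // => y _; case: eqP => [yE|]; last by rewrite mul0r.
by rewrite -yE (valP y) in xb.
Qed.

Lemma box_poincare (R : realFieldType) (u : box d n -> R) : \sum_x u x = 0 ->
  \sum_x u x ^+ 2 <= (d ^ 2 * n.*2.+1 ^ 2)%:R *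
    \sum_x \sum_y (nn (val x) (val y))%:R * (u x - u y) ^+ 2.
Proof.
set M := n.*2.+1; pose K := {ffun 'I_d -> 'I_M}.
pose row (k : K) : vertex d := \row_i ((k i)%:Z - n%:Z).
have rowb k : row k \in box d n.
  apply/mem_boxP => i; rewrite mxE; move: (nat_of_ord (k i)) (ltn_ord (k i)) => t.
  by rewrite /M -addnn; lia.
pose phi k : box d n := FSetSub (rowb k).
pose psi (x : box d n) : K := [ffun i => inord (absz (val x ord0 i + n%:Z)%R)].
have phiK : cancel phi psi.
  move=> k; apply/ffunP => i; rewrite ffunE /= mxE.
  rewrite (_ : absz _ = k i); first exact: inord_val.
  by move: (nat_of_ord (k i)) => t; lia.
have psiK : cancel psi phi.
  move=> x; apply: val_inj; apply/rowP => i; rewrite /= mxE ffunE.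
  by rewrite inordK; have /mem_boxP/(_ i) := valP x; move: (val x ord0 i) => t; rewrite /= -?addnn; lia.
have bij : {on predT, bijective phi} by exists psi => ? _; [exact: phiK|exact: psiK].
rewrite (reindex phi bij) /= => u0; rewrite (reindex phi bij) /=.
rewrite [X in _ * X](reindex phi bij) /=.
under [X in _ * X]eq_bigr do rewrite (reindex phi bij) /=.
apply: (grid_poincare (F := u \o phi) (e := fun k l => nn (row k) (row l))) u0.
move=> k i c kc; apply/eqP; rewrite /l1dist (bigD1 i) //= big1 => [|j ji].
  by rewrite !mxE setcE eqxx; move: kc; rewrite /consec; move: (k i) => ki; lia.
by rewrite !mxE setcE (negPf ji) subrr.
Qed.

End BoxGraph.

(** * A potential for the killed walk in a box *)

Section BoxPotential.
Variables (R : realType) (p : nat).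
Hypothesis p_gt0 : (0 < p)%N.
Local Notation d := p.+2.
Implicit Types (x y z : vertex d).

Definition coord z x : 'I_d -> R := fun i => (x ord0 i - z ord0 i)%:~R.

Lemma coord_nbr z x i b : coord z (nbr x (i, b)) = shift (coord z x) i (if b then 1 else -1).
Proof.
apply/funext => j; rewrite /coord /shift mxE /= addrAC rmorphD /=.
by case: (j == i); case: b.
Qed.

Lemma coord_self z : sqnorm (coord z z) = 0.
Proof. by rewrite /sqnorm big1 // => i _; rewrite /coord subrr expr0n. Qed.

Lemma pot_decay A z x : 1 <= A -> pot A (coord z x) <= d.+1%:R ^+ p * decay R p x z.
Proof.
move=> A1; set u := sqnorm (coord z x) + A.
have N0 := sqnorm_ge0 (coord z x).
have u1 : 1 <= u by rewrite /u; lra.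
have su : 0 < Num.sqrt u by rewrite sqrtr_gt0; lra.
have bs : (bracket x z)%:R <= d.+1%:R * Num.sqrt u.
  have br0 : 0 <= (bracket x z)%:R :> R by rewrite ler0n.
  rewrite -(ger0_norm br0) -sqrtr_sqr -(ger0_norm (ler0n R d.+1)) -sqrtr_sqr -sqrtrM ?sqr_ge0 //.
  apply: ler_wsqrtr.
  (* Cauchy-Schwarz for the vector with entries 1 and |x_i - z_i| *)
  pose f (t : nat) : R := if t is t'.+1 then `|coord z x (inord t')| else 1.
  have fE : (bracket x z)%:R = \sum_(t < d.+1) f t.
    rewrite big_ord_recl /= /bracket natrD; congr (_ + _).
    rewrite /l1dist natr_sum; apply: eq_bigr => i _.
    by rewrite /f /= /coord inord_val -intr_norm natr_absz.
  rewrite fE; apply: le_trans (sum_sqr_le d.+1 f) _.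
  have -> : \sum_(t < d.+1) f t ^+ 2 = 1 + sqnorm (coord z x).
    rewrite big_ord_recl /= expr1n; congr (_ + _).
    by apply: eq_bigr => i _; rewrite /f /= inord_val real_normK ?num_real.
  rewrite [d.+1%:R ^+ 2]expr2 -mulrA; apply: ler_wpM2l => //.
  apply: (@le_trans _ _ u); first by rewrite /u; lra.
  by rewrite ler_peMl ?ler1n //; lra.
rewrite /pot -/u /decay -ler_pdivrMl ?exprn_gt0 ?ltr0n // -invfM.
rewrite lef_pV2 ?posrE ?mulr_gt0 ?exprn_gt0 ?ltr0n //.
by rewrite -exprMn lerXn2r ?nnegrE ?ler0n ?mulr_ge0 ?ler0n // ltW.
Qed.

Definition box_adj n : rel (box d n) := fun (x y : box d n) => nn (val x) (val y).

Definition box_kernel n (eps : R) : box d n -> option (box d n) -> R :=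
  fun (x : box d n) o => sunk (conductance R (@box_adj n) finset.set0) eps x o /
    (eps + \sum_(y : box d n) (nn (val x) (val y))%:R).

Lemma conductance0 n (x y : box d n) :
  conductance R (@box_adj n) finset.set0 x y = (nn (val x) (val y))%:R.
Proof. by rewrite /conductance inE addr0 mulr1. Qed.

Lemma sum_directions (F : 'I_d * bool -> R) :
  \sum_ib F ib = \sum_i (F (i, true) + F (i, false)).
Proof.
rewrite (eq_bigr (fun ib => F (ib.1, ib.2))); last by case.
rewrite -(pair_bigA _ (fun i b => F (i, b))) /=; apply: eq_bigr => i _.
by rewrite big_bool.
Qed.

Lemma box_total n eps (x : box d n) : 0 < eps ->
  0 < eps + \sum_(y : box d n) (nn (val x) (val y))%:R :> R.
Proof. by move=> eps0; rewrite ltr_wpDr // sumr_ge0 // => y _; rewrite ler0n. Qed.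

Lemma box_kernel_ge0 n eps (x : box d n) o : 0 < eps -> 0 <= box_kernel eps x o.
Proof.
by move=> eps0; apply: divr_ge0; [exact: sunk_ge0 | exact/ltW/box_total].
Qed.

Lemma box_kernel_killed n eps (x : box d n) : 0 < eps -> 0 < box_kernel eps x None.
Proof. by move=> eps0; apply: divr_gt0 => //; exact: box_total. Qed.

Lemma box_kernel_total n eps (x : box d n) : 0 < eps -> \sum_o box_kernel eps x o = 1.
Proof.
move=> eps0; rewrite /box_kernel -mulr_suml sum_option /=.
under eq_bigr do rewrite conductance0.
by rewrite divff // gt_eqF // box_total.
Qed.

Lemma degree_le n (x : box d n) : \sum_(y : box d n) (nn (val x) (val y))%:R <= (2 * d)%:R :> R.
Proof.
have := @sum_neighbours d n R (val x) (fun=> 1).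
under eq_bigr do rewrite mulr1; move=> ->; under eq_bigr do rewrite mulr1.
apply: (@le_trans _ _ (\sum_(ib : 'I_d * bool) 1)).
  by apply: ler_sum => ib _; rewrite lern1 leq_b1.
by rewrite sumr_const card_prod card_ord card_bool mulnC.
Qed.

(** At interior points pot is superharmonic.  A point on a face misses neighbours, but
    there pot is at most of order (n - m) ^ (-p), which the killing of the constant
    c0 absorbs. *)
Lemma box_potential : exists2 K0 : R, 0 <= K0 & exists2 A : R, 1 <= A &
  forall n m (eps c0 : R), (m < n)%N -> 0 < eps <= 1 -> 0 <= c0 ->
  (2 * d)%:R * (d.+1%:R ^+ p * (n - m)%:R ^- p) <= eps * c0 ->
  forall (x z : box d n), val z \in box d m ->
  (x == z)%:R + \sum_(y : box d n) box_kernel eps x (Some y) * (K0 * (pot A (coord (val z) (val y)) + c0)) <=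
  K0 * (pot A (coord (val z) (val x)) + c0).
Proof.
have [A A6 super] := pot_superharmonic R p_gt0.
have A0 : 0 < A by lra.
(* the amount by which pot exceeds its mean at the pole is at least h0 / (2 d) *)
pose h0 : R := Num.sqrt A ^- p * A ^- 2.
have h0_gt0 : 0 < h0 by rewrite mulr_gt0 ?invr_gt0 ?exprn_gt0 ?sqrtr_gt0.
pose K0 : R := ((2 * d)%:R + 1) / h0.
have K0_gt0 : 0 < K0 by rewrite divr_gt0 // ltr_wpDl ?ler0n.
exists K0; first exact: ltW; exists A; first by lra.
move=> n m eps c0 mn /andP[eps0 eps1] c0_ge0 c0P x z zm.
set deg : R := \sum_(y : box d n) (nn (val x) (val y))%:R.
have deg_le : deg <= (2 * d)%:R by exact: degree_le.
have deg0 : 0 <= deg by apply: sumr_ge0 => y _; rewrite ler0n.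
have tot : 0 < eps + deg by rewrite ltr_wpDr.
pose h (y : vertex d) : R := pot A (coord (val z) y).
have h_gt0 y : 0 < h y by exact: pot_gt0.
rewrite -/(h (val x)).
have -> : \sum_(y : box d n) box_kernel eps x (Some y) * (K0 * (pot A (coord (val z) (val y)) + c0))
   = K0 * (\sum_(y : box d n) (nn (val x) (val y))%:R * h (val y) + deg * c0) / (eps + deg).
  rewrite mulr_suml -big_split mulr_sumr mulr_suml; apply: eq_bigr => y _.
  by rewrite /box_kernel /= conductance0 -/deg /h; ring.
set S := \sum_(y : box d n) _ * _.
rewrite -(ler_pM2r tot) mulrDl divfK ?gt_eqF //.
have SE : S = \sum_ib (nbr (val x) ib \in box d n)%:R * h (nbr (val x) ib).
  exact: sum_neighbours.
have [interior|/forallPn[[i b] /= out]] := boolP [forall ib, nbr (val x) ib \in box d n].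
  have degE : deg = (2 * d)%:R.
    have := @sum_neighbours d n R (val x) (fun=> 1).
    under eq_bigr do rewrite mulr1; rewrite -/deg => ->; under eq_bigr do rewrite mulr1 (forallP interior _).
    by rewrite sumr_const card_prod card_ord card_bool mulnC.
  have SB : S <= h (val x) * ((2 * d)%:R - (sqnorm (coord (val z) (val x)) + A) ^- 2).
    apply: le_trans (super (coord (val z) (val x))).
    rewrite SE sum_directions; apply: ler_sum => i _.
    by rewrite !(forallP interior _) !mul1r /h !coord_nbr.
  set v := _ ^- 2 in SB.
  have v0 : 0 <= v by rewrite invr_ge0 exprn_ge0 // addr_ge0 ?sqnorm_ge0 // ltW.
  have hv0 : 0 <= K0 * (h (val x) * v) by apply: mulr_ge0 (ltW K0_gt0) (mulr_ge0 (ltW (h_gt0 _)) v0).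
  have main : (x == z)%:R * (eps + deg) <= K0 * (h (val x) * v).
    have [xz|_] := eqVneq x z; last by rewrite mul0r.
    rewrite mul1r {1}/v /h xz /pot coord_self add0r -/h0 /K0 divfK ?gt_eqF // degE; lra.
  have ineq : K0 * (h (val x) * v) + K0 * (S + deg * c0) <= K0 * (h (val x) + c0) * (eps + deg).
    rewrite -mulrDr -mulrA; apply: ler_wpM2l; first exact: ltW.
    have e1 := mulr_ge0 (ltW eps0) (ltW (h_gt0 (val x))); have e2 := mulr_ge0 (ltW eps0) c0_ge0.
    move: SB; rewrite mulrBr degE; lra.
  by apply: le_trans ineq; rewrite lerD2r.
have xi : (n <= `|val x ord0 i|)%N.
  rewrite leqNgt; apply: contra out => xn; apply/mem_boxP => j; rewrite mxE /=.
  have /mem_boxP/(_ j) := valP x; case: eqVneq => [->|_]; last by rewrite addr0.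
  by move: (val x ord0 i) xn => t; clear; case: b; lia.
have zi : (`|val z ord0 i| <= m)%N by have /mem_boxP := zm.
have -> : (x == z) = false.
  have zn := leq_ltn_trans zi mn.
  by apply/negbTE/negP => /eqP xz; move: xi; rewrite xz leqNgt zn.
have S_le : S <= deg * (d.+1%:R ^+ p * (n - m)%:R ^- p).
  rewrite /S mulr_suml; apply: ler_sum => y _.
  have [xy|_] := boolP (nn _ _); last by rewrite !mul0r.
  rewrite !mul1r; apply: le_trans (pot_decay _ _ _) _; first lra.
  apply: ler_wpM2l; first by rewrite exprn_ge0 // ler0n.
  have nm0 : (0 < n - m)%N by rewrite subn_gt0.
  rewrite /decay lef_pV2 ?posrE ?exprn_gt0 ?ltr0n //.
  rewrite lerXn2r ?nnegrE ?ler0n // ler_nat.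
  have d1 := coord_le_l1dist (val x) (val y) i; have d2 := coord_le_l1dist (val y) (val z) i.
  rewrite (eqP xy) in d1; rewrite /bracket; move: d1 d2 xi zi mn; clear.
  by move: (val x ord0 i) (val y ord0 i) (val z ord0 i) (l1dist _ _) => *; lia.
have q0 : 0 <= d.+1%:R ^+ p * (n - m)%:R ^- p :> R by rewrite mulr_ge0 ?invr_ge0 ?exprn_ge0 ?ler0n.
have S2 : S <= eps * c0 by apply: le_trans S_le (le_trans _ c0P); apply: ler_wpM2r.
have e1 := mulr_ge0 (ltW tot) (ltW (h_gt0 (val x))).
rewrite mul0r add0r -[leRHS]mulrA; apply: ler_wpM2l; first exact: ltW.
rewrite mulrDl !mulrDr [deg * c0]mulrC.
have hx0 : 0 <= h (val x) * eps + h (val x) * deg by rewrite -mulrDr mulrC.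
have S3 : S + c0 * deg <= c0 * eps + c0 * deg by rewrite lerD2r [c0 * eps]mulrC.
by apply: le_trans S3 _; rewrite lerDr.
Qed.

End BoxPotential.

(** * Connections inside a set of vertices *)

Section ConnectedInside.
Variables (V : finType) (e : rel V).
Implicit Types (f : {ffun V -> option V}) (B W : {set V}) (T : {set {set V}}) (x y v : V).

(** Both ends of the edge must lie in B; the edge must also be one of the graph e, so
    that the relation depends on T only through the edges of e inside B. *)
Definition inside_adj B T : rel V := fun x y => [&& adj T x y, e x y, x \in B & y \in B].

Definition joined_inside B W T : bool :=
  [forall x in W, forall y in W, connect (inside_adj B T) x y].

Lemma joined_insideP B W T :
  reflect (forall x y, x \in W -> y \in W -> connect (inside_adj B T) x y) (joined_inside B W T).
Proof.
apply: (iffP forall_inP) => [H x y xW yW|H x xW]; first exact: (forall_inP (H x xW)).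
by apply/forall_inP => y; exact: H.
Qed.

Definition inside_edges B : {set {set V}} :=
  [set (fun q : V * V => [set q.1; q.2]%SET) q | q in [set q : V * V | [&& e q.1 q.2, q.1 \in B & q.2 \in B]]%SET]%SET.

Lemma card_inside_edges B : (#|inside_edges B| <= #|B| ^ 2)%N.
Proof.
apply: leq_trans (leq_imset_card _ _) _.
rewrite expnS expn1 -cardsX; apply: subset_leq_card; apply/fintype.subsetP => -[x y].
by rewrite !inE /= => /and3P[_ -> ->].
Qed.

Lemma inside_edges_set B : edge_set e (inside_edges B).
Proof.
move=> ed /imsetP[[x y]]; rewrite inE /= => /and3P[exy _ _] ->.
by exists x, y.
Qed.

Lemma joined_inside_local B W T : joined_inside B W T = joined_inside B W (T :&: inside_edges B)%SET.
Proof.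
have adjE x y : inside_adj B T x y = inside_adj B (T :&: inside_edges B)%SET x y.
  rewrite /inside_adj /adj finset.in_setI -andbA; apply: andb_id2l => _.
  have [/and3P[exy xB yB]|_] := boolP [&& _, _ & _]; last by rewrite andbF.
  by rewrite andbT; apply/esym/imsetP; exists (x, y); rewrite ?inE /= ?exy ?xB.
by apply: eq_forallb_in => x _; apply: eq_forallb_in => y _; exact: eq_connect.
Qed.

(** Follow the undirected path from x: at each step the meet with x either stays or
    moves to the vertex just reached. *)
Lemma joined_meets f B W : acyclic f -> W \subset B -> joined_inside B W (edges f) ->
  meets_in f B W.
Proof.
move=> af /fintype.subsetP WB /joined_insideP H; apply/meets_inP => x x' xW x'W.
have /connectP[q pq ->] := H _ _ xW x'W.
have start : exists2 v, v \in B & meet f x x v.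
  by exists x; [exact: WB | apply/meetP; split].
suff : forall y, (exists2 v, v \in B & meet f x y v) -> path (inside_adj B (edges f)) y q ->
    exists2 v, v \in B & meet f x (last y q) v by apply.
elim: q {pq} => [|y' q IH] y //= [v vB /meetP[xv yv Hv]] /andP[/and4P[yy' _ yB y'B] pq].
apply: IH pq; move: yy'; rewrite adj_edges => /orP[/eqP fy|/eqP fy'].
  have [vy|vy] := eqVneq v y.
    exists y' => //; apply/meetP; split => //.
    by apply: connect_trans xv _; rewrite vy; apply: connect1; rewrite /step fy.
  exists v => //; apply/meetP; split => //.
    by have /connect_step[yE|[y2]] := yv; [rewrite yE eqxx in vy | rewrite fy => -[<-]].
  move=> u xu y'u; apply: Hv => //; apply: connect_trans y'u.
  by apply: connect1; rewrite /step fy.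
have y'y : connect (step f) y' y by apply: connect1; rewrite /step fy'.
have [xy'|nxy'] := boolP (connect (step f) x y').
  by exists y' => //; apply/meetP; split.
exists v => //; apply/meetP; split => //; first exact: connect_trans yv.
move=> u xu /connect_step[y'u|[y2]]; first by rewrite -y'u (negPf nxy') in xu.
by rewrite fy' => -[<-] yu; exact: Hv.
Qed.

End ConnectedInside.

Section SpreadPower.
Variables (R : realType) (p n : nat).
Hypothesis p2 : (2 < p)%N.
Local Notation d := p.+2.
Local Notation V := (box d n).
Implicit Types (W : {set V}) (a b y z : V).

Definition vertices W : {fset vertex d} := [fset val x | x in W]%fset.

Definition spread_power W : R := (spread (vertices W))%:R ^- (p - 2).

Lemma mem_vertices W x : x \in W -> val x \in vertices W.
Proof. by move=> xW; apply/imfsetP; exists x. Qed.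

Lemma spread_power_ge0 W : 0 <= spread_power W.
Proof. by rewrite invr_ge0 exprn_ge0 ?ler0n. Qed.

Lemma spread_power_single x : 1 <= spread_power [set x]%SET.
Proof.
have -> : spread_power [set x]%SET = 1.
  rewrite /spread_power; have -> : vertices [set x]%SET = [fset val x]%fset.
    apply/fsetP => y; rewrite inE; apply/imfsetP/eqP => [[z /= ]|->].
      by rewrite inE => /eqP -> ->.
    by exists x => //=; rewrite inE.
  have := spread_fset1 (val x).
  have : (0 < spread [fset val x]%fset)%N.
    by apply: spread_gt0; apply/fset0Pn; exists (val x); rewrite inE.
  by case: (spread _) => [//|[|//]] _ _; rewrite expr1n invr1.
by [].
Qed.

Lemma spread_power_glue W1 W2 a b : a \in W1 -> b \in W2 ->
  spread_power W1 * spread_power W2 * decay R (p - 2) (val a) (val b) <=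
  spread_power (W1 :|: W2)%SET.
Proof.
move=> aW1 bW2; have a1 := mem_vertices aW1; have b2 := mem_vertices bW2.
have vU : vertices (W1 :|: W2)%SET = (vertices W1 `|` vertices W2)%fset.
  apply/fsetP => y; rewrite inE; apply/imfsetP/orP => [[z /=]|].
    by rewrite inE => /orP[] zW ->; [left|right]; exact: mem_vertices.
  by case=> /imfsetP[z /= zW ->]; exists z => //=; rewrite inE zW ?orbT.
have g1 : (0 < spread (vertices W1))%N by apply: spread_gt0; apply/fset0Pn; exists (val a).
have g2 : (0 < spread (vertices W2))%N by apply: spread_gt0; apply/fset0Pn; exists (val b).
have g3 : (0 < spread (vertices (W1 :|: W2)%SET))%N.
  by apply: spread_gt0; apply/fset0Pn; exists (val a); rewrite vU inE a1.
rewrite /spread_power /decay -!invfM -!exprMn -!natrM.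
rewrite lef_pV2 ?posrE ?exprn_gt0 ?ltr0n ?muln_gt0 ?g1 ?g2 //.
rewrite lerXn2r ?nnegrE ?ler0n // ler_nat vU; exact: spread_glue.
Qed.

Lemma sum_over_val (B : {set V}) (F : vertex d -> R) :
  \sum_(z in B) F (val z) = \sum_(z <- [seq val z | z in B]) F z.
Proof. by rewrite big_image. Qed.

End SpreadPower.

(** * The bound in finite boxes *)

Section FiniteBoxes.
Variables (R : realType) (p : nat).
Hypothesis p2 : (2 < p)%N.
Local Notation d := p.+2.

Definition inner n m : {set box d n} := [set x : box d n | val x \in box d m]%SET.

Lemma card_inner n m : (#|inner n m| <= #|` box d m|)%N.
Proof.
have inj : {in inner n m &, injective (fun x : box d n => val x)} by move=> x y _ _; exact: val_inj.
rewrite cardE -(size_map val) -[leqRHS]/(size (box d m)); apply: uniq_leq_size.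
  by rewrite map_inj_uniq ?enum_uniq //; exact: val_inj.
by move=> y /mapP[x]; rewrite mem_enum inE => xm ->.
Qed.

Lemma fsum_box_kernel n (eps : R) P : fsum (@box_kernel R p n eps) P =
  fsum (sunk (conductance R (@box_adj p n) finset.set0) eps) P /
  \prod_(x : box d n) (eps + \sum_(y : box d n) (nn (val x) (val y))%:R).
Proof.
rewrite /fsum mulr_suml; apply: eq_bigr => f _.
by rewrite /weight /box_kernel -prodf_div.
Qed.

Lemma killed_mean_fsum n (eps : R) (A : {set {set box d n}} -> bool) : 0 < eps ->
  killed_mean (@box_adj p n) eps (fun T => (A T)%:R) =
  fsum (@box_kernel R p n eps) (fun f => A (edges f)) / fsum (@box_kernel R p n eps) (fun _ => true).
Proof.
move=> eps0; rewrite !fsum_box_kernel.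
set D := \prod_(x : box d n) _.
have D0 : D != 0 by apply/prodf_neq0 => x _; rewrite gt_eqF // box_total.
rewrite invfM invrK mulrACA mulVf // mulr1 /killed_mean /partition_function; congr (_ / _).
by rewrite /fsum big_mkcondr; apply: eq_bigr => f _ /=; case: ifP; rewrite ?mulr1 ?mulr0.
Qed.

Lemma killed_joined_bound k : exists2 C : R, 0 <= C &
  forall n m (eps c0 : R) (W : {set box d n}), (m < n)%N -> 0 < eps <= 1 -> 0 <= c0 ->
  (2 * d)%:R * (d.+1%:R ^+ p * (n - m)%:R ^- p) <= eps * c0 ->
  (forall x z, x \in box d m -> z \in box d m -> c0 <= decay R p x z) ->
  (1 < #|W| <= k.+1)%N -> W \subset inner n m ->
  killed_mean (@box_adj p n) eps (fun T => (joined_inside (@box_adj p n) (inner n m) W T)%:R) <=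
    C * spread_power R W.
Proof.
have [K0 K0_ge0 [A A1 pot_box]] := box_potential R (ltnW (ltnW p2)).
(* inside the inner box c0 is dominated by decay p, whence the extra 1 *)
pose C0 : R := K0 * (d.+1%:R ^+ p + 1).
have C0_ge0 : 0 <= C0 by rewrite mulr_ge0 // addr_ge0 // exprn_ge0 // ler0n.
pose K : R := Num.max (conv_const R p) (conv3_const R p).
have K_ge0 : 0 <= K by rewrite le_max conv_const_ge0.
exists (join_const C0 K k.+1); first exact: join_const_ge0.
move=> n m eps c0 W mn eps01 c0_ge0 c0P c0_le Wk WB.
have /andP[eps0 _] := eps01.
rewrite killed_mean_fsum //; set B := inner n m.
pose w := @box_kernel R p n eps.
have w_ge0 (x : box d n) o : 0 <= w x o by exact: box_kernel_ge0.
have w_tot (x : box d n) : \sum_o w x o = 1 by exact: box_kernel_total.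
have w_kill (x : box d n) : 0 < w x None by exact: box_kernel_killed.
pose Phi (x z : box d n) := K0 * (pot A (coord R (val z) (val x)) + c0).
have Phi_ge0 (x z : box d n) : 0 <= Phi x z.
  by rewrite mulr_ge0 // addr_ge0 // ltW // pot_gt0 //; lra.
have Phi_super (x z : box d n) : z \in B -> (x == z)%:R + \sum_y w x (Some y) * Phi y z <= Phi x z.
  by rewrite inE => zm; exact: (pot_box n m eps c0).
pose g (x z : box d n) := decay R p (val x) (val z).
pose q (x z : box d n) := decay R (p - 2) (val x) (val z).
have Phi_le (x z : box d n) : x \in B -> z \in B -> Phi x z <= C0 * g x z.
  rewrite !inE => xm zm; rewrite /Phi /C0 -mulrA; apply: ler_wpM2l => //.
  rewrite mulrDl mul1r; apply: lerD; last exact: c0_le.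
  exact: pot_decay.
have g_ge0 (x z : box d n) : 0 <= g x z by exact: decay_ge0.
have q_ge0 (x z : box d n) : 0 <= q x z by exact: decay_ge0.
have us : uniq [seq val z | z in B] by rewrite map_inj_uniq ?enum_uniq //; exact: val_inj.
have sum_gg (a b : box d n) : a \in B -> b \in B -> \sum_(z in B) g a z * g b z <= K * q a b.
  move=> _ _; rewrite (sum_over_val B (fun z => decay R p (val a) z * decay R p (val b) z)).
  apply: le_trans (convolution_le R p2 _ _ us) _.
  by apply: ler_wpM2r; [exact: decay_ge0 | rewrite /K le_max lexx].
have sum_ggg (a b y : box d n) : a \in B -> b \in B -> y \in B ->
    \sum_(z in B) g a z * g b z * g z y <= K * q a b * (g a y + g b y).
  move=> _ _ _; rewrite (sum_over_val B (fun z => decay R p (val a) z * decay R p (val b) z * decay R p z (val y))).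
  apply: le_trans (convolution3_le R p2 _ _ _ us) _.
  apply: ler_wpM2r; first by rewrite addr_ge0 ?decay_ge0.
  by apply: ler_wpM2r; [exact: decay_ge0 | rewrite /K le_max lexx orbT].
have s_ge0 (X : {set box d n}) : 0 <= spread_power R X by exact: spread_power_ge0.
have single (x : box d n) : 1 <= spread_power R [set x]%SET by exact: spread_power_single.
have glue (W1 W2 : {set box d n}) (a b : box d n) : a \in W1 -> b \in W2 ->
    spread_power R W1 * spread_power R W2 * q a b <= spread_power R (W1 :|: W2)%SET.
  exact: spread_power_glue.
have bnd := joined_bound w_ge0 w_tot w_kill Phi_ge0 Phi_super C0_ge0 K_ge0 Phi_le
  g_ge0 sum_gg sum_ggg q_ge0 s_ge0 single glue Wk WB.
have Z0 : 0 < fsum w (fun _ => true).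
  rewrite fsum_box_kernel divr_gt0 //; first exact: partition_function_gt0.
  by apply: prodr_gt0 => x _; exact: box_total.
rewrite ler_pdivrMr //; apply: le_trans _ bnd.
apply: fsum_le => // f af; exact: joined_meets.
Qed.

Lemma decay_box_ge m (x z : vertex d) : x \in box d m -> z \in box d m ->
  ((1 + d * (2 * m))%:R : R) ^- p <= decay R p x z.
Proof.
move=> /mem_boxP xm /mem_boxP zm; rewrite /decay lef_pV2 ?posrE ?exprn_gt0 ?ltr0n //.
rewrite lerXn2r ?nnegrE ?ler0n // ler_nat /bracket leq_add2l /l1dist.
apply: leq_trans (_ : \sum_(i < d) 2 * m <= _)%N; last by rewrite sum_nat_const card_ord.
by apply: leq_sum => i _; have := xm i; have := zm i; move: (x ord0 i) (z ord0 i) => s t; clear; lia.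
Qed.

(** The ratio is of order n ^ (2 - p) / theta, because n is comparable to n - m. *)
Lemma correction_small (Q L theta : R) m : 0 < theta -> 0 <= Q -> 0 < L ->
  exists n0, forall n, (n0 <= n)%N -> (m < n)%N /\
    Q * (n - m)%:R ^- p / (theta / (n.*2.+1 ^ 2)%:R) <= L.
Proof.
move=> theta0 Q0 L0; pose X := 16 * Q / (theta * L).
have X0 : 0 <= X by rewrite divr_ge0 ?mulr_ge0 // ltW.
(* n >= 2 m + 1 makes the side 2 n + 1 of the box at most 4 (n - m) *)
exists (2 * m + 1 + Num.bound X)%N => n n0n; have mn : (m < n)%N by move: n0n; clear; lia.
split=> //; set t : R := (n - m)%:R.
have tX : X <= t.
  apply: le_trans (ltW (archi_boundP X0)) _; rewrite ler_nat; move: n0n; clear; lia.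
have t1 : 1 <= t by rewrite ler1n subn_gt0.
have t0 : 0 < t by lra.
have M2 : (n.*2.+1 ^ 2)%:R <= 16 * t ^+ 2.
  have -> : 16 * t ^+ 2 = ((4 * (n - m)) ^ 2)%:R by rewrite /t natrX natrM exprMn; ring.
  rewrite ler_nat leq_exp2r // -addnn; move: n0n; clear; lia.
rewrite invf_div mulrA [_ * _ / theta]mulrC -mulrA ler_pdivrMl //.
apply: (@le_trans _ _ (Q * t ^- p * (16 * t ^+ 2))).
  by rewrite mulrA; apply: ler_wpM2l => //; rewrite mulr_ge0 // invr_ge0 exprn_ge0 // ltW.
have tp : t ^- p * t ^+ 2 <= t^-1.
  rewrite -(subnK p2) exprD invfM -mulrA (_ : t ^- 3 * t ^+ 2 = t^-1); last by field; rewrite gt_eqF.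
  by rewrite ler_piMl ?invr_ge0 ?(ltW t0) // invf_le1 ?exprn_gt0 // exprn_ege1.
apply: (@le_trans _ _ (16 * Q * t^-1)).
  rewrite (_ : _ * (16 * _) = 16 * Q * (t ^- p * t ^+ 2)); last by ring.
  by apply: ler_wpM2l => //; rewrite mulr_ge0.
by rewrite ler_pdivrMr // [leRHS]mulrC; move: tX; rewrite /X ler_pdivrMr ?mulr_gt0.
Qed.

Definition local_const m : R :=
  let N := (#|` box d m| ^ 2)%N in 5 ^+ N * ((N * 2 ^ N)%:R * (2 * (d ^ 2)%:R)).

(** The rate theta / n ^ 2 is small enough for the trees to be close to the killed
    forests and large enough for the correction c0 to vanish. *)
Theorem free_joined_bound k : exists2 C : R, 0 <= C &
  forall m (theta : R), 0 < theta <= 1 -> exists n0, forall n, (n0 <= n)%N ->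
  forall W : {set box d n}, (1 < #|W| <= k.+1)%N -> W \subset inner n m ->
  #|[pred T | (T \in box_trees d n) && joined_inside (@box_adj p n) (inner n m) W T]|%:R /
    #|box_trees d n|%:R <= C * spread_power R W + local_const m * theta.
Proof.
have [C C0 bound] := killed_joined_bound k; exists C => // m theta /andP[theta0 theta1].
pose Q : R := (2 * d)%:R * d.+1%:R ^+ p.
have Q0 : 0 <= Q by rewrite mulr_ge0 ?exprn_ge0 ?ler0n.
have L0 : 0 < ((1 + d * (2 * m))%:R : R) ^- p by rewrite invr_gt0 exprn_gt0 ?ltr0n.
have [n0 n0P] := correction_small m theta0 Q0 L0; exists n0 => n /n0P[mn c0L] W Wk WB.
set M2 := (n.*2.+1 ^ 2)%N in c0L; set eps := theta / M2%:R in c0L.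
have M2_gt0 : 0 < M2%:R :> R by rewrite ltr0n expn_gt0.
have eps0 : 0 < eps by rewrite divr_gt0.
have eps1 : eps <= 1.
  by rewrite ler_pdivrMr // mul1r; apply: le_trans theta1 _; rewrite ler1n expn_gt0.
set c0 := _ / eps in c0L.
have c0_ge0 : 0 <= c0 by rewrite divr_ge0 ?mulr_ge0 ?invr_ge0 ?exprn_ge0 ?ler0n // ltW.
have c0P : (2 * d)%:R * (d.+1%:R ^+ p * (n - m)%:R ^- p) <= eps * c0.
  by rewrite /c0 [leRHS]mulrC divfK ?gt_eqF // /Q mulrA.
have killed := bound n m eps c0 W mn (introT andP (conj eps0 eps1)) c0_ge0 c0P
  (fun x z xm zm => le_trans c0L (decay_box_ge xm zm)) Wk WB.
have [T0|T_gt0] := posnP #|box_trees d n|.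
  rewrite T0 invr0 mulr0 addr_ge0 // ?mulr_ge0 ?spread_power_ge0 ?exprn_ge0 ?ler0n //; exact: ltW.
have [v0 _] : exists v0, v0 \in W.
  by apply/set0Pn; rewrite -card_gt0; case/andP: Wk => /ltnW.
have esym : symmetric (@box_adj p n) by move=> x y; exact: nn_sym.
have eirr : irreflexive (@box_adj p n) by move=> x; exact: nn_irr.
pose kappa : R := (d ^ 2 * n.*2.+1 ^ 2)%:R.
have poincare (u : box d n -> R) : \sum_x u x = 0 -> \sum_x u x ^+ 2 <=
    kappa * \sum_x \sum_y (box_adj x y)%:R * (u x - u y) ^+ 2 by exact: box_poincare.
have kappa0 : 0 <= kappa by rewrite ler0n.
have := free_le_killed esym eirr kappa0 poincare v0 eps0 (@inside_edges_set _ (@box_adj p n) (inner n m))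
  (joined_inside_local (@box_adj p n) (inner n m) W) T_gt0.
move/le_trans; apply; apply: lerD => //.
have -> : 2 * kappa * eps = 2 * (d ^ 2)%:R * theta.
  by rewrite /kappa natrM -/M2 /eps; field; rewrite gt_eqF.
set E := inside_edges _ _.
have EN : (#|E| <= #|` box d m| ^ 2)%N.
  by apply: leq_trans (card_inside_edges _ _) _; rewrite leq_exp2r // card_inner.
rewrite /local_const -!mulrA; apply: ler_pM.
- by rewrite exprn_ge0.
- by rewrite !mulr_ge0 ?ler0n // ltW.
- by rewrite ler_weXn2l // ler1n.
apply: ler_wpM2r; first by rewrite !mulr_ge0 ?ler0n // ltW.
by rewrite ler_nat leq_mul // leq_exp2l.
Qed.

End FiniteBoxes.

(** * Local connection events *)

Section LocalEvents.
Local Open Scope classical_set_scope.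
Variable d : nat.
Implicit Types (w : config d) (x y a b : vertex d) (W : {fset vertex d}) (m n : nat).

Definition inside_step m w : rel (vertex d) :=
  fun a b => [&& config_adj w a b, a \in box d m & b \in box d m].

Definition local_U m W : set (borel_config d) :=
  [set w | (forall x, x \in W -> x \in box d m) /\
     forall x y, x \in W -> y \in W ->
       exists2 q, path (inside_step m w) x q & last x q = y].

Lemma box_mono m n x : (m <= n)%N -> x \in box d m -> x \in box d n.
Proof.
by move=> mn /mem_boxP xm; apply/mem_boxP => i; exact: leq_trans (xm i) mn.
Qed.

Lemma uniform_bound (T : eqType) (Q : nat -> T -> Prop) (s : seq T) :
  (forall m n t, (m <= n)%N -> Q m t -> Q n t) ->
  (forall t, t \in s -> exists m, Q m t) -> exists m, forall t, t \in s -> Q m t.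
Proof.
move=> mono; elim: s => [|t s IH] H; first by exists 0%N.
have [|m1 H1] := IH; first by move=> t' t's; apply: H; rewrite inE t's orbT.
have [m2 H2] := H t (mem_head _ _); exists (maxn m1 m2) => t'; rewrite inE.
move=> /orP[/eqP ->|t's]; first exact: mono (leq_maxr _ _) H2.
exact: mono (leq_maxl _ _) (H1 _ t's).
Qed.

Lemma in_some_box x : exists m, x \in box d m.
Proof.
exists (\max_(i < d) `|x ord0 i|)%N; apply/mem_boxP => i.
by rewrite (bigD1 i) //= leq_maxl.
Qed.

Lemma in_common_box (s : seq (vertex d)) : exists m, forall x, x \in s -> x \in box d m.
Proof.
apply: (uniform_bound (Q := fun m x => x \in box d m)) => [m n x|x _].
  exact: box_mono.
exact: in_some_box.
Qed.

Lemma inside_step_mono m n w a b : (m <= n)%N -> inside_step m w a b -> inside_step n w a b.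
Proof. by move=> mn /and3P[ab am bm]; rewrite /inside_step ab !(box_mono mn). Qed.

Lemma local_U_mono W : {homo (fun m => local_U m W) : m n / (m <= n)%N >-> (m <= n)%O}.
Proof.
move=> m n mn; apply/subsetPset => w [Wm H]; split=> [x xW|x y xW yW].
  exact: box_mono mn (Wm _ xW).
have [q pq lq] := H x y xW yW; exists q => //.
by apply: sub_path pq => a b; exact: inside_step_mono.
Qed.

Lemma event_U_bigcup W : event_U W = \bigcup_m local_U m W.
Proof.
apply/seteqP; split=> w; last first.
  case=> m _ [_ H] x y xW yW; have [q pq lq] := H x y xW yW; exists q => //.
  by apply: sub_path pq => a b /and3P[].
move=> H.
pose Q m (t : vertex d * vertex d) := exists2 q, path (inside_step m w) t.1 q & last t.1 q = t.2.
have [m1 Wm1] := in_common_box W.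
have [m2 Hm2] : exists m, forall t, t \in [seq (x, y) | x <- W, y <- W] -> Q m t.
  apply: uniform_bound => [m n [x y] mn [q pq lq]|[x y]].
    by exists q => //; apply: sub_path pq => a b; exact: inside_step_mono.
  move=> /allpairsP[[x' y'] /= [xW yW [-> ->]]]; have [q pq lq] := H x' y' xW yW.
  have [m qm] := in_common_box (x' :: q); exists m; exists q => //=.
  elim: q x' {xW lq} pq qm => [//|a q IH] x' /= /andP[xa pq] qm.
  rewrite /inside_step xa !qm ?inE ?eqxx ?orbT //=; apply: IH => // b bq.
  by apply: qm; rewrite inE bq orbT.
exists (maxn m1 m2) => //; split=> [x xW|x y xW yW].
  exact: box_mono (leq_maxl _ _) (Wm1 _ xW).
have [|q pq lq] := Hm2 (x, y); first by apply/allpairsP; exists (x, y).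
by exists q => //; apply: sub_path pq => a b; apply: inside_step_mono; exact: leq_maxr.
Qed.

Lemma near_agree w (s : seq (edge d)) :
  @nbhs _ (config d) w [set w' | forall e, e \in s -> w' e = w e].
Proof.
have nF : Filter (@nbhs _ (config d) w) by exact: nbhs_filter.
elim: s => [|e s IH].
  by apply: filterS filterT => w' _ e.
have He : @nbhs _ (config d) w [set w' : config d | w' e = w e].
  have := @proj_continuous (edge d) (fun=> bool) e w.
  move=> /(_ [set w e]) H; apply: H.
  exact: discrete_set1.
apply: filterS (filterI He IH) => w' [we ws] e'; rewrite inE => /orP[/eqP -> //|].
exact: ws.
Qed.

Definition box_edges m : seq (edge d) := [seq (x, i) | x <- box d m, i <- enum 'I_d].

Lemma local_U_agree m W w w' : (forall e, e \in box_edges m -> w' e = w e) ->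
  local_U m W w -> local_U m W w'.
Proof.
move=> agr [Wm H]; split=> // x y xW yW; have [q pq lq] := H x y xW yW; exists q => //.
apply: sub_path pq => a b /and3P[/existsP[i ab] am bm]; apply/and3P; split=> //.
have inE' c : c \in box d m -> (c, i) \in box_edges m.
  by move=> cm; apply/allpairsP; exists (c, i); rewrite mem_enum.
by apply/existsP; exists i; rewrite !agr ?inE'.
Qed.

Lemma local_U_near m W w :
  @nbhs _ (config d) w [set w' | local_U m W w' <-> local_U m W w].
Proof.
apply: filterS (near_agree w (box_edges m)) => w' agr; split; apply: local_U_agree => e es.
  by rewrite agr.
exact: agr.
Qed.

Lemma open_local_U m W : @open (config d) (local_U m W).
Proof.
rewrite openE => w Uw; apply: filterS (local_U_near m W w) => w' [_ H]; exact: H.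
Qed.

Lemma measurable_local_U m W : measurable (local_U m W).
Proof. by apply: sub_sigma_algebra; exact: open_local_U. Qed.

Lemma measurable_event_U W : measurable (event_U W).
Proof. by rewrite event_U_bigcup; apply: bigcupT_measurable => m; exact: measurable_local_U. Qed.

Lemma continuous_local_U (R : realType) m W : continuous (\1_(local_U m W) : config d -> R).
Proof.
move=> w; apply: cvg_near_cst; apply: filterS (local_U_near m W w) => w' H.
rewrite !indicE; congr (_ %:R); congr nat_of_bool.
by apply/idP/idP; rewrite !inE => /H.
Qed.

End LocalEvents.

(** * The limit of large boxes *)

Section SpanningForestBound.
Local Open Scope classical_set_scope.
Variables (R : realType) (p : nat).
Hypothesis p2 : (2 < p)%N.
Local Notation d := p.+2.
Implicit Types (W : {fset vertex d}).

Definition in_box n W : {set box d n} := [set x : box d n | val x \in W]%SET.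

Lemma vertices_in_box n W : (forall x, x \in W -> x \in box d n) -> vertices (in_box n W) = W.
Proof.
move=> Wn; apply/fsetP => y; apply/imfsetP/idP => [[x /=]|yW]; first by rewrite inE => xW ->.
by exists (FSetSub (Wn _ yW)) => //=; rewrite inE.
Qed.

Lemma card_in_box n W : (forall x, x \in W -> x \in box d n) -> #|in_box n W| = #|` W|.
Proof.
move=> Wn; rewrite cardE -(size_map val) -[RHS]/(size W); apply/perm_size/uniq_perm.
- by rewrite map_inj_uniq ?enum_uniq //; exact: val_inj.
- exact: fset_uniq.
move=> y; apply/mapP/idP => [[x]|yW]; first by rewrite mem_enum inE => xW ->.
by exists (FSetSub (Wn _ yW)); rewrite // mem_enum inE.
Qed.

Lemma tree_config_adj n (T : {set {set box d n}}) (x : box d n) b :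
  config_adj (tree_config T) (val x) b ->
  exists2 y : box d n, val y = b & adj T x y.
Proof.
have key (a c : vertex d) (i : 'I_d) : tree_config T (a, i) -> c = edge_head (a, i) ->
    exists x' y' : box d n, [/\ val x' = a, val y' = c & adj T x' y'].
  move=> /existsP[x' /existsP[y' /and3P[/eqP xa /eqP yc aT]]] ->.
  by exists x', y'.
case/existsP => i /orP[]/andP[aT /eqP bE]; have [x' [y' [xE yE xy]]] := key _ _ _ aT bE.
  by exists y' => //; rewrite -(val_inj xE).
by exists x' => //; rewrite adj_sym -(val_inj yE) .
Qed.

Lemma local_U_joined m n W (T : {set {set box d n}}) : (m <= n)%N -> T \in box_trees d n ->
  local_U m W (tree_config T) -> joined_inside (@box_adj p n) (inner p n m) (in_box n W) T.
Proof.
move=> mn; rewrite inE => /andP[_ /forallP Tn] [Wm H]; apply/joined_insideP => x y.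
rewrite !inE => xW yW; have [q pq lq] := H _ _ xW yW.
elim: q x {xW} pq lq => [|b q IH] x /=; first by move=> _ /val_inj ->; exact: connect0.
move=> /andP[/and3P[xb xm bm] pq] lq.
have [z zE xz] := tree_config_adj xb; rewrite -zE in pq lq bm.
apply: connect_trans (IH z pq lq); apply: connect1.
by rewrite /inside_adj xz !inE xm bm !andbT; have /forallP/(_ z)/implyP := Tn x; apply.
Qed.

Lemma ust_mean_local_U m n W : (m <= n)%N ->
  ust_mean n (\1_(local_U m W) : config d -> R) <=
  #|[pred T | (T \in box_trees d n) && joined_inside (@box_adj p n) (inner p n m) (in_box n W) T]|%:R
    / #|box_trees d n|%:R.
Proof.
move=> mn; apply: ler_wpM2r; first by rewrite invr_ge0 ler0n.
rewrite -sum1_card natr_sum big_mkcondr /=; apply: ler_sum => T Tt.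
rewrite indicE; have [Ut|] := boolP (_ \in _); last by case: ifP.
by rewrite (local_U_joined mn Tt) //; move: Ut; rewrite inE.
Qed.

(** Let n tend to infinity, then theta to 0, then m to infinity. *)
Theorem forest_bound k : exists2 C : R, 0 <= C &
  forall P : probability (borel_config d) R, is_USF P ->
  forall W, (1 < #|` W| <= k.+1)%N ->
    (P (event_U W) <= (C * (spread W)%:R ^- (p - 2))%:E)%E.
Proof.
have [C C0 bound] := free_joined_bound R p2 k; exists C => // P usf W Wk.
set s : R := (spread W)%:R ^- (p - 2).
have local m : (P (local_U m W) <= (C * s)%:E)%E.
  have [Wm|nWm] := pselect (forall x, x \in W -> x \in box d m); last first.
    rewrite (_ : local_U m W = set0) ?measure0; last by apply/seteqP; split => // w [].
    by rewrite lee_fin mulr_ge0 // invr_ge0 exprn_ge0 // ler0n.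
  have limit := usf _ (@continuous_local_U d R m W) (ex_intro _ 1 _).
  have {}limit : ((ust_mean n (\1_(local_U m W) : config d -> R))%:E @[n --> \oo] --> P (local_U m W))%classic.
    rewrite -(expectation_indic P (measurable_local_U m W)).
    by apply: limit => w; rewrite indicE; case: (_ \in _); rewrite ?normr1 ?normr0.
  have Cm0 : 0 <= local_const R p m by rewrite !mulr_ge0 ?exprn_ge0 ?ler0n.
  apply/lee_addgt0Pr => e e0.
  pose theta : R := Num.min 1 (e / (local_const R p m + 1)).
  have theta01 : 0 < theta <= 1.
    by rewrite /theta lt_min ltr01 ge_min lexx andbT divr_gt0 // ltr_wpDl.
  have theta_e : local_const R p m * theta <= e.
    apply: (@le_trans _ _ ((local_const R p m + 1) * theta)).
      by rewrite ler_wpM2r ?lerDl //; case/andP: theta01 => /ltW.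
    by rewrite mulrC -ler_pdivlMr ?ltr_wpDl // /theta ge_min lexx orbT.
  have [n0 n0P] := bound m theta theta01.
  apply: (cvge_to_le limit); exists (maxn n0 m) => // n /= n0n.
  have mn : (m <= n)%N by apply: leq_trans n0n; exact: leq_maxr.
  have Wn x : x \in W -> x \in box d n by move=> xW; exact: box_mono mn (Wm x xW).
  rewrite -EFinD lee_fin; apply: le_trans (ust_mean_local_U W mn) _.
  have Wk' : (1 < #|in_box n W| <= k.+1)%N by rewrite card_in_box.
  have WB : in_box n W \subset inner p n m.
    by apply/fintype.subsetP => x; rewrite !inE; exact: Wm.
  apply: le_trans (n0P n (leq_trans (leq_maxl _ _) n0n) _ Wk' WB) _.
  by rewrite /spread_power vertices_in_box // lerD2l.
have lim := nondecreasing_cvg_mu (mu := P) (fun m => measurable_local_U m W) _ (@local_U_mono d W).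
rewrite event_U_bigcup; apply: (cvge_to_le (lim _)).
  by rewrite -event_U_bigcup; exact: measurable_event_U.
by apply: nearW => m; exact: local.
Qed.

End SpanningForestBound.

Theorem theorem4p3 (R : realType) (d k : nat) :
  exists C : R, forall P : probability (borel_config d) R, is_USF P ->
    forall W : {fset vertex d}, W != fset0 -> #|` W| = k ->
      (P (event_U W) <= (C * (spread W)%:R ^ (4%:Z - d%:Z))%:E)%E.
Proof.
have small (P : probability (borel_config d) R) (W : {fset vertex d}) (C : R) : 1 <= C ->
    1 <= (spread W)%:R ^ (4%:Z - d%:Z) :> R ->
    (P (event_U W) <= (C * (spread W)%:R ^ (4%:Z - d%:Z))%:E)%E.
  move=> C1 s1; apply: le_trans (probability_le1 P (measurable_event_U W)) _.
  by rewrite lee_fin; apply: mulr_ege1.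
have [d4|d5] := leqP d 4.
  exists 1 => P _ W W0 _; apply: small => //.
  rewrite subzn // -exprnP exprn_ege1 // ler1n; exact: spread_gt0.
case: d d5 small => [|[|p]] // p2 small.
have [C C0 bound] := forest_bound R (p2 : (2 < p)%N) k; exists (C + 1) => P usf W W0 Wk.
have powE : (spread W)%:R ^ (4%:Z - p.+2%:Z) = (spread W)%:R ^- (p - 2) :> R.
  rewrite (_ : 4%:Z - p.+2%:Z = - (p - 2)%N%:Z); first by rewrite exprnN.
  by move: p2; clear; lia.
have s0 : 0 <= (spread W)%:R ^- (p - 2) :> R by rewrite invr_ge0 exprn_ge0 // ler0n.
have [k1|k2] := leqP #|` W| 1.
  have /cardfs1P[x WE] : #|` W| == 1%N by rewrite eqn_leq k1 cardfs_gt0.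
  apply: small; first by rewrite lerDr.
  rewrite powE; have := spread_gt0 W0; have := spread_fset1 x; rewrite -WE.
  by case: (spread W) => [//|[|//]] _ _; rewrite expr1n invr1.
apply: le_trans (bound P usf W _) _; first by rewrite k2 Wk leqnSn.
by rewrite powE lee_fin; apply: ler_wpM2r => //; rewrite lerDl.
Qed.
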